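(* Let $E=(E^0,E^1,r,s)$ be a finite directed graph with at least one cycle, and view $\mathcal{T}C^*(E)$ as a $C^*$-subalgebra of $\mathcal{T}(X(E^\infty))$ via the injective homomorphism $\pi_{S,P}$ with $s_e\mapsto\psi(\chi_{Z(e)})$, $p_v\mapsto\pi(\chi_{Z(v)})$. Let $A$ be the vertex matrix of $E$, let $\sigma$ be the shift on $E^\infty$, and let $\beta_c:=\limsup_{n\to\infty}\big(n^{-1}\ln(\max_{z\in E^\infty}|\sigma^{-n}(z)|)\big)$. Let $\alpha$ denote, on each of $\mathcal{T}C^*(E)$ and $\mathcal{T}(X(E^\infty))$, the action of $\mathbb{R}$ given in terms of the gauge action by $\alpha_t=\gamma_{e^{it}}$. Suppose that $\beta>\max(\beta_c,\ln\rho(A))$. Then every KMS$_\beta$ state of $(\mathcal{T}C^*(E),\alpha)$ is the restriction of a KMS$_\beta$ state of $(\mathcal{T}(X(E^\infty)),\alpha)$.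
   Context: Graph conventions: a path is a sequence of edges $\mu=\mu_1\mu_2\cdots$ with $s(\mu_i)=r(\mu_{i+1})$. $E^\infty$ is the set of infinite paths $z=z_1z_2\cdots$, with $r(z):=r(z_1)$. The cylinder sets $Z(\mu)=\{z\in E^\infty:z_i=\mu_i\text{ for }i\le|\mu|\}$ (with $Z(v)=\{z:r(z)=v\}$ for a vertex $v$) are a basis of compact open sets for a compact Hausdorff topology on $E^\infty$. The shift $\sigma(z)=z_2z_3\cdots$ is a local homeomorphism. The vertex matrix has entries $A(v,w)=|\{e\in E^1:r(e)=v,s(e)=w\}|$; $\rho(A)$ is its spectral radius. $X(E^\infty)$ is the Hilbert bimodule over $C(E^\infty)$ with underlying space $C(E^\infty)$, actions $(a\cdot x\cdot b)(z)=a(z)x(z)b(\sigma(z))$ and inner product $\langle x,y\rangle(z)=\sum_{\sigma(w)=z}\overline{x(w)}y(w)$. For a Hilbert bimodule $X$ over a $C^*$-algebra $A_0$, a representation $(\psi,\pi)$ is a linear map $\psi$ on $X$ and a homomorphism $\pi$ of $A_0$ into a $C^*$-algebra with $\psi(a\cdot x\cdot b)=\pi(a)\psi(x)\pi(b)$ and $\pi(\langle x,y\rangle)=\psi(x)^*\psi(y)$; the Toeplitz algebra $\mathcal{T}(X)$ is generated by a universal representation, denoted $(\psi,\pi)$, and has gauge action $\gamma_z(\psi(x))=z\psi(x)$, $\gamma_z(\pi(a))=\pi(a)$. $\mathcal{T}C^*(E)$ is the universal $C^*$-algebra generated by mutually orthogonal projections $\{p_v:v\in E^0\}$ and partial isometries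 $\{s_e:e\in E^1\}$ with $s_e^*s_e=p_{s(e)}$ and $p_v\ge\sum_{r(e)=v}s_es_e^*$; its gauge action satisfies $\gamma_z(s_e)=zs_e$, $\gamma_z(p_v)=p_v$. For an action $\alpha$ of $\mathbb{R}$ on a $C^*$-algebra $B$, $a\in B$ is analytic if $t\mapsto\alpha_t(a)$ extends to an entire function $z\mapsto\alpha_z(a)$. A state $\phi$ of $B$ is a KMS$_\beta$ state of $(B,\alpha)$ if $\phi(ab)=\phi(b\,\alpha_{i\beta}(a))$ for all analytic $a,b$. *)

(* Defs.v *)
From HB Require Import structures.
From mathcomp Require Import all_boot all_order all_algebra.
From mathcomp Require Import finmap.
From mathcomp Require Import all_classical all_reals topology normedtype sequences derive exp trigo numfun.
From mathcomp Require Import complex.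

Set Implicit Arguments.
Unset Strict Implicit.
Unset Printing Implicit Defensive.

Import Order.TTheory GRing.Theory Num.Theory.
Import numFieldNormedType.Exports.

Local Open Scope classical_set_scope.
Local Open Scope ring_scope.
Local Open Scope complex_scope.

(* C*-algebras are not assumed to be unital, so that the multiplication is    *)
(* not the one of a MathComp ring.                                            *)
HB.mixin Record Lmodule_isStarAlgebra (R : realType) A
    of GRing.Lmodule R[i] A := {
  amul : A -> A -> A;
  adj : A -> A;
  amulA : forall a b c, amul a (amul b c) = amul (amul a b) c;
  amulDl : forall a b c, amul (a + b) c = amul a c + amul b c;
  amulDr : forall a b c, amul a (b + c) = amul a b + amul a c;
  amulZl : forall (k : R[i]) a b, amul (k *: a) b = k *: amul a b;
  amulZr : forall (k : R[i]) a b, amul a (k *: b) = k *: amul a b;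
  adjD : forall a b, adj (a + b) = adj a + adj b;
  adjZ : forall (k : R[i]) a, adj (k *: a) = Num.conj k *: adj a;
  adjM : forall a b, adj (amul a b) = amul (adj b) (adj a);
  adjK : forall a, adj (adj a) = a
}.

#[short(type="starAlgType")]
HB.structure Definition StarAlgebra (R : realType) :=
  {A of Lmodule_isStarAlgebra R A & GRing.Lmodule R[i] A}.

HB.mixin Record StarAlgebra_isCStar (R : realType) A
    of StarAlgebra R A & CompleteNormedModule R[i] A := {
  cnormM : forall a b : A, `|amul a b| <= `|a| * `|b|;
  cnorm_adjM : forall a : A, `|amul (adj a) a| = `|a| ^+ 2
}.

#[short(type="cstarAlgType")]
HB.structure Definition CStarAlgebra (R : realType) :=
  {A of StarAlgebra R A & CompleteNormedModule R[i] A
      & StarAlgebra_isCStar R A}.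

Notation "a ** b" := (amul a b) (at level 40, left associativity) : ring_scope.

Section StarHom.
Variables (R : realType) (A B : starAlgType R).

Definition star_hom (f : A -> B) :=
  [/\ linear f, forall a b, f (a ** b) = f a ** f b
    & forall a, f (adj a) = adj (f a)].

End StarHom.

Section CStarNotions.
Variables (R : realType) (B : cstarAlgType R).

Definition cle (a b : B) := exists c : B, b - a = adj c ** c.

Definition cstar_subalgebra (S : set B) :=
  [/\ closed S, S 0,
      forall (k : R[i]) a b, S a -> S b -> S (k *: a + b),
      forall a b, S a -> S b -> S (a ** b)
    & forall a, S a -> S (adj a)].

Definition cstar_generates (G : set B) :=
  forall S, cstar_subalgebra S -> G `<=` S -> S = setT.

Definition state (phi : B -> R[i]^o) :=
  [/\ linear phi, forall a, 0 <= phi (adj a ** a)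
    & sup [set complex.Re `|phi a| | a in [set a : B | `|a| <= 1]] = 1].

(* gamma is only meaningful on the unit circle. Complex scalars are typed in  *)
(* R[i]^o whenever a topology is needed: R[i] itself carries none.            *)
Definition circle_action (gamma : R[i]^o -> B -> B) :=
  [/\ forall z, `|z| = 1 -> star_hom (gamma z),
      forall a, gamma 1 a = a,
      forall z w a, `|z| = 1 -> `|w| = 1 ->
        gamma (z * w) a = gamma z (gamma w a)
    & forall a, {within [set z | `|z| = 1], continuous (gamma ^~ a)}].

Definition dynamics (gamma : R[i]^o -> B -> B) (t : R) : B -> B :=
  gamma (cos t +i* sin t).

Definition entire_extension (alpha : R -> B -> B) (a : B)
    (F : R[i]^o -> B) :=
  (forall z, derivable F z 1) /\ (forall t : R, F t%:C = alpha t a).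

Definition analytic_elt (alpha : R -> B -> B) (a : B) :=
  exists F, entire_extension alpha a F.

(* F is the unique entire extension of t |-> alpha_t a, so F (i beta) is      *)
(* alpha_{i beta} a                                                           *)
Definition KMS_state (alpha : R -> B -> B) (beta : R) (phi : B -> R[i]^o) :=
  state phi /\
  forall a b F, analytic_elt alpha b -> entire_extension alpha a F ->
    phi (a ** b) = phi (b ** F (beta *i)).

End CStarNotions.

Section ContinuousFunctions.
Variables (R : realType) (X : topologicalType).

Definition contfun := continuousType X R[i]^o.

HB.instance Definition _ := gen_eqMixin contfun.
HB.instance Definition _ := gen_choiceMixin contfun.

Implicit Types x y : contfun.

Lemma contfunP x y : (forall z, x z = y z) -> x = y.
Proof. by move=> xy; apply/continuousEP. Qed.

Lemma cadd_continuous x y : continuous (fun z => x z + y z : R[i]^o).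
Proof. by move=> z; apply: cvgD; exact: cts_fun. Qed.

Lemma copp_continuous x : continuous (fun z => - x z : R[i]^o).
Proof. by move=> z; apply: cvgN; exact: cts_fun. Qed.

Lemma cmul_continuous x y : continuous (fun z => x z * y z : R[i]^o).
Proof. by move=> z; apply: cvgM; exact: cts_fun. Qed.

Lemma cscale_continuous (k : R[i]) x :
  continuous (fun z => k * x z : R[i]^o).
Proof. by move=> z; apply: cvgM; [exact: cvg_cst|exact: cts_fun]. Qed.

Lemma conj_continuous : continuous (fun k : R[i]^o => Num.conj k : R[i]^o).
Proof.
move=> k.
apply/(@cvgrPdist_lt R[i] R[i]^o R[i]^o (nbhs k) _
  (fun k : R[i]^o => Num.conj k : R[i]^o) (Num.conj k)) => e e0.
near=> l; rewrite -rmorphB [ltLHS]norm_conjC; near: l.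
by apply: (@cvgr_dist_lt _ R[i]^o _ (nbhs k) _ idfun); first exact: cvg_id.
Unshelve. all: by end_near. Qed.

Lemma cconj_continuous x : continuous (fun z => Num.conj (x z) : R[i]^o).
Proof.
move=> z; apply: (@continuous_comp _ _ _ x); first exact: cts_fun.
exact: conj_continuous.
Qed.

Lemma czero_continuous : continuous (fun _ : X => 0 : R[i]^o).
Proof. by move=> z; exact: cvg_cst. Qed.

Definition cadd x y : contfun := mkcts (@cadd_continuous x y).
Definition copp x : contfun := mkcts (@copp_continuous x).
Definition czero : contfun := mkcts czero_continuous.
Definition cscale (k : R[i]) x : contfun := mkcts (@cscale_continuous k x).
Definition cmul x y : contfun := mkcts (@cmul_continuous x y).
Definition cconj x : contfun := mkcts (@cconj_continuous x).

Let caddA : associative cadd.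
Proof. by move=> x y z; apply: contfunP => t; exact: addrA. Qed.
Let caddC : commutative cadd.
Proof. by move=> x y; apply: contfunP => t; exact: addrC. Qed.
Let cadd0 : left_id czero cadd.
Proof. by move=> x; apply: contfunP => t; exact: add0r. Qed.
Let caddN : left_inverse czero copp cadd.
Proof. by move=> x; apply: contfunP => t; exact: addNr. Qed.

HB.instance Definition _ :=
  GRing.isZmodule.Build contfun caddA caddC cadd0 caddN.

Let cscaleA k l x : cscale k (cscale l x) = cscale (k * l) x.
Proof. by apply: contfunP => t; exact: mulrA. Qed.
Let cscale1 : left_id 1 cscale.
Proof. by move=> x; apply: contfunP => t; exact: mul1r. Qed.
Let cscaleDr : right_distributive cscale +%R.
Proof. by move=> k x y; apply: contfunP => t; exact: mulrDr. Qed.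
Let cscaleDl x : {morph cscale^~ x : k l / k + l}.
Proof. by move=> k l; apply: contfunP => t; exact: mulrDl. Qed.

HB.instance Definition _ :=
  GRing.Zmodule_isLmodule.Build R[i] contfun cscaleA cscale1 cscaleDr cscaleDl.

Let cmulA x y z : cmul x (cmul y z) = cmul (cmul x y) z.
Proof. by apply: contfunP => t; exact: mulrA. Qed.
Let cmulDl x y z : cmul (x + y) z = cmul x z + cmul y z.
Proof. by apply: contfunP => t; exact: mulrDl. Qed.
Let cmulDr x y z : cmul x (y + z) = cmul x y + cmul x z.
Proof. by apply: contfunP => t; exact: mulrDr. Qed.
Let cmulZl (k : R[i]) x y : cmul (k *: x) y = k *: cmul x y.
Proof. by apply: contfunP => t; symmetry; exact: mulrA. Qed.
Let cmulZr (k : R[i]) x y : cmul x (k *: y) = k *: cmul x y.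
Proof. by apply: contfunP => t; exact: mulrCA. Qed.
Let cconjD x y : cconj (x + y) = cconj x + cconj y.
Proof. by apply: contfunP => t; exact: rmorphD. Qed.
Let cconjZ (k : R[i]) x : cconj (k *: x) = Num.conj k *: cconj x.
Proof. by apply: contfunP => t; exact: rmorphM. Qed.
Let cconjM x y : cconj (cmul x y) = cmul (cconj y) (cconj x).
Proof.
by apply: contfunP => t; exact: etrans (rmorphM _ _ _) (mulrC _ _).
Qed.
Let cconjK x : cconj (cconj x) = x.
Proof. by apply: contfunP => t; exact: conjCK. Qed.

HB.instance Definition _ := Lmodule_isStarAlgebra.Build R contfun
  cmulA cmulDl cmulDr cmulZl cmulZr cconjD cconjZ cconjM cconjK.

End ContinuousFunctions.
(* Multiple edges and loops are allowed, and paths go against the edges:      *)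
(* e f is a path when src e = rng f.                                          *)
Record digraph := Digraph {
  vertex : finType;
  edge : finType;
  rng : edge -> vertex;
  src : edge -> vertex
}.

Section Paths.
Variable E : digraph.

Definition composable : rel (edge E) := fun e f => src e == rng f.

(* The cycle may revisit a vertex, which does not affect existence *)
Definition has_cycle := exists c : seq (edge E), c != [::] /\ cycle composable c.

(* z_{i+1} in the usual 1-based indexing is z i here *)
Record inf_path := InfPath {
  ipath :> nat -> edge E;
  ipathP : forall i, src (ipath i) = rng (ipath i.+1)
}.

HB.instance Definition _ := gen_eqMixin inf_path.
HB.instance Definition _ := gen_choiceMixin inf_path.

Implicit Types (z w : inf_path) (mu : seq (edge E)).

Lemma inf_pathP z w : (forall i, z i = w i) -> z = w.
Proof.
case: z w => [z zP] [w wP] /= /funext zw; subst w; congr InfPath.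
exact: Prop_irrelevance.
Qed.

Definition irng z : vertex E := rng (z 0%N).

Definition shift_path z : inf_path :=
  InfPath (fun i => ipathP z i.+1).

Definition cylinder mu : set inf_path :=
  [set z | mkseq z (size mu) = mu].

Definition vcylinder (v : vertex E) : set inf_path := [set z | irng z = v].

Definition cylinders : set (set inf_path) :=
  [set vcylinder v | v in setT] `|`
  [set cylinder mu | mu in [set mu | mu != [::] /\ sorted composable mu]].

Lemma cylinder_mkseq z w n :
  cylinder (mkseq z n) w <-> forall i, (i < n)%N -> w i = z i.
Proof.
rewrite /cylinder /mkset size_mkseq; split => [wz i ni|wz].
  by rewrite -(nth_mkseq (z 0%N) w ni) wz nth_mkseq.
by apply/eq_in_map => i; rewrite mem_iota add0n => /andP[_ /wz].
Qed.

Lemma prefix_cylinder z n : cylinders (cylinder (mkseq z n.+1)).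
Proof.
right; exists (mkseq z n.+1) => //; split => //.
apply/(sortedP (z 0%N)) => i; rewrite size_mkseq => ni.
by rewrite !nth_mkseq ?(ltnW ni)//; apply/eqP; exact: ipathP.
Qed.

Lemma cylindersP A z : cylinders A -> A z ->
  exists n, forall w, (forall i, (i < n.+1)%N -> w i = z i) -> A w.
Proof.
case=> [[v _ <-] zv|[mu [mu0 _] <-] zmu].
  by exists 0%N => u uz; rewrite -zv /vcylinder /= /irng uz.
exists (size mu) => u uz; rewrite -zmu; apply/cylinder_mkseq => i imu.
exact/uz/ltnW.
Qed.

Let cylinders_cover : \bigcup_(A in cylinders) id A = setT.
Proof.
apply/seteqP; split => // z _; exists (vcylinder (irng z)) => //.
by left; exists (irng z).
Qed.

Let cylinders_join (A B : set inf_path) z : cylinders A -> cylinders B ->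
  id A z -> id B z ->
  exists C, [/\ cylinders C, id C z & id C `<=` id A `&` id B].
Proof.
move=> cA cB /(cylindersP cA)[m mA] /(cylindersP cB)[n nB].
exists (cylinder (mkseq z (maxn m n).+1)); split.
- exact: prefix_cylinder.
- exact/cylinder_mkseq.
move=> w /cylinder_mkseq wz; split.
  by apply: mA => i im; apply: wz; apply: leq_trans im _; rewrite ltnS leq_maxl.
by apply: nB => i im; apply: wz; apply: leq_trans im _; rewrite ltnS leq_maxr.
Qed.

HB.instance Definition _ :=
  isBaseTopological.Build inf_path cylinders_cover cylinders_join.

Lemma cylinder_open A : cylinders A -> open A.
Proof.
move=> cA; exists [set A]; first by move=> _ ->.
by rewrite bigcup_set1.
Qed.

Lemma nbhs_inf_pathP z (U : set inf_path) : nbhs z U <->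
  exists n, forall w, (forall i, (i < n.+1)%N -> w i = z i) -> U w.
Proof.
split=> [|[n zU]].
  rewrite nbhsE => -[V [[D Dc <-] [A DA Az]] VU].
  have [n nA] := cylindersP (Dc _ DA) Az; exists n.
  by move=> w /nA Aw; apply: VU; exists A.
apply: (@filterS _ (nbhs z) _ (cylinder (mkseq z n.+1))).
  by move=> w /cylinder_mkseq; exact: zU.
apply: open_nbhs_nbhs; split; first exact/cylinder_open/prefix_cylinder.
exact/cylinder_mkseq.
Qed.

Lemma cylinder_closed A : cylinders A -> closed A.
Proof.
move=> cA; rewrite -openC openE => z nAz; apply/nbhs_inf_pathP.
case: cA nAz => [[v _ <-] zv|[mu [mu0 _] <-] zmu].
  exists 0%N => w wz wv; apply: zv.
  by rewrite -wv /vcylinder /= /irng wz.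
exists (size mu) => w wz wmu; apply: zmu; rewrite -wmu.
apply/cylinder_mkseq => i imu; symmetry; exact/wz/ltnW.
Qed.

Lemma shift_path_continuous : continuous shift_path.
Proof.
move=> z U /nbhs_inf_pathP[n zU]; apply/nbhs_inf_pathP; exists n.+1 => w wz.
by apply: zU => i ni; exact: wz.
Qed.

(* e z, with the junk value z when it is not a path *)
Definition pcons_fun (e : edge E) z (i : nat) : edge E :=
  if src e == irng z then (if i is j.+1 then z j else e) else z i.

Let pcons_subproof e z i : src (pcons_fun e z i) = rng (pcons_fun e z i.+1).
Proof.
rewrite /pcons_fun; case: eqP => [ez|_]; last exact: ipathP.
by case: i => [|i]; [rewrite ez|exact: ipathP].
Qed.

Definition pcons e z := InfPath (pcons_subproof e z).

Lemma pcons_continuous e : continuous (pcons e).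
Proof.
move=> z U /nbhs_inf_pathP[n zU]; apply/nbhs_inf_pathP; exists n => w wz.
apply: zU => i ni; rewrite /= /pcons_fun /irng wz//.
case: eqP => [_|_]; last exact: wz.
by case: i ni => // i ni; apply: wz; exact: ltnW.
Qed.

Lemma pcons_shift z : pcons (z 0%N) (shift_path z) = z.
Proof.
apply: inf_pathP => i; rewrite /= /pcons_fun ifT; first by case: i.
by apply/eqP; exact: ipathP.
Qed.

Lemma shift_pcons e z : src e = irng z -> shift_path (pcons e z) = z.
Proof. by move=> ez; apply: inf_pathP => i; rewrite /= /pcons_fun ez eqxx. Qed.

Lemma preimage_shiftE z : [set w | shift_path w = z] =
  [set pcons e z | e in [set e : edge E | src e == irng z]].
Proof.
apply/seteqP; split => [w <-|_ [e /eqP ez <-]]; last exact: shift_pcons.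
exists (w 0%N); last exact: pcons_shift.
by apply/eqP; exact: ipathP.
Qed.

End Paths.

Section GraphBimodule.
Variables (R : realType) (E : digraph).

Local Notation CE := (contfun R (inf_path E)).
Implicit Types (x y a b : CE).

Lemma fsbig_shiftE (f : inf_path E -> R[i]^o) z :
  \sum_(w \in [set w | shift_path w = z]) f w =
  \sum_(e | src e == irng z) f (pcons e z).
Proof.
rewrite preimage_shiftE fsbig_image; last first.
  move=> e e' /set_mem/eqP ez /set_mem/eqP e'z /(congr1 (fun w : inf_path E => w 0%N)).
  by rewrite /= /pcons_fun ez e'z eqxx.
rewrite -[RHS]big_filter [RHS]fsbig_seq; last first.
  by rewrite filter_uniq ?index_enum_uniq.
apply: eq_fsbigl; apply/seteqP; split => e /=.
  by rewrite mem_filter mem_index_enum andbT.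
by rewrite mem_filter => /andP[].
Qed.

Lemma vcylinders (v : vertex E) : cylinders (vcylinder v).
Proof. by left; exists v. Qed.

Lemma indic_continuous (A : set (inf_path E)) : cylinders A ->
  continuous (\1_A : inf_path E -> R[i]^o).
Proof.
move=> cA z; have [Az|nAz] := pselect (A z).
  apply: (@cvg_near_cst _ _ _ _ (nbhs z)).
  apply: (@filterS _ (nbhs z) _ A) => [w Aw|].
    by rewrite /indic !mem_set.
  by apply: open_nbhs_nbhs; split => //; exact: cylinder_open.
apply: (@cvg_near_cst _ _ _ _ (nbhs z)).
apply: (@filterS _ (nbhs z) _ (~` A)) => [w Aw|].
  by rewrite /indic !memNset.
by apply: open_nbhs_nbhs; split => //; rewrite openC; exact: cylinder_closed.
Qed.

Lemma ecylinders (e : edge E) : cylinders (cylinder [:: e]).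
Proof. by right; exists [:: e]. Qed.

Definition chi_vertex (v : vertex E) : CE :=
  mkcts (indic_continuous (vcylinders v)).
Definition chi_edge (e : edge E) : CE :=
  mkcts (indic_continuous (ecylinders e)).

Lemma cinner_continuous x y : continuous (fun z : inf_path E =>
  \sum_(w \in [set w | shift_path w = z]) Num.conj (x w) * y w : R[i]^o).
Proof.
pose g e : inf_path E -> R[i]^o := fun z =>
  chi_vertex (src e) z * (cconj x (pcons e z) * y (pcons e z)).
rewrite [X in continuous X](_ : _ = fun z => \sum_e g e z); last first.
  apply/funext => z; rewrite fsbig_shiftE big_mkcond; apply: eq_bigr => e _.
  rewrite /g /= /mkcts /indic; case: eqP => ez.
    by rewrite mem_set ?mul1r.
  by rewrite memNset ?mul0r// => /esym.
have gC e : continuous (g e).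
  have pC (u : CE) : continuous (fun z => u (pcons e z)).
    move=> z; apply: (@continuous_comp _ _ _ (pcons e) u).
      exact: pcons_continuous.
    exact: cts_fun.
  move=> z; apply: (@cvgM _ _ (nbhs z) _ (chi_vertex (src e))
    (fun z => cconj x (pcons e z) * y (pcons e z))).
    exact: cts_fun.
  apply: (@cvgM _ _ (nbhs z) _ (fun z => cconj x (pcons e z))
    (fun z => y (pcons e z))); exact: pC.
elim: (index_enum _) => [|e r IH].
  rewrite [X in continuous X](_ : _ = (fun=> 0 : R[i]^o)); last first.
    by apply/funext => z; rewrite big_nil.
  exact: czero_continuous.
rewrite [X in continuous X](_ : _ = fun z => g e z + \sum_(i <- r) g i z).
  move=> z; apply: (@cvgD _ _ _ (nbhs z) _ (g e)
    (fun z => \sum_(i <- r) g i z)); first exact: (gC e z).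
  exact: (IH z).
by apply/funext => z; rewrite big_cons.
Qed.

Lemma cact_continuous a x b :
  continuous (fun z : inf_path E => a z * x z * b (shift_path z) : R[i]^o).
Proof.
move=> z; apply: (@cvgM _ _ (nbhs z) _ (cmul a x)
  (fun z => b (shift_path z))); first exact: (@cts_fun _ _ (cmul a x)).
apply: (@continuous_comp _ _ _ (@shift_path E) b).
  exact: shift_path_continuous.
exact: cts_fun.
Qed.

(* The underlying space of the bimodule X(E^oo) is C(E^oo); bact a x b is     *)
(* a . x . b                                                                  *)
Definition bact a x b : CE := mkcts (@cact_continuous a x b).
Definition binner x y : CE := mkcts (@cinner_continuous x y).

Definition bimodule_rep (B : cstarAlgType R) (psi pi : CE -> B) :=
  [/\ linear psi, star_hom pi,
      forall a x b, psi (bact a x b) = pi a ** psi x ** pi b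
    & forall x y, pi (binner x y) = adj (psi x) ** psi y].

Definition bimodule_toeplitz (B : cstarAlgType R) (psi pi : CE -> B) :=
  [/\ bimodule_rep psi pi, cstar_generates (range psi `|` range pi)
    & forall (D : cstarAlgType R) (psi' pi' : CE -> D),
        bimodule_rep psi' pi' ->
        exists h : B -> D, [/\ star_hom h, forall x, h (psi x) = psi' x
          & forall a, h (pi a) = pi' a]].

Definition graph_family (B : cstarAlgType R)
    (p : vertex E -> B) (s : edge E -> B) :=
  [/\ forall v, adj (p v) = p v /\ p v ** p v = p v,
      forall v w, v != w -> p v ** p w = 0,
      forall e, s e ** adj (s e) ** s e = s e,
      forall e, adj (s e) ** s e = p (src e)
    & forall v, cle (\sum_(e | rng e == v) s e ** adj (s e)) (p v)].

Definition graph_toeplitz (B : cstarAlgType R)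
    (p : vertex E -> B) (s : edge E -> B) :=
  [/\ graph_family p s, cstar_generates (range p `|` range s)
    & forall (D : cstarAlgType R) (p' : vertex E -> D) (s' : edge E -> D),
        graph_family p' s' ->
        exists h : B -> D, [/\ star_hom h, forall v, h (p v) = p' v
          & forall e, h (s e) = s' e]].

End GraphBimodule.

Section CriticalValues.
Variable R : realType.

Definition preim_card (E : digraph) (n : nat) (z : inf_path E) : nat :=
  #|` fset_set [set w : inf_path E | iter n (@shift_path E) w = z] |.

(* The supremum is a maximum: the cardinalities are at most #|edge E| ^ n *)
Definition max_preim_card (E : digraph) (n : nat) : R :=
  sup [set (preim_card n z)%:R | z in [set: inf_path E]].

Definition beta_c (E : digraph) : R :=
  limn_sup (fun n => n%:R^-1 * ln (max_preim_card E n)).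

Definition vertex_matrix (E : digraph) : 'M[R]_#|vertex E| :=
  \matrix_(i, j) #|[set e : edge E |
    (rng e == enum_val i) && (src e == enum_val j)]%SET|%:R.

Definition spectral_radius (n : nat) (A : 'M[R]_n) : R :=
  sup [set complex.Re `|l| | l in
    [set l : R[i] | eigenvalue (map_mx (real_complex R) A) l]].

End CriticalValues.

(* Main.v *)
(* Write Q = 1 - sum_e s_e s_e^* and L b = sum_e s_e^* b s_e. The KMS         *)
(* condition gives phi(b) = phi(Q b Q) + e^-beta phi(L b). As beta > beta_c,  *)
(* e^(-beta n) phi(L^n 1) <= e^(-beta n) max_z |sigma^-n(z)| tends to 0, so   *)
(* that phi = sum_n e^(-beta n) w o L^n with w = phi(Q . Q), and w is         *)
(* determined on TC*(E) by the finitely many numbers phi(Q p_v).              *)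
(*                                                                            *)
(* A positive functional w on T(X(E^oo)) which is concentrated on the corner  *)
(* of Q and takes the same values is found by norming each Q p_v with         *)
(* Hahn-Banach: Q p_v is nonzero in T(X(E^oo)) when phi(Q p_v) is, because    *)
(* pi_SP is injective. The same series then defines the extension. The        *)
(* elements Q pi(a) are dense in the corner of Q; this makes w positive,      *)
(* gauge invariant and tracial with respect to pi(C(E^oo)), from which the    *)
(* KMS relations follow on generators.                                        *)
(*                                                                            *)
(* The KMS condition for arbitrary analytic elements needs that an entire     *)
(* function vanishing on the real axis vanishes at i beta. Instead of complex *)
(* analysis, this uses that phi is a KMS state, for the zero element.         *)

(* A KMS state of TC*(E) is rebuilt from its values on the vacuum corner. The relation [phi_rec]
   peels off one edge on each side, and its iterate [phi_iter] leaves the remainder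
   [e^(-beta n) phi (L^n b)]. As [L^n 1] is the sum of the [p v] weighted by the number of paths of
   length [n] with source [v] ([iter_transfer_unit]), this remainder is at most the norm of [b]
   times [e^(-beta n) max_z |sigma^-n(z)|], which [max_preim_card_decay] sends to 0.

   Hence only the functional on the vacuum corner has to be extended. In both algebras compressing
   by [Q] leads, on a dense subalgebra, into [D Q] with [D] commutative ([vac_corner]); a common
   [toeplitz_system] therefore serves both, with [D] the span of the vertex projections in TC*(E)
   and the image of C(E^oo) in T(X(E^oo)). For TC*(E) the corner is spanned by the [Q p_v], so
   finitely many values must be matched. One could choose a measure on E^oo with prescribed masses
   on the sets Z(v); [vacuum_functional] obtains the functional inside the algebra instead, because
   a norm-one functional with value 1 at a projection is positive on its corner
   ([corner_functional]).

   The series over [n] converges since its partial sums at the unit are at most [phi 1 = 1]. Its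
   limit is a trace relative to [D] ([fock_comm]), and moving an edge across costs [e^-beta]
   ([fock_s]). These relations survive products and adjoints, so they hold on a dense subalgebra,
   and [KMS_of_homogeneous] passes to all analytic elements. *)
Require Import Defs.
From mathcomp Require Import all_boot all_order all_algebra finmap.
From mathcomp Require Import all_classical all_reals topology normedtype sequences derive exp trigo.
From mathcomp Require Import complex ring lra.

Set Implicit Arguments.
Unset Strict Implicit.
Unset Printing Implicit Defensive.

Import Order.TTheory GRing.Theory Num.Theory.
Import numFieldNormedType.Exports.

Local Open Scope classical_set_scope.
Local Open Scope ring_scope.
Local Open Scope complex_scope.

(** * The real norm and convergence *)

Section RealNorm.
Variable R : realType.

(* The norm of a normed space over R[i] takes its values in R[i].             *)
Definition nr (V : normedZmodType R[i]) (a : V) : R := complex.Re `|a|.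

Section NormedZmod.
Variable V : normedZmodType R[i].
Implicit Types a b : V.

Lemma nrE a : `|a| = (nr a)%:C.
Proof. by rewrite RRe_real// normr_real. Qed.

Lemma ler_nr a (x : R) : (`|a| <= x%:C) = (nr a <= x).
Proof. by rewrite nrE lecR. Qed.

Lemma ltr_nr a (x : R) : (`|a| < x%:C) = (nr a < x).
Proof. by rewrite nrE ltcR. Qed.

Lemma nr_ge0 a : 0 <= nr a.
Proof. by rewrite -ler0c -nrE. Qed.

Lemma nr0 : nr (0 : V) = 0.
Proof. by rewrite /nr normr0. Qed.

Lemma nr_eq0 a : (nr a == 0) = (a == 0).
Proof. by rewrite -(normr_eq0 a) nrE (inj_eq (@complexI R)). Qed.

Lemma nrD a b : nr (a + b) <= nr a + nr b.
Proof. by rewrite -ler_nr rmorphD/= -!nrE ler_normD. Qed.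

Lemma nrN a : nr (- a) = nr a.
Proof. by rewrite /nr normrN. Qed.

Lemma nrB a b : nr (a - b) <= nr a + nr b.
Proof. by rewrite (le_trans (nrD _ _))// nrN. Qed.

Lemma nr_distC a b : nr (a - b) = nr (b - a).
Proof. by rewrite -nrN opprB. Qed.

Lemma nr_distD c a b : nr (a - b) <= nr (a - c) + nr (c - b).
Proof. by rewrite (le_trans _ (nrD _ _))// addrA subrK. Qed.

Lemma nr_sum (I : Type) (r : seq I) (P : pred I) (F : I -> V) :
  nr (\sum_(i <- r | P i) F i) <= \sum_(i <- r | P i) nr (F i).
Proof.
elim/big_ind2 : _ => [|x1 x2 y1 y2 h1 h2|//]; first by rewrite nr0.
by rewrite (le_trans (nrD _ _))// lerD.
Qed.

Lemma nr_small a : (forall e, 0 < e -> nr a <= e) -> a = 0.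
Proof.
move=> h; apply/eqP; rewrite -nr_eq0 eq_le nr_ge0 andbT.
by apply/ler_addgt0Pl => e /h; rewrite addr0.
Qed.

End NormedZmod.

Lemma nrC (x : R) : nr (x%:C : R[i]) = `|x|.
Proof. by rewrite /nr normc_def/= expr0n addr0 sqrtr_sqr. Qed.

Lemma nrCM (k l : R[i]) : nr (k * l) = nr k * nr l.
Proof. by rewrite /nr normrM !nrE /= !mulr0 subr0. Qed.

Lemma nr1 : nr (1 : R[i]) = 1.
Proof. by rewrite /nr normr1. Qed.

Lemma nr_conj (k : R[i]) : nr (Num.conj k) = nr k.
Proof. by rewrite /nr norm_conjC. Qed.

Lemma nr_sqr (k : R[i]) : nr k ^+ 2 = complex.Re k ^+ 2 + complex.Im k ^+ 2.
Proof. by rewrite /nr normc_def/= sqr_sqrtr// addr_ge0// sqr_ge0. Qed.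

Lemma ler_Re_nr (k : R[i]) : `|complex.Re k| <= nr k.
Proof.
rewrite -(@ler_pXn2r _ 2)// ?nnegrE ?nr_ge0// nr_sqr real_normK ?num_real//.
by rewrite lerDl sqr_ge0.
Qed.

Lemma ler_Im_nr (k : R[i]) : `|complex.Im k| <= nr k.
Proof.
rewrite -(@ler_pXn2r _ 2)// ?nnegrE ?nr_ge0// nr_sqr real_normK ?num_real//.
by rewrite lerDr sqr_ge0.
Qed.

Lemma nr_le_ReIm (k : R[i]) : nr k <= `|complex.Re k| + `|complex.Im k|.
Proof.
rewrite {1}(complexE k) (le_trans (nrD _ _))// nrCM !nrC lerD//.
by rewrite -[leRHS]mul1r ler_wpM2r// /nr normc_def/= expr0n add0r expr1n sqrtr1.
Qed.

Lemma phase (t : R[i]) : exists c : R[i], nr c = 1 /\ c * t = (nr t)%:C.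
Proof.
have [->|t0] := eqVneq t 0; first by exists 1; rewrite nr1 mulr0 nr0.
have nt0 : 0 < nr t by rewrite lt_neqAle nr_ge0 eq_sym nr_eq0 t0.
exists (((nr t)^-1)%:C * Num.conj t); split.
  by rewrite nrCM nrC nr_conj ger0_norm ?invr_ge0 ?nr_ge0// mulVf// gt_eqF.
rewrite -mulrA [_ * t]mulrC -normCK nrE -rmorphXn -rmorphM /=.
by rewrite expr2 mulKf// gt_eqF.
Qed.

Lemma nrZ (V : normedModType R[i]) (k : R[i]) (a : V) :
  nr (k *: a) = nr k * nr a.
Proof. by rewrite /nr normrZ !nrE /= !mulr0 subr0. Qed.

Lemma closureE (V : normedModType R[i]) (S : set V) b :
  closure S b <-> forall e : R, 0 < e -> exists c, S c /\ nr (b - c) < e.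
Proof.
split => [Sb e e0|h U /nbhs_ballP[e /= e0 eU]].
  have e0C : 0 < e%:C by rewrite ltcR.
  have [c [Sc bc]] := Sb _ (nbhsx_ballx b e%:C e0C).
  by exists c; split=> //; rewrite -ltr_nr; move: bc; rewrite -ball_normE.
have eE : e = (complex.Re e)%:C by rewrite RRe_real// gtr0_real.
have [c [Sc bc]] := h (complex.Re e) ltac:(by rewrite -ltcR -eE).
by exists c; split=> //; apply: eU; rewrite -ball_normE/= eE ltr_nr.
Qed.

Section Convergence.
Variable V : normedZmodType R[i].
Implicit Types (u v : nat -> V) (a b l : V).

(** The tolerances are real although the norm is [R[i]]-valued, so that all estimates can be carried
    out on [nr]. *)
Definition ccvg u l :=
  forall e : R, 0 < e -> exists N, forall n, (N <= n)%N -> nr (u n - l) < e.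

Lemma ccvg_cst a : ccvg (fun=> a) a.
Proof. by move=> e e0; exists 0%N => n _; rewrite subrr nr0. Qed.

Lemma ccvgD u v a b : ccvg u a -> ccvg v b -> ccvg (fun n => u n + v n) (a + b).
Proof.
move=> ua vb e e0; have e20 : 0 < e / 2 by rewrite divr_gt0.
have [N hN] := ua _ e20; have [M hM] := vb _ e20.
exists (maxn N M) => n; rewrite geq_max => /andP[/hN h1 /hM h2].
rewrite opprD addrACA (le_lt_trans (nrD _ _))// (splitr e) ltrD//.
Qed.

Lemma ccvgS u a : ccvg u a -> ccvg (fun n => u n.+1) a.
Proof. by move=> ua e /ua[N hN]; exists N => n Nn; exact/hN/leqW. Qed.

Lemma ccvg_unique u a b : ccvg u a -> ccvg u b -> a = b.
Proof.
move=> ua ub; apply/eqP; rewrite -subr_eq0; apply/eqP/nr_small => e e0.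
have e20 : 0 < e / 2 by rewrite divr_gt0.
have [N hN] := ua _ e20; have [M hM] := ub _ e20.
rewrite (le_trans (nr_distD (u (maxn N M)) _ _))// nr_distC (splitr e).
by rewrite lerD// ltW// (hN,hM)// (leq_maxl,leq_maxr).
Qed.

End Convergence.

Lemma ccvg_bounded (V W : normedZmodType R[i]) (l : V -> W) (C : R)
    (u : nat -> V) (a : V) :
  {morph l : x y / x - y} -> (forall x, nr (l x) <= C * nr x) ->
  ccvg u a -> ccvg (fun n => l (u n)) (l a).
Proof.
move=> lB lC ua e e0; have C0 : 0 < `|C| + 1 by rewrite ltr_wpDl.
have [N hN] := ua (e / (`|C| + 1)) (divr_gt0 e0 C0).
exists N => n /hN; rewrite ltr_pdivlMr// => h; rewrite -lB.
rewrite (le_lt_trans (lC _))// (le_lt_trans _ h)// mulrC ler_wpM2l ?nr_ge0//.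
by rewrite ler_wpDr// ler_norm.
Qed.

Lemma ccvgZ (V : normedModType R[i]) (k : R[i]) (u : nat -> V) a :
  ccvg u a -> ccvg (fun n => k *: u n) (k *: a).
Proof.
apply: (@ccvg_bounded _ _ _ (nr k)) => [b c|b]; first exact: scalerBr.
by rewrite nrZ.
Qed.

Lemma ccvg_ge0 (u : nat -> R[i]) (l : R[i]) :
  ccvg u l -> (forall n, 0 <= u n) -> 0 <= l.
Proof.
move=> ul u0; rewrite lecE /=; apply/andP; split.
  apply/eqP/normr0_eq0/eqP; rewrite eq_le normr_ge0 andbT.
  apply/ler_addgt0Pl => e /ul[N /(_ _ (leqnn _)) /ltW h]; rewrite addr0.
  rewrite (le_trans _ h)// (le_trans _ (ler_Im_nr _))//.
  case: (u N) (u0 N) l {ul h} => [p q] + [p' q'].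
  by rewrite lecE /= => /andP[/eqP -> _]; rewrite sub0r normrN.
apply/ler_addgt0Pl => e /ul[N /(_ _ (leqnn _)) /ltW h].
have := le_trans (ler_Re_nr _) h.
case: (u N) (u0 N) l {ul h} => [p q] + [p' q'].
rewrite lecE /= => /andP[_ p0]; rewrite ler_norml => /andP[_].
by rewrite lerBlDr; exact: le_trans.
Qed.

Lemma ccvg_seq (V : normedZmodType R[i]) (S : set V) b :
  (forall e : R, 0 < e -> exists c, S c /\ nr (b - c) < e) ->
  exists c, (forall n, S (c n)) /\ ccvg c b.
Proof.
move=> h; have h' n : exists c, S c /\ nr (b - c) < n.+1%:R^-1.
  by apply: h; rewrite invr_gt0.
exists (fun n => sval (cid (h' n))); split => [n|e e0].
  by case: cid => c [].
exists (Num.bound e^-1) => n; case: cid => c [_ /= bc] en.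
rewrite nr_distC (lt_le_trans bc)// invf_ple ?posrE//.
have e1 : 0 <= e^-1 by rewrite invr_ge0 ltW.
by rewrite (le_trans (ltW (archi_boundP e1)))// ler_nat leqW.
Qed.

(** Completeness enters here: the telescoping series of increments is dominated by a geometric one,
    hence Cauchy. *)
Lemma ccvg_geo (V : completeNormedModType R[i]) (u : nat -> V) (C r : R) :
  0 <= C -> 0 <= r < 1 ->
  (forall n, nr (u n.+1 - u n) <= C * r ^+ n) -> exists l, ccvg u l.
Proof.
move=> C0 /andP[r0 r1] uC; pose d n := u n.+1 - u n.
have dE n : u n = u 0%N + series d n.
  rewrite seriesEnat/=; elim: n => [|n IH]; first by rewrite big_geq// addr0.
  by rewrite big_nat_recr//= addrA -IH /d addrC subrK.
have /cauchy_seriesP gC : cauchy (series (geometric C r) @ \oo).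
  by apply: cvg_cauchy; apply: is_cvg_geometric_series; rewrite ger0_norm.
have : cvgn (series d).
  apply/cauchy_cvgP/cauchy_seriesP => e e0.
  have eE : e = (complex.Re e)%:C by rewrite RRe_real// gtr0_real.
  have /gC : 0 < complex.Re e by rewrite -ltcR -eE.
  apply: filterS => -[n m] /= h; rewrite eE ltr_nr (le_lt_trans (nr_sum _ _ _))//.
  rewrite (le_lt_trans _ h)// (le_trans _ (ler_norm _))// ler_sum// => i _.
  exact: uC.
move=> /cvg_ex[l /= sl]; exists (u 0%N + l) => e e0.
have e0C : 0 < e%:C by rewrite ltcR.
have /cvgrPdist_lt/(_ _ e0C)[N _ hN] := sl.
exists N => n Nn; rewrite dE opprD addrACA subrr add0r -ltr_nr distrC.
exact: hN.
Qed.

End RealNorm.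

(** * Linear maps and algebra in star algebras and C*-algebras *)

Section Linear.
Variables (K : pzRingType) (U V : lmodType K) (f : U -> V).
Hypothesis flin : linear f.

Lemma linD a b : f (a + b) = f a + f b.
Proof. by have := flin 1 a b; rewrite !scale1r. Qed.

Lemma lin0 : f 0 = 0.
Proof. by apply: (addrI (f 0)); rewrite -linD !addr0. Qed.

Lemma linZ k a : f (k *: a) = k *: f a.
Proof. by have := flin k a 0; rewrite lin0 !addr0. Qed.

Lemma linN a : f (- a) = - f a.
Proof. by rewrite -!scaleN1r linZ. Qed.

Lemma linB a b : f (a - b) = f a - f b.
Proof. by rewrite linD linN. Qed.

Lemma lin_sum (I : Type) (r : seq I) (P : pred I) (F : I -> U) :
  f (\sum_(i <- r | P i) F i) = \sum_(i <- r | P i) f (F i).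
Proof. exact: (big_morph _ linD lin0). Qed.

End Linear.

Section StarAlgebra.
Variables (R : realType) (A : starAlgType R).
Implicit Types a b c : A.

Lemma amulr_linear b : linear (fun a => a ** b).
Proof. by move=> k x y; rewrite amulDl amulZl. Qed.

Lemma amull_linear b : linear (fun a => b ** a).
Proof. by move=> k x y; rewrite amulDr amulZr. Qed.

Lemma amul0l a : 0 ** a = 0. Proof. exact: (lin0 (amulr_linear a)). Qed.
Lemma amul0r a : a ** 0 = 0. Proof. exact: (lin0 (amull_linear a)). Qed.

Lemma amulBl a b c : (a - b) ** c = a ** c - b ** c.
Proof. exact: (linB (amulr_linear c)). Qed.

Lemma amulBr a b c : c ** (a - b) = c ** a - c ** b.
Proof. exact: (linB (amull_linear c)). Qed.

Lemma amul_suml (I : Type) (r : seq I) (P : pred I) (F : I -> A) b :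
  (\sum_(i <- r | P i) F i) ** b = \sum_(i <- r | P i) F i ** b.
Proof. exact: (lin_sum (amulr_linear b)). Qed.

Lemma amul_sumr (I : Type) (r : seq I) (P : pred I) (F : I -> A) b :
  b ** (\sum_(i <- r | P i) F i) = \sum_(i <- r | P i) b ** F i.
Proof. exact: (lin_sum (amull_linear b)). Qed.

Lemma adj0 : adj (0 : A) = 0.
Proof. by apply: (addrI (adj (0 : A))); rewrite -adjD !addr0. Qed.

Lemma adjN a : adj (- a) = - adj a.
Proof. by apply: (addrI (adj a)); rewrite -adjD !subrr adj0. Qed.

Lemma adjB a b : adj (a - b) = adj a - adj b.
Proof. by rewrite adjD adjN. Qed.

Lemma adj_sum (I : Type) (r : seq I) (P : pred I) (F : I -> A) :
  adj (\sum_(i <- r | P i) F i) = \sum_(i <- r | P i) adj (F i).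
Proof. exact: (big_morph _ (@adjD _ _) adj0). Qed.

Lemma adjsZ (k : R[i]) a : adj (k *: a) = Num.conj k *: adj a.
Proof. exact: Defs.adjZ. Qed.

(** Having a unit is a property, as C*-algebras are not assumed unital; [bimodule_unit] and
    [graph_unitP] supply the units of the two Toeplitz algebras. *)
Definition is_unit (u : A) := forall a, u ** a = a /\ a ** u = a.

Lemma unit_mull u a : is_unit u -> u ** a = a. Proof. by case/(_ a). Qed.
Lemma unit_mulr u a : is_unit u -> a ** u = a. Proof. by case/(_ a). Qed.

Lemma unit_adj u : is_unit u -> adj u = u.
Proof.
move=> hu; rewrite -[RHS]adjK -[in RHS](unit_mull (adj u) hu) adjM !adjK.
by rewrite unit_mull.
Qed.

End StarAlgebra.

Lemma conj_real (R : realType) (x : R) : Num.conj (x%:C) = x%:C.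
Proof. by apply: conj_Creal; apply/complex_realP; exists x. Qed.

Lemma conj_i (R : realType) : Num.conj ('i : R[i]) = - 'i.
Proof. by apply/eqP; rewrite eq_complex /= oppr0 !eqxx. Qed.

Lemma mulii (R : realType) : ('i : R[i]) * 'i = -1.
Proof. by rewrite -expr2 sqr_i. Qed.

Section CStar.
Variables (R : realType) (B : cstarAlgType R).
Implicit Types a b c x : B.

Lemma nrM a b : nr (a ** b) <= nr a * nr b.
Proof.
by rewrite -ler_nr rmorphM /= -!nrE; exact: cnormM.
Qed.

Lemma nr_adjM a : nr (adj a ** a) = nr a ^+ 2.
Proof. by apply: (@complexI R); rewrite -nrE rmorphXn /= -nrE cnorm_adjM. Qed.

Lemma nr_adj a : nr (adj a) = nr a.
Proof.
suff h b : nr b <= nr (adj b).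
  by apply/eqP; rewrite eq_le h -{2}(adjK a) h.
have [->|b0] := eqVneq b 0; first by rewrite adj0.
have nb0 : 0 < nr b by rewrite lt_neqAle nr_ge0 eq_sym nr_eq0 b0.
by rewrite -(ler_pM2r nb0) -expr2 -nr_adjM nrM.
Qed.

Lemma nr_sa_sqr a : adj a = a -> nr (a ** a) = nr a ^+ 2.
Proof. by move=> {1}<-; rewrite nr_adjM. Qed.

Lemma nr_proj a : adj a = a -> a ** a = a -> nr a <= 1.
Proof.
move=> sa aa; have /eqP := nr_sa_sqr sa; rewrite aa expr2.
rewrite -subr_eq0 -{1}[nr a]mulr1 -mulrBr mulf_eq0 => /orP[/eqP->//|].
by rewrite subr_eq0 => /eqP <-.
Qed.

Lemma nr_proj_neq0 a : adj a = a -> a ** a = a -> a != 0 -> nr a = 1.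
Proof.
move=> sa aa a0; have /eqP := nr_sa_sqr sa; rewrite aa expr2.
rewrite -subr_eq0 -{1}[nr a]mulr1 -mulrBr mulf_eq0 nr_eq0 (negbTE a0)/=.
by rewrite subr_eq0 => /eqP <-.
Qed.

Lemma nr_unit (u : B) : is_unit u -> nr u <= 1.
Proof. by move=> hu; apply: nr_proj; [exact: unit_adj|exact: unit_mull]. Qed.

Lemma ccvgM (u v : nat -> B) a b :
  ccvg u a -> ccvg v b -> ccvg (fun n => u n ** v n) (a ** b).
Proof.
(* Since [d < 1], eventually [nr (v n) <= 1 + nr b]; the summand [e] in the denominator leaves the
   slack [d * e] that makes the final inequality strict. *)
move=> ua vb e e0; pose d := e / (1 + nr a + nr b + e).
have D0 : 0 < 1 + nr a + nr b + e by rewrite !ltr_wpDr ?nr_ge0// ltW.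
have d0 : 0 < d by rewrite divr_gt0.
have d1 : d < 1.
  by rewrite ltr_pdivrMr// mul1r ltrDr !ltr_wpDr ?nr_ge0.
have [N hN] := ua _ d0; have [M hM] := vb _ d0.
exists (maxn N M) => n; rewrite geq_max => /andP[/hN h1 /hM h2].
rewrite (_ : _ - _ = (u n - a) ** v n + a ** (v n - b)); last first.
  by rewrite amulBl amulBr addrA subrK.
have -> : e = d * (1 + nr a + nr b + e) by rewrite /d divfK// gt_eqF.
rewrite (le_lt_trans (nrD _ _))//.
have h3 : nr (v n) <= 1 + nr b.
  rewrite -(subrK b (v n)) (le_trans (nrD _ _))// lerD2r.
  by rewrite ltW// (lt_trans h2).
have h4 : nr ((u n - a) ** v n) <= d * (1 + nr b).
  rewrite (le_trans (nrM _ _))// (le_trans (ler_wpM2l _ h3)) ?nr_ge0//.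
  by rewrite ler_wpM2r ?addr_ge0 ?nr_ge0// ltW.
have h5 : nr (a ** (v n - b)) <= d * nr a.
  by rewrite (le_trans (nrM _ _))// mulrC ler_wpM2r ?nr_ge0// ltW.
have h7 : 0 < d * e by rewrite mulr_gt0.
move: h4 h5; rewrite !mulrDr; lra.
Qed.

End CStar.

(** * Square roots, contractivity and positive functionals *)

Lemma half_double (R : realType) (V : lmodType R[i]) (a : V) :
  (2^-1)%:C *: (a + a) = a.
Proof.
rewrite scalerDr -scalerDl -rmorphD /= -[in X in X%:C](mul1r 2^-1) -splitr.
exact: scale1r.
Qed.

Section SquareRoot.
Variables (R : realType) (B : cstarAlgType R) (u : B).
Hypothesis hu : is_unit u.
Implicit Types a b c x : B.

Let half : R[i] := (2^-1)%:C.

Let halfD : half + half = 1.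
Proof. by rewrite -rmorphD /= -[in LHS](mul1r 2^-1) -splitr. Qed.

Let nr_half : nr half = 2^-1.
Proof. by rewrite nrC ger0_norm ?invr_ge0. Qed.

Definition sqrt_step x y : B := half *: (x + y ** y).

(* [u - x] has the square root [u - y] as soon as [y = (x + y ^ 2) / 2], a    *)
(* contraction on the ball of radius [1 - sqrt (1 - |x|)]                     *)
Lemma sqrt_exists x : adj x = x -> nr x < 1 -> exists k,
  [/\ adj k = k, k ** k = u - x & forall c, c ** x = x ** c -> c ** k = k ** c].
Proof.
(* [r] is the smaller root of [nr x + r ^+ 2 = 2 * r], so [sqrt_step x] maps the ball of radius
   [r < 1] to itself. *)
move=> sx x1; pose r := 1 - Num.sqrt (1 - nr x).
have x1' : 0 < 1 - nr x by rewrite subr_gt0.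
have r1 : r < 1 by rewrite /r gtrBl sqrtr_gt0.
have r0 : 0 <= r.
  by rewrite /r subr_ge0 -sqrtr1 ler_sqrt// sqrtr1 gerBl nr_ge0.
have rE : nr x + r ^+ 2 = 2 * r.
  have := sqr_sqrtr (ltW x1'); rewrite /r; lra.
pose y n := iter n (sqrt_step x) 0.
have ySn n : y n.+1 = sqrt_step x (y n) by [].
have ny n : nr (y n) <= r.
  elim: n => [|n IH]; first by rewrite /y /= nr0.
  rewrite ySn /sqrt_step nrZ nr_half mulrC ler_pdivrMr// mulrC -rE.
  rewrite (le_trans (nrD _ _))// lerD2l (le_trans (nrM _ _))// expr2.
  by rewrite ler_pM ?nr_ge0.
have [C yC] : exists C, nr (y 1%N) <= C by exists (nr (y 1%N)).
have dy n : nr (y n.+1 - y n) <= C * r ^+ n.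
  elim: n => [|n IH]; first by rewrite expr0 mulr1 [y 0%N]/y subr0.
  rewrite exprSr mulrA.
  (* The difference of the two squares is split without commutativity; each half contributes a
     factor of at most [r / 2]. *)
  have -> : y n.+2 - y n.+1 = half *: ((y n.+1 - y n) ** y n.+1) +
      half *: (y n ** (y n.+1 - y n)).
    rewrite ySn [in X in _ - X]ySn /sqrt_step -scalerBr -scalerDr amulBl amulBr.
    by rewrite addrA subrK opprD addrACA subrr add0r.
  rewrite (le_trans (nrD _ _))// !nrZ nr_half -mulrDr mulrC ler_pdivrMr//.
  have h1 : nr ((y n.+1 - y n) ** y n.+1) <= nr (y n.+1 - y n) * r.
    by rewrite (le_trans (nrM _ _))// ler_wpM2l ?nr_ge0.
  have h2 : nr (y n ** (y n.+1 - y n)) <= nr (y n.+1 - y n) * r.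
    by rewrite (le_trans (nrM _ _))// mulrC ler_wpM2l ?nr_ge0.
  have h3 : nr (y n.+1 - y n) * r <= C * r ^+ n * r by rewrite ler_wpM2r.
  lra.
have r01 : 0 <= r < 1 by rewrite r0.
have [l yl] := ccvg_geo (le_trans (nr_ge0 _) yC) r01 dy.
have lE : l = sqrt_step x l.
  apply: (ccvg_unique (ccvgS yl)).
  exact/ccvgZ/ccvgD/ccvgM/yl/yl/ccvg_cst.
have sl : adj l = l.
  have syl : ccvg (fun n => adj (y n)) (adj l).
    by apply: (@ccvg_bounded _ _ _ _ 1) yl => [b c|b];
      [exact: adjB|rewrite nr_adj mul1r].
  apply: (ccvg_unique syl); suff sy n : adj (y n) = y n.
    by move=> e /yl[N hN]; exists N => n; rewrite sy; exact: hN.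
  elim: n => [|n IH]; first exact: adj0.
  by rewrite ySn /sqrt_step adjsZ conj_real adjD adjM sx IH.
exists (u - l); split.
- by rewrite adjB sl unit_adj.
- have xE : x = l + l - l ** l.
      suff -> : l + l = x + l ** l by rewrite addrK.
    by rewrite {1 2}lE /sqrt_step -scalerDl halfD scale1r.
  rewrite amulBl !amulBr !(unit_mull _ hu) (unit_mulr _ hu) [in RHS]xE.
  by rewrite !opprD !opprK !addrA.
- move=> c cx; rewrite amulBl amulBr (unit_mull _ hu) (unit_mulr _ hu); congr (_ - _).
  have c1 : ccvg (fun n => c ** y n) (c ** l) by apply: ccvgM yl; exact: ccvg_cst.
  have c2 : ccvg (fun n => y n ** c) (l ** c) by apply: ccvgM yl _; exact: ccvg_cst.
  apply: (ccvg_unique c1); suff cy n : c ** y n = y n ** c.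
    by move=> e /c2[N hN]; exists N => n; rewrite cy; exact: hN.
  elim: n => [|n IH]; first by rewrite /y /= amul0l amul0r.
  rewrite ySn /sqrt_step amulZr amulZl amulDl amulDr cx.
  by rewrite amulA IH -amulA IH amulA.
Qed.

End SquareRoot.

Section Contractive.
Variable R : realType.

Let half : R[i] := (2^-1)%:C.

(* [a] is the real part of [w = a + i b], and [adj w ** w = e].               *)
Lemma nr_sum_sqr (B : cstarAlgType R) (a b e : B) : adj a = a -> adj b = b ->
  a ** b = b ** a -> a ** a + b ** b = e -> nr e <= 1 -> nr a <= 1.
Proof.
move=> sa sb ab abe e1; pose w := a + 'i *: b.
have wa : adj w = a - 'i *: b by rewrite /w adjD adjsZ conj_i sa sb scaleNr.
have ww : adj w ** w = e.
  rewrite wa /w amulBl !amulDr !amulZl !amulZr scalerA mulii scaleN1r ab.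
  by rewrite -abe opprD opprK addrA addrK.
have w1 : nr w <= 1.
  by rewrite -(@ler_pXn2r _ 2)// ?nnegrE ?nr_ge0// expr1n -nr_adjM ww.
have -> : a = half *: (w + adj w).
  by rewrite wa /w addrACA subrr addr0 half_double.
rewrite nrZ nrC ger0_norm ?invr_ge0// mulrC ler_pdivrMr// mul1r (le_trans (nrD _ _))//.
by rewrite nr_adj lerD.
Qed.

(** [u - h ** h] is the square of a selfadjoint [k] commuting with [h], and [k ** k + h ** h = u],
    so [nr_sum_sqr] bounds [k] by 1. *)
Lemma nr_unit_subsqr (B : cstarAlgType R) (u h : B) : is_unit u -> adj h = h ->
  nr h < 1 -> nr (u - h ** h) <= 1.
Proof.
move=> hu sh h1; have hh1 : nr (h ** h) < 1.
  by rewrite nr_sa_sqr// expr_lt1// nr_ge0.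
have shh : adj (h ** h) = h ** h by rewrite adjM sh.
have [k [sk kk kc]] := sqrt_exists hu shh hh1.
rewrite -kk nr_sa_sqr// expr_le1 ?nr_ge0//.
apply: (@nr_sum_sqr _ k h u) => //; last exact: nr_unit.
  by rewrite kc// amulA.
by rewrite kk subrK.
Qed.

(** No spectral theory is involved: for selfadjoint [x] of norm below 1, the square root [k] of
    [u - x ** x] commutes with [x], and the squares of [h x] and [h k] add up to the projection
    [h u]. Scaling and the C*-identity give the rest. *)
Lemma star_hom_le (A B : cstarAlgType R) (u : A) (h : A -> B) :
  is_unit u -> star_hom h -> forall a, nr (h a) <= nr a.
Proof.
move=> hu [hlin hM hadj].
have h1 x : adj x = x -> nr x < 1 -> nr (h x) <= 1.
  move=> sx x1; have xx1 : nr (x ** x) < 1.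
    by rewrite nr_sa_sqr// expr_lt1// nr_ge0.
  have sxx : adj (x ** x) = x ** x by rewrite adjM sx.
  have [k [sk kk kc]] := sqrt_exists hu sxx xx1.
  apply: (@nr_sum_sqr _ (h x) (h k) (h u)); rewrite -?hadj ?sx ?sk//.
  - by rewrite -!hM kc// amulA.
  - by rewrite -!hM -(linD hlin) kk addrC subrK.
  - apply: nr_proj; first by rewrite -hadj unit_adj.
    by rewrite -hM unit_mull.
have h2 x : adj x = x -> nr (h x) <= nr x.
  move=> sx; apply/ler_addgt0Pl => e e0; rewrite addrC.
  have t0 : 0 < nr x + e by rewrite ltr_wpDl ?nr_ge0.
  have := h1 (((nr x + e)^-1)%:C *: x).
  rewrite adjsZ conj_real sx (linZ hlin) !nrZ !nrC ger0_norm; last first.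
    by rewrite invr_ge0 ltW.
  rewrite mulrC ltr_pdivrMr// mul1r ltrDl => /(_ erefl e0).
  by rewrite mulrC ler_pdivrMr// mul1r.
move=> a; rewrite -(@ler_pXn2r _ 2)// ?nnegrE ?nr_ge0// -!nr_adjM -hadj -hM.
by apply: h2; rewrite adjM adjK.
Qed.

End Contractive.

Section PositiveFunctional.
Variables (R : realType) (B : cstarAlgType R) (u : B).
Hypothesis hu : is_unit u.
Variable tau : B -> R[i]^o.
Hypothesis tlin : linear tau.
Hypothesis tpos : forall a, 0 <= tau (adj a ** a).

Let half : R[i] := (2^-1)%:C.

(** Polarization against the unit: [4 x = (x + u) ^ 2 - (x - u) ^ 2], and [tau] is real on both
    squares. *)
Let tsa x : adj x = x -> complex.Im (tau x) = 0.
Proof.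
move=> sx; pose y := x + u; pose z := x - u.
have sy : adj y = y by rewrite adjD sx unit_adj.
have sz : adj z = z by rewrite adjB sx unit_adj.
have yz : y ** y - z ** z = (4%:R : R)%:C *: x.
  rewrite /y /z amulBl !amulBr amulDl !amulDr !(unit_mull _ hu) !(unit_mulr _ hu).
  rewrite !opprD !opprK !addrA (ACl (1*5*(4*8)*2*3*6*7))/= !subrr !add0r.
  by rewrite rmorph_nat scaler_nat !mulrSr mulr0n add0r.
have := congr1 (fun w => complex.Im (tau w)) yz.
rewrite (linB tlin) (linZ tlin) /=.
have /ger0_Im := tpos y; rewrite sy; have /ger0_Im := tpos z; rewrite sz.
case: (tau x) (tau (y ** y)) (tau (z ** z)) => [p q] [p1 q1] [p2 q2] /= -> ->.
rewrite subr0 mul0r addr0 => /esym/eqP; rewrite mulf_eq0 => /orP[|/eqP//].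
by rewrite pnatr_eq0.
Qed.

Lemma pos_adj a : tau (adj a) = Num.conj (tau a).
Proof.
have := tsa (x := a + adj a); rewrite adjD adjK addrC => /(_ erefl).
have := tsa (x := 'i *: (a - adj a)).
rewrite adjsZ conj_i adjB adjK scaleNr -scalerN opprB => /(_ erefl).
rewrite (linZ tlin) (linB tlin) (linD tlin).
case: (tau a) (tau (adj a)) => [p q] [p1 q1] /=.
rewrite mul0r add0r mul1r => /subr0_eq -> /eqP.
rewrite addr_eq0 => /eqP ->.
by apply/eqP; rewrite eq_complex /= opprK !eqxx.
Qed.

Lemma pos_unit_Re : 0 <= complex.Re (tau u).
Proof.
have := tpos u; rewrite unit_adj// unit_mull//.
by case: (tau u) => x y; rewrite lecE => /andP[].
Qed.

Lemma pos_unitE : tau u = (complex.Re (tau u))%:C.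
Proof.
have := tpos u; rewrite unit_adj// unit_mull// => h.
by rewrite RRe_real// ger0_real.
Qed.

(** If [z] is selfadjoint of norm below 1, then [u - z] is the square of a selfadjoint element, so
    [tau z <= tau u]. Scaling into the open unit ball costs an arbitrarily small [e]. *)
Let tle x : adj x = x -> complex.Re (tau x) <= complex.Re (tau u) * nr x.
Proof.
move=> sx.
have h1 z : adj z = z -> nr z < 1 -> complex.Re (tau z) <= complex.Re (tau u).
  move=> sz z1; have [k [sk kk _]] := sqrt_exists hu sz z1.
  have := tpos k; rewrite sk kk (linB tlin).
  case: (tau u) (tau z) => [p q] [p1 q1].
  by rewrite lecE /= => /andP[_]; rewrite subr_ge0.
apply/ler_addgt0Pl => e e0; pose M := complex.Re (tau u) + 1.
have M0 : 0 < M by rewrite ltr_wpDl ?pos_unit_Re.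
pose d := e / M; have d0 : 0 < d by rewrite divr_gt0.
have t0 : 0 < nr x + d by rewrite ltr_wpDl ?nr_ge0.
have := h1 (((nr x + d)^-1)%:C *: x).
rewrite adjsZ conj_real sx (linZ tlin) nrZ nrC ger0_norm; last first.
  by rewrite invr_ge0 ltW.
rewrite mulrC ltr_pdivrMr// mul1r ltrDl => /(_ erefl d0).
case: (tau x) => p q /=; rewrite mul0r subr0 mulrC ler_pdivrMr// => h.
rewrite (le_trans h)// mulrDr addrC lerD2r.
have -> : e = M * d by rewrite mulrC divfK// gt_eqF.
by rewrite ler_wpM2r ?ltW// /M ltrDl.
Qed.

(** After rotation by a phase the value at [a] is real, so it equals the value at the real part of
    the rotated element, which is selfadjoint and of norm at most [nr a]. *)
Lemma pos_le a : nr (tau a : R[i]) <= complex.Re (tau u) * nr a.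
Proof.
set t : R[i] := tau a; have [c [nc ct]] := phase t.
pose h := half *: (c *: a + adj (c *: a)).
have sh : adj h = h by rewrite /h adjsZ conj_real adjD adjK addrC.
have nh : nr h <= nr a.
  rewrite /h nrZ nrC ger0_norm ?invr_ge0// mulrC ler_pdivrMr// (le_trans (nrD _ _))//.
  by rewrite nr_adj nrZ nc mul1r -mulr2n mulr_natr.
have -> : nr t = complex.Re (tau h).
  rewrite (linZ tlin) (linD tlin) pos_adj (linZ tlin).
  rewrite -[c *: tau a]/(c * t) ct conj_real -rmorphD.
  rewrite -[half *: _]/(half * _) -rmorphM /=.
  by rewrite -mulr2n -(mulr_natl (nr t)) mulrA mulVf ?mul1r ?pnatr_eq0.
by rewrite (le_trans (tle sh))// ler_wpM2l ?pos_unit_Re.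
Qed.

End PositiveFunctional.

(** * The Hahn-Banach theorem *)

Section HahnBanach.
Variables (R : realType) (V : normedModType R[i]).
Implicit Types (x y : V) (p q : V -> R) (t : R).

Definition sublinear q := (forall x y, q (x + y) <= q x + q y) /\
  (forall t x, 0 <= t -> q (t%:C *: x) = t * q x).

Lemma sublinear0 q : sublinear q -> q 0 = 0.
Proof. by case=> _ /(_ 0 0 (lexx _)); rewrite scaler0 mul0r. Qed.

Lemma sublinearN q x : sublinear q -> - q (- x) <= q x.
Proof.
move=> sq; have := sq.1 x (- x).
by rewrite subrr (sublinear0 sq) -lerBlDr sub0r.
Qed.

Lemma sublinear_homo q : q 0 = 0 ->
  (forall t x, 0 < t -> q (t%:C *: x) <= t * q x) ->
  forall t x, 0 <= t -> q (t%:C *: x) = t * q x.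
Proof.
move=> q0 qZ t x; rewrite le_eqVlt => /orP[/eqP<-|t0].
  by rewrite scale0r mul0r.
apply/eqP; rewrite eq_le qZ//= -ler_pdivlMl//.
have := qZ t^-1 (t%:C *: x); rewrite invr_gt0 => /(_ t0).
by rewrite scalerA -rmorphM /= mulVf ?scale1r// gt_eqF.
Qed.

Section Shift.
Variables (q : V -> R) (y : V).
Hypothesis sq : sublinear q.

Let values x : set R := [set q (x + t%:C *: y) - t * q y | t in [set t | 0 <= t]].

(** Lowers [q] towards additivity in the direction [y]: the term [t = 1] gives
    [qshift x <= q (x + y) - q y], the missing half of additivity once [qshift] and [q] agree. *)
Definition qshift x := inf (values x).

Let lb x : lbound (values x) (- q (- x)).
Proof.
move=> _ [t /= t0 <-]; rewrite lerBrDr addrC -sq.2// lerBlDr addrC.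
have := sq.1 (- x) (x + t%:C *: y); rewrite addKr addrC; exact.
Qed.

Let ne x : values x !=set0.
Proof. by exists (q (x + 0%:C *: y) - 0 * q y); exists 0 => /=. Qed.

Lemma qshift_le x t : 0 <= t -> qshift x <= q (x + t%:C *: y) - t * q y.
Proof.
move=> t0; apply: ge_inf; first by exists (- q (- x)); exact: lb.
by exists t.
Qed.

Lemma qshift_ge x m :
  (forall t, 0 <= t -> m <= q (x + t%:C *: y) - t * q y) -> m <= qshift x.
Proof. by move=> h; apply: lb_le_inf (ne x) _ => _ [t /= t0 <-]; exact: h. Qed.

Lemma qshift_le_id x : qshift x <= q x.
Proof.
by have := qshift_le x (lexx 0); rewrite scale0r addr0 mul0r subr0.
Qed.

Lemma qshift_sublinear : sublinear qshift.
Proof.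
split => [x1 x2|].
  rewrite -lerBlDr; apply: qshift_ge => t1 t10.
  rewrite lerBlDr -lerBlDl; apply: qshift_ge => t2 t20.
  rewrite lerBlDl; have := qshift_le (x1 + x2) (addr_ge0 t10 t20).
  move=> /le_trans; apply; rewrite rmorphD/= scalerDl (addrACA x1) mulrDl.
  by rewrite [leRHS]addrACA -opprD lerD2r; exact: sq.1.
apply: sublinear_homo.
  apply/eqP; rewrite eq_le (le_trans (qshift_le_id 0)) ?(sublinear0 sq)//=.
  by apply: qshift_ge => t t0; rewrite add0r sq.2// subrr.
move=> t x t0; rewrite -ler_pdivrMl//; apply: qshift_ge => s s0.
rewrite ler_pdivrMl//; apply: le_trans (qshift_le _ (mulr_ge0 (ltW t0) s0)) _.
by rewrite mulrBr -mulrA lerD2r -(sq.2 _ _ (ltW t0)) scalerDr scalerA -rmorphM.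
Qed.

End Shift.

(* By Zorn's lemma there is a minimal sublinear functional below [p], and a   *)
(* minimal sublinear functional [q] is linear since [qshift q y = q].         *)
Lemma sublinear_minorant p : sublinear p -> exists f : V -> R,
  [/\ {morph f : x y / x + y}, forall t x, f (t%:C *: x) = t * f x
    & forall x, f x <= p x].
Proof.
move=> sp; pose T := {q : V -> R | sublinear q /\ forall x, q x <= p x}.
(* The order is reversed, since Zorn's lemma yields maximal elements and a minimal functional is
   sought. *)
pose le (q1 q2 : T) := `[< forall x, sval q2 x <= sval q1 x >].
have [||||q qmin] := @Zorn T le.
- by move=> q; apply/asboolP => x.
- move=> q r s /asboolP h1 /asboolP h2; apply/asboolP => x.
  exact: le_trans (h2 x) (h1 x).
- move=> [q hq] [r hr] /asboolP h1 /asboolP h2; apply: eq_exist => /=.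
  by apply/funext => x; apply/eqP; rewrite eq_le h2 h1.
- move=> A Atot; have [A0|/set0P A0] := eqVneq A set0.
    have hp : sublinear p /\ forall x, p x <= p x by [].
    by exists (exist _ p hp) => q; rewrite A0.
  pose vals x : set R := [set sval q x | q in A].
  have lb x : lbound (vals x) (- p (- x)).
    move=> _ [[q [sq qp]] Aq <-] /=.
    by rewrite (le_trans _ (sublinearN x sq))// lerN2.
  have ne x : vals x !=set0 by case: A0 => q Aq; exists (sval q x), q.
  pose m x := inf (vals x).
  have mle x (q : T) : A q -> m x <= sval q x.
    move=> Aq; apply: ge_inf; first by exists (- p (- x)); exact: lb.
    by exists q.
  have gem x c : (forall q : T, A q -> c <= sval q x) -> c <= m x.
    by move=> h; apply: lb_le_inf (ne x) _ => _ [q Aq <-]; exact: h.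
  have sm : sublinear m.
    split=> [x y|].
      rewrite -lerBlDr; apply: (gem) => q Aq; rewrite lerBlDr -lerBlDl.
      apply: (gem) => r Ar; rewrite lerBlDl.
      (* Members of the chain are comparable; the subadditivity of the smaller one bounds the
         infimum at [x + y]. *)
      have [/asboolP qr|/asboolP rq] := Atot _ _ Aq Ar.
        by rewrite (le_trans (mle _ _ Ar))// (le_trans ((svalP r).1.1 x y))// lerD.
      by rewrite (le_trans (mle _ _ Aq))// (le_trans ((svalP q).1.1 x y))// lerD.
    apply: sublinear_homo.
      apply/eqP; rewrite eq_le; apply/andP; split.
        case: A0 => q Aq; rewrite (le_trans (mle _ _ Aq))//.
        by rewrite (sublinear0 (svalP q).1).
      by apply: (gem) => q Aq; rewrite (sublinear0 (svalP q).1).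
    move=> t x t0; rewrite -ler_pdivrMl//; apply: (gem) => q Aq.
    rewrite ler_pdivrMl// -((svalP q).1.2 _ _ (ltW t0)); exact: mle.
  have mp : forall x, m x <= p x.
    case: A0 => q Aq x; rewrite (le_trans (mle _ _ Aq))//.
    exact: (svalP q).2.
  exists (exist _ m (conj sm mp)) => q Aq; apply/asboolP => x; exact: mle.
have [sq qp] := svalP q; exists (sval q).
have qE y x : qshift (sval q) y x = sval q x.
  have hqs : sublinear (qshift (sval q) y) /\ forall x, qshift (sval q) y x <= p x.
    split; first exact: qshift_sublinear.
    by move=> z; rewrite (le_trans _ (qp z))//; exact: qshift_le_id.
  have /qmin qq : le q (exist _ _ hqs).
    by apply/asboolP => z /=; exact: qshift_le_id.
  exact: (congr1 (fun r : T => sval r x) qq).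
have qD : {morph sval q : x y / x + y}.
  move=> a b; apply/eqP; rewrite eq_le sq.1 /=.
  have := @qshift_le _ b sq a 1 ler01.
  by rewrite qE scale1r mul1r lerBrDr.
have qN x : sval q (- x) = - sval q x.
  apply: (addrI (sval q x)); rewrite -qD !subrr; exact: sublinear0.
split=> // t x; have [t0|t0] := leP 0 t; first exact: sq.2.
rewrite -[t]opprK rmorphN scaleNr qN sq.2 ?mulNr// oppr_ge0; exact: ltW.
Qed.

Lemma nr_sublinear : sublinear (@nr R V).
Proof.
by split=> [|t x t0]; [exact: nrD|rewrite nrZ nrC ger0_norm].
Qed.

(* The sublinear functional [qshift nr e] is at most [-1] at [- e].           *)
Theorem norming_functional (e : V) : nr e = 1 -> exists f : V -> R[i]^o,
  [/\ linear f, forall a, nr (f a : R[i]) <= nr a & f e = 1].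
Proof.
move=> e1; have snr := nr_sublinear.
have [g [gD gZ gp]] := sublinear_minorant (qshift_sublinear e snr).
have gle x : g x <= nr x by rewrite (le_trans (gp x))//; exact: qshift_le_id.
have g0 : g 0 = 0 by have := gZ 0 0; rewrite scaler0 mul0r.
have gN x : g (- x) = - g x.
  by apply: (addrI (g x)); rewrite -gD !subrr.
have ge : g e = 1.
  apply/eqP; rewrite eq_le -{1}e1 gle /= -lerN2 -gN (le_trans (gp _))//.
  have := qshift_le e snr (- e) ler01.
  by rewrite scale1r addNr nr0 mul1r e1 sub0r.
(* The complex linear functional whose real part is [g]. *)
pose f (a : V) : R[i]^o := g a -i* g ('i *: a).
have flin : linear f.
  move=> k a b; rewrite /f scalerDr !gD scalerA.
  have kE c : g (k *: c) = complex.Re k * g c + complex.Im k * g ('i *: c).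
    rewrite {1}(complexE k) scalerDl gD gZ; congr (_ + _).
    by rewrite (mulrC 'i) -scalerA gZ.
  have -> : 'i * k *: a = k *: ('i *: a) by rewrite scalerA mulrC.
  rewrite !kE scalerA mulii scaleN1r gN.
  rewrite -[k *: (_ : R[i]^o)]/(k * (_ : R[i])).
  case: k {kE} => p q /=; apply/eqP; rewrite eq_complex /=; apply/andP; split;
    apply/eqP; ring.
have fle a : nr (f a : R[i]) <= nr a.
  have [c [nc cf]] := phase (f a : R[i]).
  have := congr1 (@complex.Re R) cf; move=> /= <-.
  rewrite -[c * f a]/(c *: f a) -(linZ flin) /f /= (le_trans (gle _))//.
  by rewrite nrZ nc mul1r.
exists f; split=> //; apply/eqP; rewrite eq_complex /= ge eqxx /=.
(* Modulus at most 1 and real part 1 leave no room for an imaginary part. *)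
have : nr (f e : R[i]) ^+ 2 <= 1.
  by rewrite expr_le1 ?nr_ge0// -e1 fle.
rewrite nr_sqr /= ge expr1n gerDl sqrrN => h.
have : g ('i *: e) ^+ 2 == 0 by rewrite eq_le h sqr_ge0.
by rewrite sqrf_eq0 => /eqP ->; rewrite oppr0.
Qed.

End HahnBanach.

(** * Dense subalgebras *)

Section Generation.
Variables (R : realType) (B : cstarAlgType R).
Implicit Types (S G : set B) (a b c : B).

Definition star_subalgebra S :=
  [/\ S 0, forall (k : R[i]) a b, S a -> S b -> S (k *: a + b),
      forall a b, S a -> S b -> S (a ** b) & forall a, S a -> S (adj a)].

Lemma closure_seq S b :
  closure S b <-> exists c : nat -> B, (forall n, S (c n)) /\ ccvg c b.
Proof.
split => [/closureE|[c [Sc cb]]]; first exact: ccvg_seq.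
apply/closureE => e /cb[N /(_ _ (leqnn _)) h]; exists (c N).
by rewrite nr_distC.
Qed.

Lemma closure_star_subalgebra S :
  star_subalgebra S -> cstar_subalgebra (closure S).
Proof.
move=> [S0 SD SM Sadj]; split.
- exact: closed_closure.
- exact: subset_closure.
- move=> k a b /closure_seq[c [Sc ca]] /closure_seq[d [Sd db]].
  apply/closure_seq; exists (fun n => k *: c n + d n); split=> [n|].
    exact: SD.
  exact/ccvgD/db/ccvgZ.
- move=> a b /closure_seq[c [Sc ca]] /closure_seq[d [Sd db]].
  apply/closure_seq; exists (fun n => c n ** d n); split=> [n|].
    exact: SM.
  exact: ccvgM.
- move=> a /closure_seq[c [Sc ca]].
  apply/closure_seq; exists (fun n => adj (c n)); split=> [n|].
    exact: Sadj.
  by apply: (@ccvg_bounded _ _ _ _ 1) ca => [x y|x];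
    [exact: adjB|rewrite nr_adj mul1r].
Qed.

Definition dense_seq S := forall b, exists c : nat -> B, (forall n, S (c n)) /\ ccvg c b.

Lemma generates_dense G S :
  cstar_generates G -> star_subalgebra S -> G `<=` S -> dense_seq S.
Proof.
move=> gG sS GS b; apply/closure_seq.
rewrite (gG _ (closure_star_subalgebra sS))// => x /GS.
exact: subset_closure.
Qed.

Inductive lspan G : B -> Prop :=
| lspan0 : lspan G 0
| lspanD (k : R[i]) a b : G a -> lspan G b -> lspan G (k *: a + b).

Lemma lspan_sub G a : G a -> lspan G a.
Proof.
by move=> Ga; have := lspanD 1 Ga (lspan0 G); rewrite scale1r addr0.
Qed.

Lemma lspan_lin G (k : R[i]) a b :
  lspan G a -> lspan G b -> lspan G (k *: a + b).
Proof.
move=> + Gb; elim=> [|l c d Gc _ IH]; first by rewrite scaler0 add0r.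
by rewrite scalerDr -addrA scalerA; exact: lspanD.
Qed.

Lemma lspan_star_subalgebra G :
  (forall a b, G a -> G b -> G (a ** b)) -> (forall a, G a -> G (adj a)) ->
  star_subalgebra (lspan G).
Proof.
move=> GM Gadj; split.
- exact: lspan0.
- exact: lspan_lin.
- move=> a b Ga Gb; elim: Ga => [|k c d Gc _ IH].
    by rewrite amul0l; exact: lspan0.
  rewrite amulDl amulZl; apply: lspan_lin IH.
  elim: Gb => [|l x y Gx _ IH]; first by rewrite amul0r; exact: lspan0.
  rewrite amulDr amulZr; apply: lspanD IH; exact: GM.
- move=> a; elim=> [|k c d Gc _ IH]; first by rewrite adj0; exact: lspan0.
  by rewrite adjD adjsZ; apply: lspanD IH; exact: Gadj.
Qed.

Definition bounded_linear (V : normedModType R[i]) (f : B -> V) :=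
  linear f /\ exists C, forall a, nr (f a) <= C * nr a.

Lemma dense_eq0 (V : normedModType R[i]) S (f : B -> V) :
  dense_seq S -> bounded_linear f -> (forall c, S c -> f c = 0) ->
  forall b, f b = 0.
Proof.
move=> dS [flin [C fC]] f0 b; have [c [Sc cb]] := dS b.
have := ccvg_bounded (linB flin) fC cb.
rewrite (_ : (fun n => _) = fun=> 0); last by apply/funext => n; exact: f0.
by move=> h; apply: (ccvg_unique h); exact: ccvg_cst.
Qed.

Lemma dense_lspan_eq0 (V : normedModType R[i]) G (f : B -> V) :
  dense_seq (lspan G) -> bounded_linear f -> (forall c, G c -> f c = 0) ->
  forall b, f b = 0.
Proof.
move=> dS flin f0; apply: (dense_eq0 dS flin) => c.
elim=> [|k a b Ga _ IH]; first exact: (lin0 flin.1).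
by rewrite flin.1 f0// IH scaler0 addr0.
Qed.

Lemma dense_pos S (f : B -> R[i]^o) :
  dense_seq S -> bounded_linear f -> (forall c, S c -> 0 <= f (adj c ** c)) ->
  forall b, 0 <= f (adj b ** b).
Proof.
move=> dS [flin [C fC]] f0 b; have [c [Sc cb]] := dS b.
have acb : ccvg (fun n => adj (c n)) (adj b).
  by apply: (@ccvg_bounded _ _ _ _ 1) cb => [x y|x];
    [exact: adjB|rewrite nr_adj mul1r].
have := ccvg_bounded (linB flin) fC (ccvgM acb cb).
by move/ccvg_ge0; apply => n; exact: f0.
Qed.

Section BoundedLinear.
Variable V : normedModType R[i].
Implicit Types f g : B -> V.

Lemma bounded_linearB f g : bounded_linear f -> bounded_linear g ->
  bounded_linear (fun a => f a - g a).
Proof.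
move=> [fl [C fC]] [gl [D gD]]; split=> [k a b|].
  by rewrite fl gl scalerBr opprD addrACA.
exists (C + D) => a; rewrite (le_trans (nrB _ _))// mulrDl lerD//.
Qed.

Lemma bounded_linearZ (k : R[i]) f : bounded_linear f ->
  bounded_linear (fun a => k *: f a).
Proof.
move=> [fl [C fC]]; split=> [l a b|].
  by rewrite fl scalerDr !scalerA mulrC.
by exists (nr k * C) => a; rewrite nrZ -mulrA ler_wpM2l ?nr_ge0.
Qed.

Lemma bounded_linear_comp (A : cstarAlgType R) f (h : A -> B) :
  bounded_linear f -> linear h ->
  (exists C, forall a : A, nr (h a) <= C * nr a) ->
  linear (fun a : A => f (h a)) /\
  exists C, forall a : A, nr (f (h a)) <= C * nr a.
Proof.
move=> [fl [C fC]] hl [D hD]; split=> [k a b|]; first by rewrite hl fl.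
exists (`|C| * D) => a; rewrite (le_trans (fC _))// -mulrA.
by rewrite (le_trans (ler_wpM2r (nr_ge0 _) (ler_norm C)))// ler_wpM2l.
Qed.

End BoundedLinear.

Lemma bounded_amull a : exists C, forall b, nr (a ** b) <= C * nr b.
Proof. by exists (nr a) => b; exact: nrM. Qed.

Lemma bounded_amulr a : exists C, forall b, nr (b ** a) <= C * nr b.
Proof. by exists (nr a) => b; rewrite mulrC; exact: nrM. Qed.

Lemma bounded_linear_mull (V : normedModType R[i]) (f : B -> V) a :
  bounded_linear f -> bounded_linear (fun b => f (a ** b)).
Proof.
move=> hf; apply: (bounded_linear_comp hf (amull_linear a)).
exact: bounded_amull.
Qed.

Lemma bounded_linear_mulr (V : normedModType R[i]) (f : B -> V) a :
  bounded_linear f -> bounded_linear (fun b => f (b ** a)).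
Proof.
move=> hf; apply: (bounded_linear_comp hf (amulr_linear a)).
exact: bounded_amulr.
Qed.

End Generation.

(** * The vacuum projection *)

Section Vacuum.
Variables (R : realType) (B : cstarAlgType R) (u : B) (I : finType) (s : I -> B).
Variable D : set B.
Implicit Types (a b c x y : B) (e f : I) (n m : nat).

(* [D] stands for the coefficient algebra: the image of C(E^oo) in            *)
(* T(X(E^oo)), and the span of the vertex projections in TC*(E).              *)
Record toeplitz_system := ToeplitzSystem {
  ts_unit : is_unit u;
  ts_D1 : D u;
  ts_Dlin : forall (k : R[i]) a b, D a -> D b -> D (k *: a + b);
  ts_DM : forall a b, D a -> D b -> D (a ** b);
  ts_Dadj : forall a, D a -> D (adj a);
  ts_Dcomm : forall a b, D a -> D b -> a ** b = b ** a;
  ts_shift : forall a e, D a -> exists a', D a' /\ a ** s e = s e ** a';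
  ts_orth : forall e f, e != f -> adj (s e) ** s f = 0;
  ts_src : forall e, D (adj (s e) ** s e);
  ts_iso : forall e, s e ** (adj (s e) ** s e) = s e
}.

Hypothesis ts : toeplitz_system.
Let hu := ts_unit ts.

Definition vac : B := u - \sum_e s e ** adj (s e).

Lemma ts_D0 : D 0.
Proof.
by have := ts_Dlin ts (-1) (ts_D1 ts) (ts_D1 ts); rewrite scaleN1r addNr.
Qed.

Lemma ts_iso_adj e : adj (s e) ** s e ** adj (s e) = adj (s e).
Proof. by rewrite -[in RHS](ts_iso ts e) !adjM adjK. Qed.

Lemma vac_adj : adj vac = vac.
Proof.
rewrite /vac adjB (unit_adj hu) adj_sum; congr (_ - _).
by apply: eq_bigr => e _; rewrite adjM adjK.
Qed.

Lemma vac_s e : vac ** s e = 0.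
Proof.
rewrite /vac amulBl (unit_mull _ hu) amul_suml (bigD1 e)//= big1 ?addr0.
  by rewrite -amulA (ts_iso ts) subrr.
by move=> f fe; rewrite -amulA (ts_orth ts)// amul0r.
Qed.

Lemma sadj_vac e : adj (s e) ** vac = 0.
Proof. by rewrite -vac_adj -adjM vac_s adj0. Qed.

Lemma vacK : vac ** vac = vac.
Proof.
rewrite {2}/vac amulBr (unit_mulr _ hu) amul_sumr big1 ?subr0// => e _.
by rewrite amulA vac_s amul0l.
Qed.

Lemma sadj_shift a e : D a -> exists a', D a' /\ adj (s e) ** a = a' ** adj (s e).
Proof.
move=> /(ts_Dadj ts)/(ts_shift ts e)[a' [Da' h]].
exists (adj a'); split; first exact: ts_Dadj.
by have := congr1 (@adj _ _) h; rewrite !adjM adjK.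
Qed.

(** If [a ** s e = s e ** a1], then [adj (s e) ** a = adj (s e) ** s e ** a1 ** adj (s e)]; hence
    [a] commutes with each range projection [s e ** adj (s e)]. *)
Lemma vac_comm a : D a -> a ** vac = vac ** a.
Proof.
move=> Da; rewrite /vac amulBr amulBl (unit_mull _ hu) (unit_mulr _ hu).
rewrite amul_sumr amul_suml; congr (_ - _); apply: eq_bigr => e _.
have [a1 [Da1 h1]] := ts_shift ts e Da; have [a2 [Da2 h2]] := sadj_shift e Da.
have E : a2 ** adj (s e) = adj (s e) ** s e ** a1 ** adj (s e).
  by rewrite -[in LHS](ts_iso_adj e) !amulA -h2 -(amulA _ a) h1 amulA.
rewrite amulA h1 -[RHS]amulA h2 E !amulA; congr (_ ** _ ** _).
by rewrite -amulA (ts_iso ts).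
Qed.

(* In T(X(E^oo)) this is [psi^n(X^n) Q].                                      *)
Fixpoint vac_deg n : set B :=
  if n is m.+1 then
    [set x | exists2 y : I -> B, forall e, vac_deg m (y e) & x = \sum_e s e ** y e]
  else [set x | exists2 a, D a & x = a ** vac].

Lemma vac_deg_lin n (k : R[i]) x y :
  vac_deg n x -> vac_deg n y -> vac_deg n (k *: x + y).
Proof.
elim: n x y => [|n IH] x y /= [a ha ->] [b hb ->].
  exists (k *: a + b); first exact: ts_Dlin.
  by rewrite amulDl amulZl.
exists (fun e => k *: a e + b e); first by move=> e; exact: IH.
by rewrite scaler_sumr -big_split/=; apply: eq_bigr => e _; rewrite amulDr amulZr.
Qed.

Lemma vac_deg0 n : vac_deg n 0.
Proof.
elim: n => [|n IH] /=; first by exists 0; [exact: ts_D0|rewrite amul0l].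
by exists (fun=> 0) => //; rewrite big1// => e _; rewrite amul0r.
Qed.

Lemma vac_deg_coef n a x : D a -> vac_deg n x -> vac_deg n (a ** x).
Proof.
elim: n a x => [|n IH] a x Da /= [b hb ->].
  by exists (a ** b); [exact: ts_DM|rewrite amulA].
have sh e : exists a', D a' /\ a ** s e = s e ** a' by exact: ts_shift.
exists (fun e => sval (cid (sh e)) ** b e) => [e|].
  by case: cid => a' [Da' _] /=; exact: IH.
rewrite amul_sumr; apply: eq_bigr => e _; case: cid => a' [_ /= h].
by rewrite !amulA h.
Qed.

Lemma vac_deg_s n e x : vac_deg n x -> vac_deg n.+1 (s e ** x).
Proof.
move=> nx; exists (fun f => if f == e then x else 0) => [f|].
  by case: eqP => // _; exact: vac_deg0.
rewrite (bigD1 e)//= eqxx big1 ?addr0// => f /negbTE ->.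
by rewrite amul0r.
Qed.

Lemma sadj_sum e (y : I -> B) :
  adj (s e) ** (\sum_f s f ** y f) = adj (s e) ** s e ** y e.
Proof.
rewrite amul_sumr (bigD1 e)//= amulA big1 ?addr0// => f fe.
by rewrite amulA (ts_orth ts) ?amul0l// eq_sym.
Qed.

Lemma vac_deg_sadj n e x : vac_deg n.+1 x -> vac_deg n (adj (s e) ** x).
Proof.
move=> [y ny ->]; rewrite sadj_sum.
exact: vac_deg_coef (ts_src ts e) (ny e).
Qed.

Lemma vac_deg0_sadj e x : vac_deg 0 x -> adj (s e) ** x = 0.
Proof.
move=> [a Da ->]; have [a' [_ h]] := sadj_shift e Da.
by rewrite amulA h -amulA sadj_vac amul0r.
Qed.

(** Edges are cancelled on both sides until one factor has degree 0, where [adj (s e)] annihilates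
    it. *)
Lemma vac_deg_orth n m x y :
  n != m -> vac_deg n x -> vac_deg m y -> adj x ** y = 0.
Proof.
elim: n m x y => [|n IH] [|m] x y // nm nx ny.
- case: ny => z nz ->; rewrite amul_sumr big1// => e _.
  by rewrite amulA -[s e]adjK -adjM vac_deg0_sadj// adj0 amul0l.
- case: nx => z nz ->; rewrite adj_sum amul_suml big1// => e _.
  by rewrite adjM -amulA vac_deg0_sadj// amul0r.
- case: nx => z nz ->; rewrite adj_sum amul_suml big1// => e _.
  rewrite adjM -amulA; exact: IH nm (nz e) (vac_deg_sadj e ny).
Qed.

Definition vac_module := lspan [set x | exists n, vac_deg n x].

(** Allowing every [L] from [K] on lets two decompositions be padded to a common length. *)
Lemma vac_module_graded x : vac_module x -> exists x_ : nat -> B,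
  (forall n, vac_deg n (x_ n)) /\
  exists K, forall L, (K <= L)%N -> x = \sum_(n < L) x_ n.
Proof.
elim=> [|k a b [n na] _ [x_ [nx [K xK]]]].
  exists (fun=> 0); split; first exact: vac_deg0.
  by exists 0%N => L _; rewrite big1.
exists (fun m => (if m == n then k *: a else 0) + x_ m); split => [m|].
  case: eqP => [->|_]; first exact: vac_deg_lin.
  by rewrite add0r.
exists (maxn K n.+1) => L; rewrite geq_max => /andP[KL nL].
rewrite big_split/= -(xK L)//; congr (_ + _).
rewrite (bigD1 (Ordinal nL))//= eqxx big1 ?addr0// => i.
by rewrite -val_eqE /= => /negbTE ->.
Qed.

(** The elements that act, with their adjoints, on the algebraic Fock module. They form a star
    subalgebra containing the generators, and no normal form for words is needed to compress them by
    [vac]. *)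
Definition vac_stab c := forall x, vac_module x ->
  vac_module (c ** x) /\ vac_module (adj c ** x).

Lemma vac_stab_star_subalgebra : star_subalgebra vac_stab.
Proof.
split.
- by move=> x _; rewrite adj0 amul0l; split; exact: lspan0.
- move=> k a b ha hb x mx; have [a1 a2] := ha x mx; have [b1 b2] := hb x mx.
  by rewrite adjD adjsZ !amulDl !amulZl; split; exact: lspan_lin.
- move=> a b ha hb x mx; rewrite adjM -!amulA.
  by split; [exact: (ha _ (hb _ mx).1).1|exact: (hb _ (ha _ mx).2).2].
- by move=> a ha x mx; rewrite adjK; have [] := ha x mx.
Qed.

Lemma vac_stab_gen c :
  (forall n x, vac_deg n x -> vac_module (c ** x)) ->
  (forall n x, vac_deg n x -> vac_module (adj c ** x)) -> vac_stab c.
Proof.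
move=> h1 h2 x; elim=> [|k a b [n na] _ [IH1 IH2]].
  by rewrite !amul0r; split; exact: lspan0.
rewrite !amulDr !amulZr; split; apply: lspan_lin => //.
  exact: h1 na.
exact: h2 na.
Qed.

Lemma vac_stab_coef a : D a -> vac_stab a.
Proof.
move=> Da; apply: vac_stab_gen => n x nx; apply: lspan_sub; exists n.
  exact: vac_deg_coef.
by apply: vac_deg_coef => //; exact: ts_Dadj.
Qed.

Lemma vac_stab_s e : vac_stab (s e).
Proof.
apply: vac_stab_gen => n x nx.
  by apply: lspan_sub; exists n.+1; exact: vac_deg_s.
case: n nx => [|n] nx; first by rewrite vac_deg0_sadj//; exact: lspan0.
by apply: lspan_sub; exists n; exact: vac_deg_sadj.
Qed.

Lemma vac_deg_vac : vac_deg 0 vac.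
Proof. by exists u; [exact: ts_D1|rewrite (unit_mull _ hu)]. Qed.

Lemma vac_module_vac : vac_module vac.
Proof. by apply: lspan_sub; exists 0%N; exact: vac_deg_vac. Qed.

(** By orthogonality of degrees, only the degree 0 component of [c ** vac] survives multiplication
    by [vac] on the left. *)
Lemma vac_corner c : vac_stab c -> exists2 a, D a & vac ** c ** vac = a ** vac.
Proof.
move=> /(_ _ vac_module_vac)[/vac_module_graded[x [nx [K xK]]] _].
have [a Da ax] := nx 0%N; exists a => //.
rewrite -amulA (xK K.+1)// big_ord_recl /= amulDr amul_sumr big1 ?addr0.
  by rewrite ax amulA -(vac_comm Da) -amulA vacK.
move=> i _; rewrite -vac_adj; apply: (vac_deg_orth _ vac_deg_vac) => //.
by rewrite /bump.
Qed.

(** The cross terms between the graded components of [c ** vac] vanish. A square in degree [n + 1]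
    is a sum of squares of [adj (s e) ** s e ** y e], of degree [n], so everything reduces to degree
    0. *)
Lemma vac_stab_pos (w : B -> R[i]^o) : linear w ->
  (forall a, D a -> 0 <= w (adj (a ** vac) ** (a ** vac))) ->
  forall c, vac_stab c -> 0 <= w (vac ** (adj c ** c) ** vac).
Proof.
move=> wlin wpos.
have npos n : forall x, vac_deg n x -> 0 <= w (adj x ** x).
  elim: n => [_ [a Da ->]|n IH _ [y ny ->]]; first exact: wpos.
  rewrite adj_sum amul_suml (lin_sum wlin); apply: sumr_ge0 => e _.
  rewrite adjM -amulA sadj_sum.
  have -> : adj (y e) ** (adj (s e) ** s e ** y e) =
     adj (adj (s e) ** s e ** y e) ** (adj (s e) ** s e ** y e).
    rewrite !adjM adjK -!amulA; congr (_ ** _).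
    by rewrite -[in LHS](ts_iso_adj e) -!amulA.
  exact: IH (vac_deg_coef (ts_src ts e) (ny e)).
move=> c /(_ _ vac_module_vac)[/vac_module_graded[x [nx [K xK]]] _].
have -> : vac ** (adj c ** c) ** vac = adj (c ** vac) ** (c ** vac).
  by rewrite adjM vac_adj !amulA.
rewrite (xK K)//.
rewrite adj_sum amul_suml (lin_sum wlin); apply: sumr_ge0 => i _.
rewrite amul_sumr (bigD1 i)//= big1 ?addr0; first exact: npos (nx i).
by move=> j ji; apply: vac_deg_orth (nx i) (nx j); rewrite eq_sym.
Qed.

End Vacuum.

(** * Complex differentiability *)

Section Derivable.
Variables (K : numFieldType) (W : normedModType K).
Implicit Types (f : K^o -> W) (z : K^o) (l : W).

(** Differentiability without a quotient: [h = 0] needs no exclusion and bounded linear maps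
    preserve the estimate directly. *)
Definition diff_at f z l := forall e : K, 0 < e -> exists2 d : K, 0 < d &
  forall h : K, `|h| < d -> `|f (h + z) - f z - h *: l| <= e * `|h|.

Lemma diff_atP f z l :
  diff_at f z l <-> (fun h : K^o => h^-1 *: (f (h + z) - f z)) @ 0^' --> l.
Proof.
have E (h : K) : h != 0 -> `|l - h^-1 *: (f (h + z) - f z)| =
    `|f (h + z) - f z - h *: l| / `|h|.
  move=> h0; rewrite distrC mulrC -normfV -normrZ [in RHS]scalerBr [in RHS]scalerA mulVf//.
  by rewrite scale1r.
split => [fl|/cvgrPdist_le fl e e0].
  apply/cvgrPdist_le => e /fl[d d0 hd]; rewrite near_withinE.
  apply/nbhs_ballP; exists d => //= h; rewrite /ball/= sub0r normrN => /hd + h0.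
  by rewrite E// ler_pdivrMr// normr_gt0.
have := fl e e0; rewrite near_withinE => /nbhs_ballP[d /= d0 hd].
exists d => // h hd'; have [->|h0] := eqVneq h 0.
  by rewrite add0r subrr scale0r subr0 !normr0 mulr0.
have := hd h; rewrite /ball /= sub0r normrN => /(_ hd' h0).
by rewrite E// ler_pdivrMr// normr_gt0.
Qed.

Lemma diff_at_derivable f z l : diff_at f z l -> derivable f z 1.
Proof.
move=> /diff_atP fl; apply/cvg_ex; exists l.
by under eq_fun do rewrite [_ *: 1]mulr1.
Qed.

Lemma derivable_diff_at f z : derivable f z 1 -> exists l, diff_at f z l.
Proof.
move=> /cvg_ex[/= l]; under eq_fun do rewrite [_ *: 1]mulr1.
by move=> fl; exists l; apply/diff_atP.
Qed.

Lemma is_derive_diff_at f z l : is_derive z 1 f l -> diff_at f z l.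
Proof.
move=> [/cvg_ex[/= m fm] <-]; apply/diff_atP.
rewrite /derive (cvg_lim _ fm)//.
by move: fm; under eq_fun do rewrite [_ *: 1]mulr1.
Qed.

End Derivable.

Lemma diff_at_comp (K : numFieldType) (V W : normedModType K) (g : V -> W)
    (C : K) (f : K^o -> V) (z : K^o) (l : V) :
  linear g -> (forall x, `|g x| <= C * `|x|) -> 0 < C ->
  diff_at f z l -> diff_at (fun h => g (f h)) z (g l).
Proof.
move=> glin gC C0 fl e e0; have [d d0 hd] := fl (e / C) (divr_gt0 e0 C0).
exists d => // h /hd; rewrite -(linZ glin) -!(linB glin) => h1.
by rewrite (le_trans (gC _))// -ler_pdivlMl// mulrA (mulrC C^-1).
Qed.

Lemma diff_atB (K : numFieldType) (V : normedModType K) (f g : K^o -> V)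
    (z : K^o) (l m : V) : diff_at f z l -> diff_at g z m ->
  diff_at (fun h => f h - g h) z (l - m).
Proof.
move=> fl gm e e0; have e20 : 0 < e / 2 by rewrite divr_gt0.
have [d d0 hd] := fl _ e20; have [d' d'0 hd'] := gm _ e20.
exists (Num.min d d').
  rewrite comparable_lt_min ?d0 ?d'0//.
  by apply: real_comparable; rewrite gtr0_real.
move=> h; rewrite comparable_lt_min; last first.
  by apply: real_comparable; rewrite gtr0_real.
move=> /andP[/hd h1 /hd' h2].
have -> : f (h + z) - g (h + z) - (f z - g z) - h *: (l - m) =
   (f (h + z) - f z - h *: l) - (g (h + z) - g z - h *: m).
  rewrite scalerBr !opprD !opprK !addrA.
  by rewrite (ACl (1*3*5*2*4*6))/=.
by rewrite (le_trans (ler_normB _ _))// (splitr e) mulrDl lerD.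
Qed.

(** * The complex exponential and its derivative *)

Section ComplexExponential.
Variable R : realType.
Implicit Types (k : R) (z : R[i]).

Definition cis (x : R) : R[i] := cos x +i* sin x.

Lemma cisD x y : cis (x + y) = cis x * cis y.
Proof.
rewrite /cis cosD sinD; apply/eqP; rewrite eq_complex /=.
by rewrite eqxx /= addrC eqxx.
Qed.

Lemma cis0 : cis 0 = 1.
Proof. by rewrite /cis cos0 sin0. Qed.

Lemma nr_cis x : nr (cis x) = 1.
Proof. by rewrite /nr normc_def /= cos2Dsin2 sqrtr1. Qed.

Lemma conj_cis x : Num.conj (cis x) = cis (- x).
Proof. by rewrite /cis cosN sinN; apply/eqP; rewrite eq_complex /= !eqxx. Qed.

(* [exp (i k z)]                                                              *)
Definition expi k z : R[i] :=
  (expR (- k * complex.Im z))%:C * cis (k * complex.Re z).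

Lemma expiD k z w : expi k (z + w) = expi k z * expi k w.
Proof.
rewrite /expi mulrACA -cisD -rmorphM -expRD.
by case: z w => [a b] [c d] /=; rewrite !mulrDr.
Qed.

Lemma expi_real k (t : R) : expi k t%:C = cis (k * t).
Proof. by rewrite /expi /= mulr0 expR0 mul1r. Qed.

Lemma expi_imag k (t : R) : expi k (t *i) = (expR (- k * t))%:C.
Proof. by rewrite /expi /= mulr0 cis0 mulr1. Qed.

Let exp_cis (a b : R) := (expR a)%:C * cis b - 1 - (a +i* b).

Let small (f : R -> R) (l c : R) : is_derive (0 : R) 1 f l -> f 0 = c ->
  forall e : R, 0 < e -> exists2 d : R, 0 < d & forall h, `|h| < d ->
    `|f h - c - h * l| <= e * `|h|.
Proof.
move=> /(@is_derive_diff_at _ R^o) fl f0 e /fl[d d0 hd]; exists d => // h /hd.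
by rewrite addr0 f0.
Qed.

Let exp_cis_small (e : R) : 0 < e -> exists2 d : R, 0 < d &
  forall a b, `|a| < d -> `|b| < d -> nr (exp_cis a b) <= e * (`|a| + `|b|).
Proof.
(* The terms [e' * |b|] occur 2 times in the real part and 4 + 1 times in the imaginary part. The
   bound [e' <= 1] keeps [1 + |a|] below 2 and [|sin b|] below [2 * |b|]. *)
move=> e0; have [e' [e'0 e'1 e'7]] : exists e' : R, [/\ 0 < e', e' <= 1 & 7 * e' <= e].
  exists (Num.min 1 (e / 7)); split; first by rewrite lt_min ltr01 divr_gt0.
    by rewrite ge_min lexx.
  by rewrite mulrC -ler_pdivlMr// ge_min lexx orbT.
have [d1 d10 h1] := small (is_derive_expR 0) (expR0 R) e'0.
have [d2 d20 h2] := small (is_derive_cos 0) (cos0 R) e'0.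
have [d3 d30 h3] := small (is_derive_sin 0) (sin0 R) e'0.
exists (Num.min (Num.min d1 d2) (Num.min d3 e')); first by rewrite !lt_min; lra.
move=> a b; rewrite !lt_min => /andP[/andP[/h1 + _] /andP[_ ae]].
move=> + /andP[/andP[_ /h2 +] /andP[/h3 + be]].
rewrite sin0 cos0 expR0 oppr0 mulr0 !(subr0, addr0, mulr1) => A S C.
have a0 := normr_ge0 a; have b0 := normr_ge0 b.
have cb : `|cos b| <= 1 by rewrite ler_norml cos_geN1 cos_le1.
have hRe : `|complex.Re (exp_cis a b)| <= e' * `|a| + 2 * (e' * `|b|).
  have -> : complex.Re (exp_cis a b) =
      (expR a - 1 - a) * cos b + (1 + a) * (cos b - 1).
    by rewrite /exp_cis /=; ring.
  rewrite (le_trans (ler_normD _ _))// !normrM lerD//.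
    by rewrite -[leRHS]mulr1 ler_pM.
  rewrite ler_pM// (le_trans (ler_normD _ _))// normr1; lra.
have hIm : `|complex.Im (exp_cis a b)| <= (2 * e') * (2 * `|b|) + e' * `|b|.
  have -> : complex.Im (exp_cis a b) = (expR a - 1) * sin b + (sin b - b).
    by rewrite /exp_cis /=; ring.
  rewrite (le_trans (ler_normD _ _))// normrM lerD//.
  rewrite ler_pM//.
    rewrite -(subrK a (expR a - 1)) (le_trans (ler_normD _ _))//.
have : e' * `|a| <= 1 * e' by apply: ler_pM; [exact: ltW e'0|done|done|exact: ltW ae].
    lra.
  rewrite -(subrK b (sin b)) (le_trans (ler_normD _ _))//.
  have : e' * `|b| <= 1 * `|b| by rewrite ler_wpM2r.
  lra.
have ea : 7 * e' * `|a| <= e * `|a| by rewrite ler_wpM2r.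
have eb : 7 * e' * `|b| <= e * `|b| by rewrite ler_wpM2r.
have ea0 : 0 <= e' * `|a| by rewrite mulr_ge0// ltW.
have eb0 : 0 <= e' * `|b| by rewrite mulr_ge0// ltW.
rewrite (le_trans (nr_le_ReIm _))//; lra.
Qed.

(** The functional equation [expiD] moves the estimate from [z] to 0, where [exp_cis_small]
    applies. *)
Lemma expi_diff k (z : R[i]^o) :
  diff_at (expi k : R[i]^o -> R[i]^o) z (expi k z * (k *i)).
Proof.
move=> e e0; pose M := nr (expi k z) + 1.
have M0 : 0 < M by rewrite ltr_wpDl ?nr_ge0.
have eE : e = (complex.Re e)%:C by rewrite RRe_real// gtr0_real.
have e0R : 0 < complex.Re e by rewrite -ltcR -eE.
pose N := `|k| + 1; have N0 : 0 < N by rewrite ltr_wpDl.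
(* [M] dominates [nr (expi k z)], [N] dominates [|k|], and 2 stands for the two real coordinates of
   [h]. *)
have [d d0 hd] := exp_cis_small (divr_gt0 e0R (mulr_gt0 M0 (mulr_gt0 N0 (ltr0Sn _ 1)))).
exists (d / N)%:C; first by rewrite ltcR divr_gt0.
move=> h; rewrite ltr_nr ltr_pdivlMr// => hdN.
rewrite [leRHS](_ : _ = (complex.Re e * nr h)%:C); last first.
  by rewrite rmorphM /= -eE -nrE.
rewrite ler_nr.
have bound (x : R) : `|x| <= nr h -> `|k * x| <= N * nr h.
  by move=> xh; rewrite normrM ler_pM// lerDl.
have hRe := bound _ (ler_Re_nr h).
have hIm : `|- k * complex.Im h| <= N * nr h.
  by rewrite mulNr normrN; exact/bound/ler_Im_nr.
have lt1 : N * nr h < d by rewrite mulrC.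
have := hd _ _ (le_lt_trans hIm lt1) (le_lt_trans hRe lt1).
have -> : expi k (h + z) - expi k z - h *: (expi k z * (k *i) : R[i]^o) =
    expi k z * exp_cis (- k * complex.Im h) (k * complex.Re h).
  rewrite expiD /exp_cis -/(expi k h) !mulrBr mulr1 (mulrC (expi k h)).
  congr (_ - _); rewrite -[h *: _]/(h * _) mulrCA; congr (_ * _).
  by case: (h) => x y; apply/eqP; rewrite eq_complex /= ; apply/andP; split; apply/eqP; ring.
set r := nr (exp_cis _ _) => rle; rewrite nrCM -/r.
have r2 : r <= complex.Re e / (M * (N * 2)) * (N * nr h + N * nr h).
  by rewrite (le_trans rle)// ler_wpM2l ?lerD// divr_ge0// ltW// !mulr_gt0.
have -> : complex.Re e * nr h = M * (complex.Re e / (M * (N * 2)) * (N * nr h + N * nr h)).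
  by field; rewrite !gt_eqF.
by rewrite ler_pM ?nr_ge0// lerDl.
Qed.

End ComplexExponential.

(** * KMS states and homogeneous elements *)

Section States.
Variables (R : realType) (B : cstarAlgType R) (u : B).
Hypothesis hu : is_unit u.
Variable phi : B -> R[i]^o.

(** By [pos_le] a positive functional attains its norm at the unit; [unit_state] is the converse. *)
Lemma state_unit : state phi -> phi u = 1.
Proof.
move=> [flin fpos fsup]; set S := [set _ | _ in _] in fsup.
have Sle x : S x -> x <= complex.Re (phi u).
  move=> [a /= + <-]; rewrite -[1](@rmorph1 _ _ (real_complex R)) ler_nr => a1.
  have := pos_le hu flin fpos a; rewrite /nr => /le_trans; apply.
  by rewrite -[leRHS]mulr1 ler_wpM2l// (pos_unit_Re hu fpos).
have u1 : 1 <= complex.Re (phi u).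
  rewrite -fsup; apply: ge_sup; last by move=> x; exact: Sle.
  by exists (complex.Re `|phi 0|), 0 => //=; rewrite normr0 ler01.
have u2 : complex.Re (phi u) <= 1.
  rewrite -fsup; apply: ub_le_sup; first by exists (complex.Re (phi u)).
  exists u; first by rewrite /= -[1](@rmorph1 _ _ (real_complex R)) ler_nr nr_unit.
  rewrite (pos_unitE hu fpos) -[LHS]/(nr ((complex.Re (phi u))%:C : R[i])) nrC /=.
  by rewrite ger0_norm// (le_trans ler01).
by rewrite (pos_unitE hu fpos); congr (_%:C); apply/eqP; rewrite eq_le u1 u2.
Qed.

Lemma state_bounded : state phi -> bounded_linear phi.
Proof.
move=> [flin fpos fsup]; split=> //; exists (complex.Re (phi u)) => a.
exact: (pos_le hu flin fpos a).
Qed.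

Lemma unit_state : linear phi -> (forall a, 0 <= phi (adj a ** a)) ->
  phi u = 1 -> state phi.
Proof.
move=> flin fpos fu; split=> //; apply/eqP; rewrite eq_le; apply/andP; split.
  apply: ge_sup.
    by exists (complex.Re `|phi 0|), 0 => //=; rewrite normr0 ler01.
  move=> _ [a /= + <-]; rewrite -[1](@rmorph1 _ _ (real_complex R)) ler_nr => a1.
  by rewrite (le_trans (pos_le hu flin fpos a))// fu /= mul1r.
apply: ub_le_sup.
  exists 1 => _ [a /= + <-]; rewrite -[1](@rmorph1 _ _ (real_complex R)) ler_nr => a1.
  by rewrite (le_trans (pos_le hu flin fpos a))// fu /= mul1r.
exists u; first by rewrite /= -[1](@rmorph1 _ _ (real_complex R)) ler_nr nr_unit.
by rewrite fu normr1.
Qed.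

End States.

Section Homogeneous.
Variables (R : realType) (B : cstarAlgType R).
Variable gamma : R[i]^o -> B -> B.
Hypothesis gact : circle_action gamma.
Local Notation alpha := (dynamics gamma).

Let norm_cis (t : R) : `|cis t : R[i]^o| = 1.
Proof. by rewrite [LHS](nrE (cis t : R[i])) nr_cis. Qed.

Lemma dynamics_hom t : star_hom (alpha t).
Proof. by case: gact => h _ _ _; apply: h; exact: norm_cis. Qed.

Lemma dynamicsD t t' a : alpha (t + t') a = alpha t (alpha t' a).
Proof.
case: gact => _ _ h _; rewrite /dynamics.
by rewrite -[_ +i* _]/(cis (t + t')) cisD h ?norm_cis.
Qed.

Lemma dynamics0 a : alpha 0 a = a.
Proof.
by case: gact => _ h _ _; rewrite /dynamics -[_ +i* _]/(cis 0) cis0 h.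
Qed.

Definition homogeneous (k : R) (y : B) := forall t, alpha t y = cis (k * t) *: y.

Lemma homogeneousM k l y z :
  homogeneous k y -> homogeneous l z -> homogeneous (k + l) (y ** z).
Proof.
move=> hy hz t; have [_ hM _] := dynamics_hom t.
by rewrite hM hy hz amulZl amulZr scalerA -cisD mulrDl.
Qed.

Lemma homogeneous_adj k y : homogeneous k y -> homogeneous (- k) (adj y).
Proof.
move=> hy t; have [_ _ hadj] := dynamics_hom t.
by rewrite hadj hy adjsZ conj_cis mulNr.
Qed.

Lemma homogeneousP k y : (forall z, `|z| = 1 -> gamma z y = (z : R[i]) ^+ k *: y) ->
  homogeneous k%:R y.
Proof.
move=> h t; rewrite /dynamics h ?norm_cis//; congr (_ *: _).
rewrite -[_ +i* _]/(cis t); elim: k {h} => [|k IH].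
  by rewrite expr0 mul0r cis0.
by rewrite exprS IH -cisD -{1}[t]mul1r -mulrDl -natr1 addrC.
Qed.

Lemma homogeneous_entire k y : homogeneous k y ->
  entire_extension alpha y (fun z => expi k z *: y).
Proof.
move=> hy; split=> [z|t]; last by rewrite hy expi_real.
apply: diff_at_derivable (expi k z * (k *i) *: y) _.
apply: (@diff_at_comp _ _ _ (fun c : R[i]^o => (c : R[i]) *: y) (`|y| + 1)).
- by move=> c x x'; rewrite scalerDl -scalerA.
- by move=> x; rewrite normrZ mulrC ler_wpM2r// lerDl.
- by rewrite ltr_wpDl.
- exact: expi_diff.
Qed.

Lemma analytic_lin (c : R[i]) a b :
  analytic_elt alpha a -> analytic_elt alpha b ->
  analytic_elt alpha (c *: a + b).
Proof.
move=> [F [dF hF]] [G [dG hG]]; exists (fun z => c *: F z + G z).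
split=> [z|t]; last by have [hl _ _] := dynamics_hom t; rewrite hF hG hl.
by apply: derivableD => //; apply: derivableZ.
Qed.

Definition homogeneous_set := [set y | exists k, homogeneous k y].

Lemma homogeneous_star_subalgebra : star_subalgebra (lspan homogeneous_set).
Proof.
apply: lspan_star_subalgebra => [a b [k ka] [l lb]|a [k ka]].
  by exists (k + l); exact: homogeneousM.
by exists (- k); exact: homogeneous_adj.
Qed.

Lemma homogeneous0 y : (forall z, `|z| = 1 -> gamma z y = y) -> homogeneous 0 y.
Proof.
move=> h; have -> : (0 : R) = 0%:R by [].
by apply: homogeneousP => z z1; rewrite h// expr0 scale1r.
Qed.

Lemma homogeneous1 y :
  (forall z, `|z| = 1 -> gamma z y = (z : R[i]) *: y) -> homogeneous 1 y.
Proof.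
move=> h; have -> : (1 : R) = 1%:R by [].
by apply: homogeneousP => z z1; rewrite h// expr1.
Qed.

Lemma lspan_analytic a : lspan homogeneous_set a -> analytic_elt alpha a.
Proof.
elim=> [|k y b [l ly] _ IH].
  exists (fun=> 0); split=> [z|t]; first exact: derivable_cst.
  by have [hl _ _] := dynamics_hom t; rewrite (lin0 hl).
by apply: analytic_lin IH; exists (fun z => expi l z *: y); exact: homogeneous_entire.
Qed.

Section KMS.
Variables (u : B) (beta : R) (phi : B -> R[i]^o).
Hypothesis hu : is_unit u.
Hypothesis dense_hom : dense_seq (lspan homogeneous_set).

(** [alpha_{i beta}] multiplies [y] by [e^(-k beta)]. The KMS condition is stated for analytic [b]
    only, and density of the homogeneous span removes this restriction. *)
Lemma KMS_homogeneous k y b : KMS_state alpha beta phi -> homogeneous k y ->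
  phi (y ** b) = (expR (- k * beta))%:C * (phi (b ** y) : R[i]).
Proof.
move=> [fst fKMS] hy; have fb := state_bounded hu fst.
apply/eqP; rewrite -subr_eq0; apply/eqP; move: b.
apply: (@dense_eq0 R B R[i]^o _ (fun b => phi (y ** b) -
  (expR (- k * beta))%:C *: phi (b ** y)) dense_hom).
  apply: bounded_linearB; first exact: bounded_linear_mull.
  exact/bounded_linearZ/bounded_linear_mulr.
move=> b /lspan_analytic hb.
rewrite (fKMS _ _ _ hb (homogeneous_entire hy)) expi_imag amulZr (linZ fb.1).
exact: subrr.
Qed.

(* The KMS condition holds for every entire extension, and for [a = 0] these  *)
(* include all [g (z) u] with [g] entire and zero on the real axis.           *)
Lemma KMS_identity (g : R[i]^o -> R[i]^o) : KMS_state alpha beta phi ->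
  homogeneous 0 u -> (forall z, derivable g z 1) -> (forall t : R, g t%:C = 0) ->
  g (beta *i) = 0.
Proof.
move=> [fst fKMS] h0 dg g0; have [flin _ _] := fst.
have au : analytic_elt alpha u.
  by exists (fun z => expi 0 z *: u); exact: homogeneous_entire.
have e0 : entire_extension alpha 0 (fun z => (g z : R[i]) *: u).
  split=> [z|t]; last first.
    by have [hl _ _] := dynamics_hom t; rewrite g0 scale0r (lin0 hl).
  have [l gl] := derivable_diff_at (dg z).
  apply: diff_at_derivable ((l : R[i]) *: u) _.
  apply: (@diff_at_comp _ _ _ (fun c : R[i]^o => (c : R[i]) *: u) (`|u| + 1) g) => //.
  - by move=> c x x'; rewrite scalerDl -scalerA.
  - by move=> x; rewrite normrZ mulrC ler_wpM2r// lerDl.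
  - by rewrite ltr_wpDl.
(* For [a = 0] and [b = u] the relation reads [0 = phi (g (i beta) u) = g (i beta)]. *)
have := fKMS _ _ _ au e0.
rewrite amul0l (lin0 flin) (unit_mull _ hu) (linZ flin) (state_unit hu fst).
by rewrite -[_ *: _]/((g (beta *i) : R[i]) * 1) mulr1 => <-.
Qed.

End KMS.

(* For [y] of degree [k], the entire function [z |-> phi (y F(z))] agrees     *)
(* with [expi (- k) z * phi (y a)] on the real axis.                          *)
Lemma KMS_of_homogeneous (G : set B) (beta : R) (phi : B -> R[i]^o) :
  (forall g : R[i]^o -> R[i]^o, (forall z, derivable g z 1) ->
    (forall t : R, g t%:C = 0) -> g (beta *i) = 0) ->
  dense_seq (lspan G) -> bounded_linear phi ->
  (forall t a, phi (alpha t a) = phi a) ->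
  (forall y, G y -> exists k, homogeneous k y /\
    forall a, phi (y ** a) = (expR (- k * beta))%:C * (phi (a ** y) : R[i])) ->
  forall a b F, entire_extension alpha a F ->
    phi (a ** b) = phi (b ** F (beta *i)).
Proof.
move=> ident dG fb finv hG a b F [dF hF].
apply/eqP; rewrite -subr_eq0; apply/eqP; move: b.
apply: (@dense_lspan_eq0 R B R[i]^o _ (fun b => phi (a ** b) -
  phi (b ** F (beta *i))) dG).
  by apply: bounded_linearB; [exact: bounded_linear_mull|exact: bounded_linear_mulr].
move=> y /hG[k [ky yk]].
pose g (z : R[i]^o) : R[i]^o := phi (y ** F z) - (phi (y ** a) : R[i]) *: (expi (- k) z : R[i]^o).
have : g (beta *i) = 0.
  apply: ident => [z|t].
    have [l Fl] := derivable_diff_at (dF z).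
    have [C fC] := fb.2.
    apply: diff_at_derivable; apply: diff_atB.
      have yb := bounded_linear_mull y fb.
      have [D hD] := yb.2.
      apply: (@diff_at_comp _ _ _ (fun b => phi (y ** b)) (`|D| + 1)%:C F _ _ yb.1 _ _ Fl).
        move=> x; rewrite (nrE x) -rmorphM ler_nr (le_trans (hD x))//.
        by rewrite ler_wpM2r ?nr_ge0// ler_wpDr// ler_norm.
      by rewrite ltcR ltr_wpDl.
    apply: (@diff_at_comp _ _ _ (fun c : R[i]^o => (phi (y ** a) : R[i]) *: c)
      (`|phi (y ** a)| + 1) (expi (- k))).
    - by move=> c x x'; rewrite scalerDr !scalerA mulrC.
    - by move=> x; rewrite normrZ ler_wpM2r// lerDl.
    - by rewrite ltr_wpDl.
    - exact: expi_diff.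
  rewrite /g hF expi_real.
  have -> : phi (y ** alpha t a) = cis (- k * t) *: phi (y ** a).
    rewrite -(finv (- t)); have [_ hM _] := dynamics_hom (- t).
    by rewrite hM ky -dynamicsD addNr dynamics0 amulZl (linZ fb.1) mulrN mulNr.
  by rewrite -[X in X - _]/(_ * _ : R[i]) mulrC; exact: subrr.
(* So [phi (y F(i beta)) = e^(k beta) phi (y a)], and the factor cancels against the one in the
   relation for [y]. *)
rewrite /g expi_imag opprK => /subr0_eq ->.
apply/eqP; rewrite subr_eq0; apply/eqP.
rewrite yk -[RHS]/(_ * _ : R[i]) mulrAC -rmorphM -expRD mulNr addNr expR0.
by rewrite mul1r.
Qed.

End Homogeneous.

(** * Counting backward paths *)

Section Counting.
Variable E : digraph.
Implicit Types (e : edge E) (v : vertex E) (z w : inf_path E).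

(** The number of paths of length [n] with source [v]. By [preim_cardE] it is the size of the fibre
    of [sigma^n] over any infinite path with range [v]. *)
Fixpoint path_count n v : nat :=
  if n is m.+1 then \sum_(e | src e == v) path_count m (rng e) else 1.

Lemma path_count_le n v : (path_count n v <= #|edge E| ^ n)%N.
Proof.
elim: n v => [//|n IH] v; rewrite expnS /=.
apply: (@leq_trans (\sum_(e | src e == v) #|edge E| ^ n)); first exact: leq_sum.
by rewrite sum_nat_const leq_mul2r max_card orbT.
Qed.

Fixpoint preimages n z : seq (inf_path E) :=
  if n is m.+1 then
    flatten (map (fun e => preimages m (pcons e z))
      (seq.filter (fun e => src e == irng z) (index_enum (edge E))))
  else [:: z].

Lemma irng_pcons e z : src e = irng z -> irng (pcons e z) = rng e.
Proof. by move=> ez; rewrite /irng /= /pcons_fun ez eqxx. Qed.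

Lemma pcons_head e z : src e = irng z -> pcons e z 0%N = e.
Proof. by move=> ez; rewrite /= /pcons_fun ez eqxx. Qed.

Lemma size_preimages n z : size (preimages n z) = path_count n (irng z).
Proof.
elim: n z => [//|n IH] z /=.
rewrite size_flatten /shape -map_comp sumnE big_map big_filter.
by apply: eq_bigr => e /eqP ez; rewrite /= IH irng_pcons.
Qed.

Lemma mem_preimages n z w :
  (w \in preimages n z) = (iter n (@shift_path E) w == z).
Proof.
elim: n z => [|n IH] z /=; first by rewrite inE.
apply/flatten_mapP/eqP => [[e]|wz].
  by rewrite mem_filter mem_index_enum andbT IH => /eqP ez /eqP ->; rewrite shift_pcons.
set w' := iter n _ w in wz; exists (w' 0%N); last by rewrite IH -wz pcons_shift.
rewrite mem_filter mem_index_enum andbT -wz; apply/eqP; exact: ipathP.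
Qed.

Lemma uniq_preimages n z : uniq (preimages n z).
Proof.
elim: n z => [//|n IH] z /=.
set r := seq.filter _ _; have : all (fun e => src e == irng z) r by exact: filter_all.
have : uniq r by rewrite filter_uniq ?index_enum_uniq.
elim: r => //= e l IHl.
move=> /andP[el ul] /andP[/eqP ez al]; rewrite cat_uniq IH IHl// andbT /=.
apply/hasPn => w /flatten_mapP[f fl]; rewrite !mem_preimages => /eqP ->.
apply: contra el => /eqP /(congr1 (fun w : inf_path E => w 0%N)).
by rewrite !pcons_head// => [<-//|]; apply/eqP; exact: (allP al).
Qed.

Lemma preim_cardE n z : preim_card n z = path_count n (irng z).
Proof.
have wE : [set w | iter n (@shift_path E) w = z] = [set` preimages n z].
  by apply/seteqP; split => w /=; rewrite mem_preimages => /eqP.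
have fin := finite_seq (preimages n z).
rewrite /preim_card wE -size_preimages; apply/eqP; rewrite eqn_leq.
apply/andP; split; apply: uniq_leq_size.
- exact: fset_uniq.
- by move=> w; rewrite (in_fset_set fin) => /set_mem.
- exact: uniq_preimages.
- by move=> w wz; rewrite (in_fset_set fin); exact: mem_set.
Qed.

Section MaxPreimCard.
Variable R : realType.

Let values n : set R := [set (preim_card n z)%:R | z in [set: inf_path E]].

Let valuesP n x : values n x -> 0 <= x <= (#|edge E| ^ n)%:R.
Proof. by move=> [z _ <-]; rewrite ler0n ler_nat preim_cardE path_count_le. Qed.

Lemma path_count_le_max n z :
  (path_count n (irng z))%:R <= max_preim_card R E n.
Proof.
apply: ub_le_sup; last by exists z => //; rewrite preim_cardE.
by exists (#|edge E| ^ n)%:R => x /valuesP /andP[].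
Qed.

Lemma max_preim_card_ge0 n : 0 <= max_preim_card R E n.
Proof.
have [[z _]|/forallNP h] := pselect (exists z : inf_path E, True).
  exact: le_trans (ler0n _ _) (path_count_le_max n z).
rewrite /max_preim_card (_ : [set _ | _ in _] = set0) ?sup0//.
by apply/seteqP; split => // x [z _ _]; case: (h z).
Qed.

Lemma max_preim_card_le n : max_preim_card R E n <= (#|edge E| ^ n)%:R.
Proof.
have [[z _]|/forallNP h] := pselect (exists z : inf_path E, True).
  apply: ge_sup; first by exists (preim_card n z)%:R, z.
  by move=> x /valuesP /andP[].
rewrite /max_preim_card (_ : [set _ | _ in _] = set0) ?sup0//.
by apply/seteqP; split => // x [z _ _]; case: (h z).
Qed.

(** A positive supremum exceeds 0 at some fibre cardinality, which is a natural number. So the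
    logarithms in [beta_c] are nonnegative, the value at 0 being 0 by convention. *)
Lemma max_preim_card_ge1 n : 0 < max_preim_card R E n -> 1 <= max_preim_card R E n.
Proof.
move=> h; have [x [z _ <-]] : exists2 x, values n x & 0 < x.
  have [[z _]|/forallNP hz] := pselect (exists z : inf_path E, True).
    by apply: sup_gt h; exists (preim_card n z)%:R, z.
  move: h; rewrite /max_preim_card (_ : [set _ | _ in _] = set0) ?sup0 ?ltxx//.
  by apply/seteqP; split => // x [z _ _]; case: (hz z).
rewrite ltr0n => zn; rewrite (le_trans _ (path_count_le_max n z))// -preim_cardE.
by rewrite ler1n.
Qed.

Let u (n : nat) : R := n%:R^-1 * ln (max_preim_card R E n).

Let u_ge0 n : 0 <= u n.
Proof.
rewrite mulr_ge0 ?invr_ge0//; have := max_preim_card_ge0 n.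
rewrite le_eqVlt => /orP[/eqP <-|/max_preim_card_ge1/ln_ge0//].
by rewrite ln0.
Qed.

Let u_le n : u n <= #|edge E|%:R.
Proof.
rewrite /u; case: n => [|n]; first by rewrite invr0 mul0r.
rewrite ler_pdivrMl//; have := max_preim_card_ge0 n.+1.
rewrite le_eqVlt => /orP[/eqP <-|M0]; first by rewrite ln0// mulr_ge0.
have h := le_trans (max_preim_card_ge1 M0) (max_preim_card_le n.+1).
have E0 : (0 : R) < #|edge E|%:R.
  move: h; rewrite natrX ltNge; apply: contraTN => E0.
  have -> : #|edge E|%:R = 0 :> R by apply/eqP; rewrite eq_le E0 ler0n.
  by rewrite expr0n /= -ltNge ltr01.
rewrite (@le_trans _ _ (ln (#|edge E| ^ n.+1)%:R))//.
  rewrite ler_ln ?posrE//; first exact: max_preim_card_le.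
  by rewrite natrX exprn_gt0.
rewrite natrX lnXn// -[ln _ *+ _]mulr_natl ler_wpM2l//.
by rewrite (le_trans _ (ltW (ln_sublinear E0))).
Qed.

(** The limsup is the infimum of the tail suprema, so some tail of [n^-1 ln M_n] is bounded by a
    [c < beta], and there [e^(-beta n) M_n] is at most [e^(-(beta - c) n)]. *)
Lemma max_preim_card_decay (beta : R) : beta_c R E < beta ->
  forall e : R, 0 < e -> exists N, forall n, (N <= n)%N ->
    expR (- beta * n%:R) * max_preim_card R E n < e.
Proof.
have bu : bounded_fun (u : nat -> R^o).
  exists #|edge E|%:R; split; first exact: num_real.
  move=> M EM n _ /=; rewrite ger0_norm//; exact: le_trans (u_le n) (ltW EM).
rewrite /beta_c (limn_supE bu) => /inf_lt[|_ [N _ <-] Nb e e0].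
  by exists (sups (u : nat -> R^o) 0%N), 0%N.
set c := sups _ N in Nb.
have uc n : (N <= n)%N -> u n <= c.
  move=> Nn; apply: ub_le_sup; last by exists n.
  by exists #|edge E|%:R => _ [m _ <-].
have bc0 : 0 < (beta - c) * e by rewrite mulr_gt0// subr_gt0.
(* [N.+1] makes [n] positive; the other bound gives [e^-1 < (beta - c) n], which the exponential of
   [(beta - c) n] exceeds. *)
exists (maxn N.+1 (Num.bound ((beta - c) * e)^-1)) => n.
rewrite geq_max => /andP[Nn bn].
have n0 : (0 : R) < n%:R by rewrite ltr0n (leq_trans _ Nn).
have Mle : max_preim_card R E n <= expR (c * n%:R).
  have := max_preim_card_ge0 n; rewrite le_eqVlt => /orP[/eqP <-|M0].
    exact: expR_ge0.
  rewrite -(lnK M0) ler_expR -ler_pdivrMr// mulrC.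
  exact: uc (ltnW Nn).
rewrite (le_lt_trans (ler_wpM2l (expR_ge0 _) Mle))// -expRD -mulrDl.
rewrite -[_ + c]opprK opprD opprK mulNr expRN invf_plt ?posrE ?expR_gt0//.
have be1 : 0 <= ((beta - c) * e)^-1 by rewrite invr_ge0 ltW.
have /archi_boundP h := be1.
have h2 : ((beta - c) * e)^-1 < n%:R by rewrite (lt_le_trans h)// ler_nat.
rewrite (lt_le_trans _ (expR_ge1Dx _))//.
rewrite (lt_trans (_ : e^-1 < (beta - c) * n%:R))//; last by rewrite ltrDr.
by rewrite -ltr_pdivrMl ?subr_gt0// -invfM.
Qed.

End MaxPreimCard.

End Counting.

(** * The bimodule of the path space *)

Lemma one_continuous (R : realType) (X : topologicalType) :
  continuous (fun _ : X => 1 : R[i]^o).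
Proof. by move=> z; exact: cvg_cst. Qed.

Section PathFunctions.
Variables (R : realType) (E : digraph).
Local Notation CE := (contfun R (inf_path E)).
Implicit Types (x a b : CE) (e f : edge E) (v : vertex E) (z : inf_path E).

Definition contfun1 : CE := mkcts (@one_continuous R (inf_path E)).

Lemma pullback_continuous e a : continuous (fun z => a (pcons e z)).
Proof.
move=> z; apply: (@continuous_comp _ _ _ (pcons e) a).
  exact: pcons_continuous.
exact: cts_fun.
Qed.

(** The junk values of [pcons] at paths that [e] cannot precede are harmless: after [chi_edge e],
    only paths starting with [e] count. *)
Definition pullback e a : CE := mkcts (@pullback_continuous e a).

Lemma chi_vertexE v z : chi_vertex R v z = (irng z == v)%:R.
Proof.
rewrite -[LHS]/((z \in vcylinder v)%:R : R[i]).
case: eqP => zv; first by rewrite mem_set.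
by rewrite memNset.
Qed.

Lemma chi_edgeE e z : chi_edge R e z = (z 0%N == e)%:R.
Proof.
rewrite -[LHS]/((z \in cylinder [:: e])%:R : R[i]); case: eqP => ze.
  by rewrite mem_set// /cylinder /= /mkseq /= ze.
by rewrite memNset// /cylinder /= /mkseq /= => -[].
Qed.

Lemma bactE a x b z : bact a x b z = (a z : R[i]) * x z * b (shift_path z).
Proof. by []. Qed.

Lemma pullbackE e a z : pullback e a z = a (pcons e z).
Proof. by []. Qed.

Lemma contfun1E z : contfun1 z = 1.
Proof. by []. Qed.

Lemma contfun_sum (I : Type) (r : seq I) (P : pred I) (F : I -> CE) z :
  (\sum_(i <- r | P i) F i) z = \sum_(i <- r | P i) (F i z : R[i]).
Proof. exact: (big_morph (fun x : CE => x z : R[i]) (fun _ _ => erefl) erefl). Qed.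

Lemma binner_chi_edge e f : binner (chi_edge R f) (chi_edge R e) =
  if e == f then chi_vertex R (src e) else 0.
Proof.
apply: contfunP => z; rewrite [LHS]fsbig_shiftE.
transitivity ((\sum_(g | src g == irng z) ((g == f) && (g == e))%:R) : R[i]).
  apply: eq_bigr => g /eqP gz.
  by rewrite !chi_edgeE pcons_head// conjC_nat -natrM mulnb.
have [->|ef] := eqVneq e f; last first.
  rewrite big1// => g _; case: eqP => // ->.
  by rewrite eq_sym (negbTE ef).
rewrite chi_vertexE eq_sym; have [fz|fz] := eqVneq (src f) (irng z).
  rewrite (bigD1 f) ?fz//= eqxx big1 ?addr0//.
  by move=> g /andP[_ /negbTE ->].
rewrite big1// => g gz; case: eqP => // gf.
by rewrite -gf gz in fz.
Qed.

Lemma chi_edge_shift a e : bact a (chi_edge R e) contfun1 =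
  bact contfun1 (chi_edge R e) (pullback e a).
Proof.
apply: contfunP => z; rewrite !bactE !chi_edgeE pullbackE !contfun1E mul1r mulr1.
have [ze|_] := eqVneq (z 0%N) e; last by rewrite mulr0 mul0r.
by rewrite -ze pcons_shift mulr1 mul1r.
Qed.

(** The cylinders Z(e) partition E^oo and [sigma] is injective on each, so the [chi_edge e] generate
    X(E^oo) as a right module. *)
Lemma chi_edge_expand x :
  x = \sum_e bact contfun1 (chi_edge R e) (pullback e x).
Proof.
apply: contfunP => z; rewrite contfun_sum (bigD1 (z 0%N))//= big1 ?addr0.
  by rewrite bactE chi_edgeE pullbackE contfun1E eqxx !mul1r pcons_shift.
by move=> e /negbTE ez; rewrite bactE chi_edgeE eq_sym ez mulr0 mul0r.
Qed.

Lemma chi_edge_src e :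
  bact contfun1 (chi_edge R e) (chi_vertex R (src e)) = chi_edge R e.
Proof.
apply: contfunP => z; rewrite bactE chi_vertexE chi_edgeE contfun1E mul1r.
have [ze|_] := eqVneq (z 0%N) e; last by rewrite mul0r.
by rewrite mul1r /irng /= -ipathP ze eqxx.
Qed.

Lemma chi_edge_rng v e : bact (chi_vertex R v) (chi_edge R e) contfun1 =
  if v == rng e then chi_edge R e else 0.
Proof.
apply: contfunP => z; rewrite bactE chi_vertexE chi_edgeE contfun1E mulr1.
have [ze|ze] := eqVneq (z 0%N) e; last first.
  by rewrite mulr0; case: eqP => // _; rewrite chi_edgeE (negbTE ze).
rewrite mulr1 /irng ze eq_sym; case: eqP => // _.
by rewrite chi_edgeE ze eqxx.
Qed.

Lemma chi_vertex_sum : \sum_v chi_vertex R v = contfun1.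
Proof.
apply: contfunP => z; rewrite contfun_sum (bigD1 (irng z))//= big1 ?addr0.
  by rewrite chi_vertexE eqxx.
by move=> v /negbTE vz; rewrite chi_vertexE eq_sym vz.
Qed.

Lemma bact1 x : bact contfun1 x contfun1 = x.
Proof. by apply: contfunP => z; rewrite bactE contfun1E mul1r mulr1. Qed.

End PathFunctions.

Section BimoduleSystem.
Variables (R : realType) (E : digraph) (B : cstarAlgType R).
Local Notation CE := (contfun R (inf_path E)).
Variables psi pi : CE -> B.
Hypothesis rep : bimodule_rep psi pi.
Hypothesis gen : cstar_generates (range psi `|` range pi).
Implicit Types (x a b : CE) (e f : edge E) (v : vertex E).

Local Notation s := (fun e => psi (chi_edge R e)).
Local Notation P := (fun v => pi (chi_vertex R v)).
Local Notation u := (pi (contfun1 R E)).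

Let psi_lin : linear psi. Proof. by case: rep. Qed.
Let pi_hom : star_hom pi. Proof. by case: rep. Qed.
Let pi_lin : linear pi. Proof. by case: pi_hom. Qed.
Let piM a b : pi (cmul a b) = pi a ** pi b.
Proof. by case: pi_hom => _ h _; exact: h. Qed.
Let pi_adj a : pi (cconj a) = adj (pi a).
Proof. by case: pi_hom => _ _ h; exact: h. Qed.
Let psiM a x b : psi (bact a x b) = pi a ** psi x ** pi b.
Proof. by case: rep. Qed.

Let adj_u : adj u = u.
Proof.
by rewrite -pi_adj; congr (pi _); apply: contfunP => z; exact: rmorph1.
Qed.

Let cmulC a b : cmul a b = cmul b a.
Proof. by apply: contfunP => z; exact: mulrC. Qed.

Let cmul1 a : cmul (contfun1 R E) a = a.
Proof. by apply: contfunP => z; exact: mul1r. Qed.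

(** The elements fixed by [u] on both sides form a star subalgebra; it contains [psi x] because
    [x = 1 . x . 1], hence is dense. *)
Lemma bimodule_unit : is_unit u.
Proof.
pose S : set B := [set b | u ** b = b /\ b ** u = b].
have uu : u ** u = u by rewrite -piM cmul1.
have dS : dense_seq S.
  apply: (generates_dense gen).
    split=> [|k a b [a1 a2] [b1 b2]|a b [a1 a2] [b1 b2]|a [a1 a2]].
    - by rewrite /S /= amul0l amul0r.
    - by rewrite /S /= amulDr amulDl amulZl amulZr a1 a2 b1 b2.
    - by rewrite /S /= amulA a1 -amulA b2.
    - by split; rewrite -{1}adj_u -adjM ?a1 ?a2.
  move=> _ [[x _ <-]|[a _ <-]].
    have xE := psiM (contfun1 R E) x (contfun1 R E); rewrite bact1 in xE.
    by rewrite /S /= {1 3}xE !amulA uu -(amulA _ u u) uu -xE.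
  by rewrite /S /= -!piM (cmulC a) cmul1.
move=> b; suff [h1 h2] : u ** b - b = 0 /\ b ** u - b = 0.
  by split; apply/eqP; rewrite -subr_eq0; apply/eqP.
have idB : bounded_linear (fun b : B => b).
  by split=> [//|]; exists 1 => a; rewrite mul1r.
split; move: b; apply: (dense_eq0 dS) => [|c [c1 c2]].
- by apply: bounded_linearB => //; exact: (bounded_linear_mull u idB).
- by rewrite c1 subrr.
- by apply: bounded_linearB => //; exact: (bounded_linear_mulr u idB).
- by rewrite c2 subrr.
Qed.

Let unitl (c : B) : u ** c = c. Proof. exact: unit_mull bimodule_unit. Qed.
Let unitr (c : B) : c ** u = c. Proof. exact: unit_mulr bimodule_unit. Qed.

Lemma bimodule_src e f : adj (s f) ** s e = if e == f then P (src e) else 0.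
Proof.
case: rep => _ _ _ <-; rewrite binner_chi_edge.
by case: eqP => // _; exact: lin0.
Qed.

Lemma bimodule_shift a e : pi a ** s e = s e ** pi (pullback e a).
Proof.
have := congr1 psi (chi_edge_shift a e).
by rewrite !psiM unitr unitl.
Qed.

Lemma bimodule_expand x : psi x = \sum_e s e ** pi (pullback e x).
Proof.
rewrite [in LHS](chi_edge_expand x) (lin_sum psi_lin); apply: eq_bigr => e _.
by rewrite psiM unitl.
Qed.

Lemma bimodule_s_src e : s e ** P (src e) = s e.
Proof. by have := congr1 psi (chi_edge_src R e); rewrite psiM unitl. Qed.

Lemma bimodule_rng v e : P v ** s e = if v == rng e then s e else 0.
Proof.
have := congr1 psi (chi_edge_rng R v e); rewrite psiM unitr => ->.
by case: eqP => // _; exact: lin0.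
Qed.

Lemma bimodule_vertex_sum : \sum_v P v = u.
Proof. by rewrite -(lin_sum pi_lin) chi_vertex_sum. Qed.

Lemma bimodule_system : toeplitz_system u s (range pi).
Proof.
split.
- exact: bimodule_unit.
- by exists (contfun1 R E).
- move=> k _ _ [a _ <-] [b _ <-]; exists (k *: a + b) => //; exact: pi_lin.
- move=> _ _ [a _ <-] [b _ <-]; exists (cmul a b) => //; exact: piM.
- move=> _ [a _ <-]; exists (cconj a) => //; exact: pi_adj.
- by move=> _ _ [a _ <-] [b _ <-]; rewrite -!piM cmulC.
- move=> _ e [a _ <-]; exists (pi (pullback e a)); split; first by exists (pullback e a).
  exact: bimodule_shift.
- by move=> e f ef; rewrite bimodule_src eq_sym (negbTE ef).
- by move=> e; rewrite bimodule_src eqxx; exists (chi_vertex R (src e)).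
- by move=> e; rewrite bimodule_src eqxx bimodule_s_src.
Qed.

Lemma bimodule_stab_dense : dense_seq (vac_stab u s (range pi)).
Proof.
apply: (generates_dense gen); first exact: vac_stab_star_subalgebra.
have [S0 SD SM _] := vac_stab_star_subalgebra u s (range pi).
move=> _ [[x _ <-]|[a _ <-]]; last first.
  by apply: (vac_stab_coef bimodule_system); exists a.
rewrite bimodule_expand; elim/big_ind: _ => [//|b c Sb Sc|e _].
  by have := SD 1 b c Sb Sc; rewrite scale1r.
apply: SM; first exact: (vac_stab_s bimodule_system).
by apply: (vac_stab_coef bimodule_system); exists (pullback e x).
Qed.

End BimoduleSystem.

(** * Functionals on a corner *)

Section CornerFunctional.
Variables (R : realType) (B : cstarAlgType R) (u : B).
Hypothesis hu : is_unit u.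

(** At [x + i t e] the C*-identity bounds the squared norm by [|x| ^ 2 + t ^ 2], while [f] has
    imaginary part [q + t]. So [2 q t <= |x| ^ 2] for every real [t], which forces [q = 0]. *)
Lemma corner_real (e x : B) (f : B -> R[i]^o) :
  linear f -> (forall a, nr (f a : R[i]) <= nr a) -> f e = 1 ->
  adj e = e -> e ** e = e -> adj x = x -> e ** x = x -> x ** e = x ->
  complex.Im (f x) = 0.
Proof.
move=> flin fle fe se ee sx ex xe; set q := complex.Im (f x).
have key (t : R) : q * t * 2 <= nr x ^+ 2.
  pose y := x + (t *i) *: e.
  have sy : adj y = x - (t *i) *: e.
    rewrite adjD adjsZ sx se -scaleNr; congr (_ + _ *: _).
    by apply/eqP; rewrite eq_complex /= oppr0 !eqxx.
  have yy : adj y ** y = x ** x + (t ^+ 2)%:C *: e.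
    rewrite sy amulBl !amulDr !amulZl !amulZr xe ex ee scalerA.
    rewrite opprD addrA addrK.
    have -> : (t *i) * (t *i) = - (t ^+ 2)%:C.
      apply/eqP; rewrite eq_complex /=; apply/andP; split; apply/eqP; ring.
    by rewrite scaleNr opprK.
  have fy : f y = complex.Re (f x) +i* (q + t).
    rewrite (linD flin) (linZ flin) fe /q -[_ *: _]/((t *i) * 1 : R[i]) mulr1.
    by case: (f x) => a b /=; apply/eqP; rewrite eq_complex /= addr0 !eqxx.
  have h1 : nr (f y : R[i]) ^+ 2 <= nr x ^+ 2 + t ^+ 2.
    rewrite (@le_trans _ _ (nr y ^+ 2))//.
      by rewrite ler_pXn2r ?nnegrE ?nr_ge0.
    rewrite -nr_adjM yy (le_trans (nrD _ _))// nr_sa_sqr// lerD2l nrZ nrC.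
    by rewrite ger0_norm ?sqr_ge0// ler_piMr ?sqr_ge0// nr_proj.
  rewrite fy nr_sqr /= in h1.
  have := sqr_ge0 (complex.Re (f x)); have := sqr_ge0 q; nra.
apply/eqP/negPn/negP => q0.
have := key ((nr x ^+ 2 + 1) / (q * 2)).
rewrite (_ : q * _ * 2 = nr x ^+ 2 + 1); first by rewrite gerDl ler10.
by field.
Qed.

(* A norm-one functional that is [1] at the projection [e] is positive on the *)
(* squares of selfadjoint elements of the corner [e B e].                     *)
Lemma corner_functional (e : B) (c : R) : adj e = e -> e ** e = e ->
  0 <= c -> (e = 0 -> c = 0) -> exists g : B -> R[i]^o,
  [/\ bounded_linear g, g e = c%:C & forall h, adj h = h -> e ** h = h ->
    h ** e = h -> 0 <= g (h ** h)].
Proof.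
move=> se ee c0 ec; have [->|cn0] := eqVneq c 0.
  (* The projection [e] may vanish in this case, and then nothing norms it. *)
  exists (fun=> 0); split => //; split; last by exists 0 => a; rewrite nr0 mul0r.
  by move=> k a b; rewrite scaler0 addr0.
have en1 := nr_proj se ee.
have en0 : e != 0 by apply: contra_neq cn0.
have [f [flin fle fe]] := norming_functional (nr_proj_neq0 se ee en0).
have fb : bounded_linear f by split=> //; exists 1 => a; rewrite mul1r.
have fpos h : adj h = h -> e ** h = h -> h ** e = h -> nr h < 1 -> 0 <= f (h ** h).
  move=> sh eh he h1; have shh : adj (h ** h) = h ** h by rewrite adjM sh.
  have := corner_real flin fle fe se ee shh; rewrite amulA eh -amulA he.
  move=> /(_ erefl erefl) im0.
  have : nr (f (e - h ** h) : R[i]) <= 1.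
    rewrite (le_trans (fle _))//.
    (* Compression by [e] reduces the bound to [nr_unit_subsqr]; then [1 - f (h ** h)] has real part
       at most 1. *)
    have -> : e - h ** h = e ** (u - h ** h) ** e.
      by rewrite amulBr amulBl (unit_mulr _ hu) ee -!amulA he amulA eh.
    rewrite (le_trans (nrM _ _))// -[leRHS]mulr1 ler_pM ?nr_ge0//.
    rewrite (le_trans (nrM _ _))// -[leRHS]mulr1 ler_pM ?nr_ge0//.
    exact: nr_unit_subsqr.
  move=> /(le_trans (ler_Re_nr _)); rewrite (linB flin) fe.
  case: (f (h ** h)) im0 => a b /= ->; rewrite lecE /= eqxx /=.
  by rewrite ler_norml => /andP[_]; rewrite gerBl.
exists (fun a => c%:C *: f a); split=> [||h sh eh he].
- exact: bounded_linearZ.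
- by rewrite fe -[LHS]/(c%:C * 1 : R[i]) mulr1.
- pose t := nr h + 1; have t0 : 0 < t by rewrite ltr_wpDl ?nr_ge0.
  pose h' := (t^-1)%:C *: h.
  have := fpos h'; rewrite /h' adjsZ conj_real sh !amulZr !amulZl eh he nrZ nrC.
  rewrite ger0_norm ?invr_ge0; last exact: ltW.
  move=> /(_ erefl erefl erefl).
  rewrite mulrC ltr_pdivrMr// mul1r /t ltrDl => /(_ ltr01).
  rewrite scalerA (linZ flin) -rmorphM /= => h1.
  have : 0 <= (c * t ^+ 2)%:C * ((t^-1 * t^-1)%:C * (f (h ** h) : R[i])).
    by rewrite mulr_ge0// lecR mulr_ge0// sqr_ge0.
  rewrite mulrA -rmorphM.
  by rewrite (_ : c * t ^+ 2 * (t^-1 * t^-1) = c)//; field; rewrite gt_eqF.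
Qed.

End CornerFunctional.

Lemma csum_cvg (R : realType) (c : nat -> R[i]) (a : nat -> R) (M : R) :
  (forall n, nr (c n) <= a n) -> (forall N, \sum_(n < N) a n <= M) ->
  exists l, ccvg (fun N => \sum_(n < N) c n) l.
Proof.
move=> ca aM; have a0 n : 0 <= a n by rewrite (le_trans (nr_ge0 _) (ca n)).
have cva : cvgn (series a).
  apply: nondecreasing_is_cvgn.
    apply/nondecreasing_seqP => n.
    by rewrite !seriesEord /= big_ord_recr /= lerDl.
  by exists M => _ [n _ <-]; rewrite seriesEord; exact: aM.
have cvx (x : nat -> R) : (forall n, `|x n| <= a n) -> exists l : R,
    forall e, 0 < e -> exists N, forall n, (N <= n)%N ->
      `|\sum_(i < n) x i - l| < e.
  move=> xa; have /normed_cvg /cvg_ex[/= l xl] : cvgn [normed series x].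
    by apply: series_le_cvg cva => n //=.
  exists l => e e0; have /cvgrPdist_lt/(_ _ e0)[N _ hN] := xl.
  by exists N => n /hN; rewrite seriesEord distrC.
have [lr hr] := cvx (fun n => complex.Re (c n))
  (fun n => le_trans (ler_Re_nr _) (ca n)).
have [li hi] := cvx (fun n => complex.Im (c n))
  (fun n => le_trans (ler_Im_nr _) (ca n)).
exists (lr +i* li) => e e0; have e20 : 0 < e / 2 by rewrite divr_gt0.
have [N hN] := hr _ e20; have [N' hN'] := hi _ e20.
exists (maxn N N') => n; rewrite geq_max => /andP[/hN h1 /hN' h2].
rewrite (le_lt_trans (nr_le_ReIm _))// (splitr e).
have -> : \sum_(i < n) c i = (\sum_(i < n) complex.Re (c i)) +i*
    (\sum_(i < n) complex.Im (c i)).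
  elim: (n) => [|m IH]; first by rewrite !big_ord0.
  by rewrite !big_ord_recr /= IH; case: (c m).
by rewrite ltrD.
Qed.

(** * The transfer operator and functionals on the vacuum corner *)

Section Transfer.
Variables (R : realType) (B : cstarAlgType R) (I : finType) (s : I -> B).
Implicit Types (a b c : B).

Definition transfer b := \sum_e adj (s e) ** b ** s e.

Lemma transfer_linear : linear transfer.
Proof.
move=> k a b; rewrite /transfer scaler_sumr -big_split/=; apply: eq_bigr => e _.
by rewrite amulDr amulDl amulZr amulZl.
Qed.

Lemma iter_transfer_linear n : linear (iter n transfer).
Proof.
by elim: n => [//|n IH] k a b; rewrite /= IH transfer_linear.
Qed.

Lemma iter_transfer_pos (f : B -> R[i]^o) n : linear f ->
  (forall a, 0 <= f (adj a ** a)) ->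
  forall a, 0 <= f (iter n transfer (adj a ** a)).
Proof.
move=> flin fpos; elim: n => [//|n IH] a; rewrite iterSr /transfer.
rewrite (lin_sum (iter_transfer_linear n)) (lin_sum flin).
apply: sumr_ge0 => e _; have := IH (a ** s e).
by rewrite adjM !amulA.
Qed.

End Transfer.

Lemma bounded_linear_sum (R : realType) (B : cstarAlgType R)
    (V : normedModType R[i]) (J : finType) (F : J -> B -> V) :
  (forall j, bounded_linear (F j)) -> bounded_linear (fun b => \sum_j F j b).
Proof.
move=> hF; split=> [k a b|].
  by rewrite scaler_sumr -big_split/=; apply: eq_bigr => j _; rewrite (hF j).1.
exists (\sum_j sval (cid (hF j).2)) => a.
rewrite (le_trans (nr_sum _ _ _))// mulr_suml ler_sum// => j _.
by case: cid => C /=; exact.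
Qed.

Section Fock.
Variables (R : realType) (B : cstarAlgType R) (u : B) (I : finType) (s : I -> B).
Variable D : set B.
Hypothesis ts : toeplitz_system u s D.
Implicit Types (a b c : B) (e : I).

Local Notation Q := (vac u s).
Local Notation L := (transfer s).
Let hu := ts_unit ts.

(** Each [e v = Q ** P v] gets its own functional from [corner_functional], and [w] sums them over
    compressions by the [e v], which commute with [D]. Compression makes [w] see only the corner of
    [Q], and orthogonality of the [P v] decouples the prescribed values. *)
Lemma vacuum_functional (J : finType) (P : J -> B) (eps : J -> R) :
  (forall v, D (P v)) -> (forall v, adj (P v) = P v) ->
  (forall v w, P v ** P w = if v == w then P v else 0) ->
  (forall v, 0 <= eps v) -> (forall v, Q ** P v = 0 -> eps v = 0) ->
  exists w : B -> R[i]^o, [/\ bounded_linear w, forall b, w (Q ** b ** Q) = w b,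
    forall v, w (P v ** Q) = (eps v)%:C &
    forall a, D a -> 0 <= w (adj (a ** Q) ** (a ** Q))].
Proof.
move=> DP Padj PP eps0 epsP; pose e v := Q ** P v.
have PQ v : P v ** Q = e v by exact: (vac_comm ts).
have QQ := vacK ts; have Qadj : adj Q = Q := vac_adj ts.
have PPv v : P v ** P v = P v by rewrite PP eqxx.
have eadj v : adj (e v) = e v by rewrite /e adjM Padj Qadj PQ.
have ee v : e v ** e v = e v.
  by rewrite {1}/e -PQ -amulA (amulA (P v)) PPv PQ amulA QQ.
have eeA v c : e v ** (e v ** c) = e v ** c by rewrite amulA ee.
have eQ v : e v ** Q = e v by rewrite -PQ -amulA QQ.
have Qe v : Q ** e v = e v by rewrite amulA QQ.
have aE v a : D a -> a ** e v = e v ** a.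
  move=> Da; rewrite /e amulA (vac_comm ts Da) -!amulA; congr (_ ** _).
  exact: (ts_Dcomm ts).
have e0 v w : w != v -> e w ** (P v ** Q) = 0.
  by move=> wv; rewrite /e -amulA (amulA (P w)) PP (negbTE wv) amul0l amul0r.
have e_eps v : e v = 0 -> eps v = 0 := epsP v.
clearbody e.
have hg v := corner_functional hu (eadj v) (ee v) (eps0 v) (e_eps v).
pose g v := sval (cid (hg v)).
have gP v : [/\ bounded_linear (g v), g v (e v) = (eps v)%:C & forall h,
  adj h = h -> e v ** h = h -> h ** e v = h -> 0 <= g v (h ** h)].
  by rewrite /g; case: cid.
exists (fun b => \sum_v g v (e v ** b ** e v)); split.
- apply: bounded_linear_sum => v; have [gb _ _] := gP v.
  apply: (bounded_linear_mull (e v) (f := fun b => g v (b ** e v))).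
  exact: bounded_linear_mulr.
- by move=> b; apply: eq_bigr => v _; rewrite !amulA eQ -!amulA Qe.
- move=> v; have [gb <- _] := gP v.
  rewrite (bigD1 v)//= big1 ?addr0 => [|w wv]; first by rewrite PQ !ee.
  rewrite e0//.
  by have [gw _ _] := gP w; rewrite amul0l; exact: (lin0 gw.1).
move=> a Da; apply: sumr_ge0 => v _; have [gb _ gpos] := gP v.
have Dadj := ts_Dadj ts Da.
have -> : e v ** (adj (a ** Q) ** (a ** Q)) ** e v = e v ** (adj a ** a).
  rewrite adjM Qadj !amulA eQ -!amulA Qe (amulA (adj a)) aE ?eeA//.
  exact: (ts_DM ts).
pose h1 := e v ** (a + adj a); pose h2 := e v ** ('i *: (adj a - a)).
have Dlin := ts_Dlin ts; have D0 := ts_D0 ts.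
have Dh1 : D (a + adj a) by have := Dlin 1 _ _ Da Dadj; rewrite scale1r.
have Dh2 : D ('i *: (adj a - a)).
  have /(Dlin 'i _ _)/(_ D0) := Dlin (-1) _ _ Da Dadj.
  by rewrite scaleN1r addr0 (addrC (- a)).
have sq d : D d -> adj d = d -> 0 <= g v (e v ** (d ** d)).
  move=> Dd sd; have ->: e v ** (d ** d) = (e v ** d) ** (e v ** d).
    by rewrite -amulA (amulA d) aE// -amulA eeA.
  apply: gpos; first by rewrite adjM sd eadj aE.
    exact: eeA.
  by rewrite -amulA aE// eeA.
have := addr_ge0 (sq _ Dh1 _) (sq _ Dh2 _).
rewrite adjD adjK addrC adjsZ adjB adjK conj_i scaleNr -scalerN opprB.
rewrite -(linD gb.1) -amulDr => /(_ erefl erefl).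
(* [corner_functional] handles squares of selfadjoint elements only; commutativity of [D] writes
   [4 adj a ** a] as a sum of two of them. *)
have -> : (a + adj a) ** (a + adj a) + 'i *: (adj a - a) ** ('i *: (adj a - a)) =
    (4%:R : R)%:C *: (adj a ** a).
  rewrite amulZl amulZr scalerA mulii scaleN1r amulBl !amulBr amulDl !amulDr.
  have aa : a ** adj a = adj a ** a by exact: (ts_Dcomm ts).
  rewrite aa rmorph_nat scaler_nat !opprB !addrA.
  rewrite (ACl ((1*6)*(4*8)*2*3*5*7))/= ?subrr ?addNr ?add0r.
  by rewrite !mulrSr mulr0n add0r.
rewrite amulZr (linZ gb.1) -[_ *: _]/((4%:R)%:C * (g v _ : R[i])).
by rewrite pmulr_rge0// ltcR ltr0n.
Qed.

End Fock.

(** * The state of the Fock representation *)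

Section FockState.
Variables (R : realType) (B : cstarAlgType R) (u : B) (I : finType) (s : I -> B).
Variable D : set B.
Hypothesis ts : toeplitz_system u s D.
Hypothesis stab_dense : dense_seq (vac_stab u s D).
Variables (w : B -> R[i]^o) (q : R) (M : R).
Implicit Types (a b c : B) (e : I).

Local Notation Q := (vac u s).
Local Notation L := (transfer s).
Let hu := ts_unit ts.

Hypothesis wb : bounded_linear w.
Hypothesis wQ : forall b, w (Q ** b ** Q) = w b.
Hypothesis wD : forall a, D a -> 0 <= w (adj (a ** Q) ** (a ** Q)).

Definition fock_sum N b : R[i]^o :=
  \sum_(n < N) ((q ^+ n)%:C *: w (iter n L b)).

Hypothesis q0 : 0 <= q.
Hypothesis fock_sum_unit : forall N, complex.Re (fock_sum N u) <= M.

Let wlin : linear w. Proof. by case: wb. Qed.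

Let wpos c : 0 <= w (adj c ** c).
Proof.
move: c; apply: (dense_pos stab_dense wb) => c Sc.
rewrite -wQ; exact: (vac_stab_pos ts wlin wD).
Qed.

Let wL_le n b : nr (w (iter n L b) : R[i]) <= complex.Re (w (iter n L u)) * nr b.
Proof.
have wLlin : linear (fun b => w (iter n L b)).
  by move=> k a c; rewrite iter_transfer_linear wlin.
apply: (pos_le (tau := fun b => w (iter n L b)) hu wLlin) => a.
exact: iter_transfer_pos.
Qed.

Let Re_scale (x : R) (z : R[i]^o) : complex.Re (x%:C *: z : R[i]^o) = x * complex.Re z.
Proof. by rewrite -[_ *: _]/(x%:C * z : R[i]); case: z => a b /=; rewrite mul0r subr0. Qed.

Let Re_sum (J : Type) (r : seq J) (P : pred J) (F : J -> R[i]^o) :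
  complex.Re (\sum_(j <- r | P j) F j) = \sum_(j <- r | P j) complex.Re (F j).
Proof.
by apply: (big_morph (fun z : R[i]^o => complex.Re z)) => // -[x y] [x' y'].
Qed.

(** Each [w o L^n] is positive, so the terms at [b] are dominated by [nr b] times those at the unit,
    whose sums are bounded. *)
Lemma fock_limit b : exists l : R[i]^o, ccvg (fock_sum ^~ b) l.
Proof.
apply: (@csum_cvg _ (fun n => ((q ^+ n)%:C *: w (iter n L b) : R[i]^o))
  (fun n => q ^+ n * complex.Re (w (iter n L u)) * nr b) (M * nr b)).
  move=> n; rewrite -[nr _]/(nr ((q ^+ n)%:C * (w (iter n L b) : R[i]))).
  rewrite nrCM nrC ger0_norm ?exprn_ge0// -mulrA.
  by rewrite ler_wpM2l ?exprn_ge0.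
move=> N; rewrite -mulr_suml ler_wpM2r ?nr_ge0//.
apply: le_trans (fock_sum_unit N); rewrite /fock_sum Re_sum.
by apply: ler_sum => n _; rewrite Re_scale.
Qed.

Definition fock b : R[i]^o := sval (cid (fock_limit b)).

Lemma fock_cvg b : ccvg (fock_sum ^~ b) (fock b).
Proof. by rewrite /fock; case: cid. Qed.

Lemma fock_sum_linear N : linear (fock_sum N).
Proof.
move=> k a b; rewrite /fock_sum scaler_sumr -big_split/=; apply: eq_bigr => n _.
by rewrite iter_transfer_linear wlin scalerDr !scalerA mulrC.
Qed.

Lemma fock_linear : linear fock.
Proof.
move=> k a b; apply: (ccvg_unique (fock_cvg _)).
rewrite (_ : fock_sum ^~ _ = fun N => k *: fock_sum N a + fock_sum N b).
  by apply: ccvgD (fock_cvg b); apply: ccvgZ (fock_cvg a).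
by apply/funext => N; exact: fock_sum_linear.
Qed.

Lemma fock_pos a : 0 <= fock (adj a ** a).
Proof.
apply: (ccvg_ge0 (fock_cvg _)) => N; apply: sumr_ge0 => n _.
rewrite -[_ *: _]/((q ^+ n)%:C * (w _ : R[i])) mulr_ge0 ?ler0c ?exprn_ge0//.
exact: iter_transfer_pos.
Qed.

Lemma fock_bounded : bounded_linear fock.
Proof.
split; first exact: fock_linear.
exists (complex.Re (fock u)) => a; exact: (pos_le hu fock_linear fock_pos).
Qed.

Lemma fock_ext a b :
  (forall n, w (iter n L a) = w (iter n L b)) -> fock a = fock b.
Proof.
move=> h; apply: (ccvg_unique (fock_cvg a)).
rewrite (_ : fock_sum ^~ a = fock_sum ^~ b); first exact: fock_cvg.
by apply/funext => N; apply: eq_bigr => n _; rewrite h.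
Qed.

Lemma fock_rec b : fock b = w b + q%:C *: fock (L b).
Proof.
apply: (ccvg_unique (ccvgS (fock_cvg b))).
rewrite (_ : (fun n => _) = fun N => w b + q%:C *: fock_sum N (L b)).
  by apply: ccvgD; [exact: ccvg_cst|apply: ccvgZ; exact: fock_cvg].
apply/funext => N; rewrite /fock_sum big_ord_recl /= expr0 scale1r scaler_sumr.
congr (_ + _); apply: eq_bigr => n _; rewrite scalerA -rmorphM.
by rewrite /bump /= add1n exprS -iterS iterSr.
Qed.

(** Only [Q ** c ** Q] matters, and on a dense subalgebra it lies in [D Q], where [a] commutes with
    everything. *)
Let w_comm a c : D a -> w (a ** c) = w (c ** a).
Proof.
move=> Da; apply/eqP; rewrite -subr_eq0; apply/eqP; move: c.
apply: (dense_eq0 stab_dense (f := fun c => w (a ** c) - w (c ** a))).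
  by apply: bounded_linearB; [exact: bounded_linear_mull|exact: bounded_linear_mulr].
move=> c /(vac_corner ts)[b Db cE].
rewrite -(wQ (a ** c)) -(wQ (c ** a)).
have -> : Q ** (a ** c) ** Q = a ** (Q ** c ** Q).
  by rewrite !amulA (vac_comm ts Da).
have -> : Q ** (c ** a) ** Q = Q ** c ** Q ** a.
  by rewrite -!amulA (vac_comm ts Da).
rewrite cE amulA -(amulA b) -(vac_comm ts Da) amulA (ts_Dcomm ts Da Db).
exact: subrr.
Qed.

(** In each summand of [L (a ** b)], pulling [a] through [adj (s e)] leaves a coefficient of [D]
    times [adj (s e) ** b ** s e]; in [L (b ** a)] the same coefficient appears on the right.
    Induction on [n] reduces to [w_comm]. *)
Lemma fock_comm a b : D a -> fock (a ** b) = fock (b ** a).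
Proof.
move=> Da; apply: fock_ext => n; elim: n a b Da => [|n IH] a b Da.
  exact: w_comm.
rewrite !iterSr /transfer !(lin_sum (iter_transfer_linear s n)) !(lin_sum wlin).
apply: eq_bigr => e _; have [a1 [Da1 h1]] := ts_shift ts e Da.
have [a2 [Da2 h2]] := sadj_shift ts e Da.
have src := ts_src ts e.
have p1 : adj (s e) ** a = adj (s e) ** s e ** a1 ** adj (s e).
  by rewrite h2 -[in LHS](ts_iso_adj ts e) !amulA -h2 -(amulA _ a) h1 amulA.
have -> : adj (s e) ** (a ** b) ** s e =
    adj (s e) ** s e ** a1 ** (adj (s e) ** b ** s e).
  by rewrite amulA p1 !amulA.
have -> : adj (s e) ** (b ** a) ** s e =
    adj (s e) ** b ** s e ** (adj (s e) ** s e ** a1).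
  rewrite -(amulA (adj (s e) ** b)) (amulA (s e)) (ts_iso ts) -h1.
  by rewrite !amulA.
by apply: IH; exact: (ts_DM ts).
Qed.

(** The vacuum term is killed by [vac_s], and only the summand of [e] survives in [L (s e ** b)].
    There [adj (s e) ** s e] lies in [D], so it moves to the right and is absorbed by [s e]. *)
Lemma fock_s e b : fock (s e ** b) = q%:C *: fock (b ** s e).
Proof.
rewrite fock_rec -wQ amulA (vac_s ts) !amul0l (lin0 wlin) add0r.
congr (_ *: _); rewrite /transfer (bigD1 e)//= big1 ?addr0; last first.
  by move=> f fe; rewrite amulA (ts_orth ts)// !amul0l.
rewrite amulA -amulA fock_comm; last exact: (ts_src ts).
by rewrite -amulA (ts_iso ts).
Qed.

(** The phases cancel in [Q] and in [L], so [g] fixes the one and commutes with the other, and it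
    fixes the corner elements [a ** Q] that determine [w]. *)
Lemma fock_gauge (g : B -> B) (z : R[i]) : star_hom g ->
  (forall e, g (s e) = z *: s e) -> Num.conj z * z = 1 ->
  (forall a, D a -> g a = a) -> forall b, fock (g b) = fock b.
Proof.
move=> gh gs zz gD b; have [glin gM gadj] := gh.
have ss e c : adj (s e) ** g c ** s e = g (adj (s e) ** c ** s e).
  rewrite !gM gadj gs adjsZ !amulZl amulZr scalerA zz.
  by rewrite scale1r.
have gQ : g Q = Q.
  rewrite /vac (linB glin) (lin_sum glin) gD; last exact: (ts_D1 ts).
  congr (_ - _); apply: eq_bigr => e _.
  by rewrite gM gadj gs adjsZ amulZl amulZr scalerA mulrC zz scale1r.
have wg c : w (g c) = w c.
  apply/eqP; rewrite -subr_eq0; apply/eqP; move: c.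
  apply: (dense_eq0 stab_dense (f := fun c => w (g c) - w c)).
    apply: bounded_linearB => //; apply: (bounded_linear_comp wb glin).
    by exists 1 => c; rewrite mul1r; exact: (star_hom_le hu gh).
  move=> c /(vac_corner ts)[a Da cE].
  rewrite -wQ -[in Q ** g c ** Q]gQ -[X in _ - X]wQ -!gM cE gM gQ gD//.
  exact: subrr.
apply: fock_ext => n; elim: n b => [|n IH] b; first exact: wg.
rewrite !iterSr /transfer; rewrite (eq_bigr _ (fun e _ => ss e b)).
by rewrite -(lin_sum glin) IH.
Qed.

End FockState.

(** * The Toeplitz algebra of the graph *)

Section GraphSystem.
Variables (R : realType) (E : digraph).
Local Notation CE := (contfun R (inf_path E)).
Variables (A : cstarAlgType R) (p : vertex E -> A) (s : edge E -> A).
Hypothesis fam : graph_family p s.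
Hypothesis genA : cstar_generates (range p `|` range s).
Variables (B : cstarAlgType R) (psi pi : CE -> B).
Hypothesis rep : bimodule_rep psi pi.
Hypothesis genB : cstar_generates (range psi `|` range pi).
Variable h : A -> B.
Hypothesis h_hom : star_hom h.
Hypothesis h_s : forall e, h (s e) = psi (chi_edge R e).
Hypothesis h_p : forall v, h (p v) = pi (chi_vertex R v).
Hypothesis h_inj : injective h.
Implicit Types (a b c : A) (e f : edge E) (v w : vertex E).

Local Notation S := (fun e => psi (chi_edge R e)).
Local Notation P := (fun v => pi (chi_vertex R v)).
Local Notation uB := (pi (contfun1 R E)).

Definition graph_unit : A := \sum_v p v.
Local Notation uA := graph_unit.

Let hlin : linear h. Proof. by case: h_hom. Qed.
Let hM a b : h (a ** b) = h a ** h b. Proof. by case: h_hom. Qed.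
Let hadj a : h (adj a) = adj (h a). Proof. by case: h_hom. Qed.
Let huB : is_unit uB. Proof. exact: (bimodule_unit rep genB). Qed.

Lemma hom_graph_unit : h uA = uB.
Proof.
rewrite (lin_sum hlin) -(bimodule_vertex_sum rep).
by apply: eq_bigr => v _; exact: h_p.
Qed.

Lemma graph_unitP : is_unit uA.
Proof.
move=> a; split; apply: h_inj; rewrite hM hom_graph_unit.
  exact: unit_mull.
exact: unit_mulr.
Qed.

Lemma vertex_adj v : adj (p v) = p v.
Proof. by case: fam => /(_ v)[]. Qed.

Lemma vertexM v w : p v ** p w = if v == w then p v else 0.
Proof.
case: fam => /(_ v)[_ pp] + _ _ _ => /(_ v w).
by case: eqP => [<- _//|_]; exact.
Qed.

(** Injectivity of [h] pulls the relation back from functions on E^oo, avoiding the order relation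
    in [graph_family]; [edge_orth] is obtained likewise. *)
Lemma vertex_edge v e : p v ** s e = if v == rng e then s e else 0.
Proof.
apply: h_inj; rewrite hM h_p h_s (bimodule_rng rep genB).
by case: eqP => _; rewrite ?h_s// (lin0 hlin).
Qed.

Lemma edge_orth e f : e != f -> adj (s e) ** s f = 0.
Proof.
move=> ef; apply: h_inj; rewrite hM hadj !h_s (lin0 hlin) (bimodule_src rep).
by rewrite eq_sym (negbTE ef).
Qed.

Lemma edge_src e : adj (s e) ** s e = p (src e).
Proof. by case: fam. Qed.

Definition vertex_span : set A :=
  [set a | exists c : vertex E -> R[i], a = \sum_v c v *: p v].

Let spanE (c : vertex E -> R[i]) : vertex_span (\sum_v c v *: p v).
Proof. by exists c. Qed.

Lemma vertex_span_vertex v : vertex_span (p v).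
Proof.
exists (fun w => if w == v then 1 else 0).
rewrite (bigD1 v)//= eqxx scale1r big1 ?addr0// => w /negbTE ->.
by rewrite scale0r.
Qed.

Let spanM (c d : vertex E -> R[i]) :
  (\sum_v c v *: p v) ** (\sum_v d v *: p v) = \sum_v (c v * d v) *: p v.
Proof.
rewrite amul_suml; apply: eq_bigr => v _; rewrite amul_sumr (bigD1 v)//= big1.
  by rewrite addr0 amulZl amulZr vertexM eqxx scalerA.
move=> w wv; rewrite amulZl amulZr vertexM eq_sym (negbTE wv).
by rewrite !scaler0.
Qed.

Lemma span_edge (c : vertex E -> R[i]) e :
  (\sum_v c v *: p v) ** s e = c (rng e) *: s e.
Proof.
rewrite amul_suml (bigD1 (rng e))//= big1 => [|v ve].
  by rewrite addr0 amulZl vertex_edge eqxx.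
by rewrite amulZl vertex_edge (negbTE ve) scaler0.
Qed.

Lemma graph_system : toeplitz_system uA s vertex_span.
Proof.
have uS : vertex_span uA.
  by exists (fun=> 1); apply: eq_bigr => v _; rewrite scale1r.
have spanZ (k : R[i]) : vertex_span (k *: uA).
  by exists (fun=> k); rewrite /uA scaler_sumr.
split => //.
- exact: graph_unitP.
- move=> k _ _ [c ->] [d ->]; exists (fun v => k * c v + d v).
  rewrite scaler_sumr -big_split/=; apply: eq_bigr => v _.
  by rewrite scalerDl scalerA.
- by move=> _ _ [c ->] [d ->]; rewrite spanM.
- move=> _ [c ->]; exists (fun v => Num.conj (c v)).
  by rewrite adj_sum; apply: eq_bigr => v _; rewrite adjsZ vertex_adj.
- move=> _ _ [c ->] [d ->]; rewrite !spanM; apply: eq_bigr => v _.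
  by rewrite mulrC.
- move=> _ e [c ->]; exists (c (rng e) *: uA); split=> //.
  by rewrite span_edge amulZr (unit_mulr _ graph_unitP).
- exact: edge_orth.
- by move=> e; rewrite edge_src; exact: vertex_span_vertex.
- by move=> e; rewrite amulA; case: fam.
Qed.

Lemma graph_stab_dense : dense_seq (vac_stab uA s vertex_span).
Proof.
apply: (generates_dense genA); first exact: vac_stab_star_subalgebra.
move=> _ [[v _ <-]|[e _ <-]].
  exact/(vac_stab_coef graph_system)/vertex_span_vertex.
exact: (vac_stab_s graph_system).
Qed.

Lemma hom_vac : h (vac uA s) = vac uB S.
Proof.
rewrite /vac (linB hlin) hom_graph_unit (lin_sum hlin); congr (_ - _).
by apply: eq_bigr => e _; rewrite hM hadj h_s.
Qed.

Lemma hom_transfer b : h (transfer s b) = transfer S (h b).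
Proof.
rewrite /transfer (lin_sum hlin); apply: eq_bigr => e _.
by rewrite !hM hadj h_s.
Qed.

Lemma hom_iter_transfer n b : h (iter n (transfer s) b) = iter n (transfer S) (h b).
Proof. by elim: n => [//|n IH]; rewrite !iterS hom_transfer IH. Qed.

Lemma iter_transfer_unit n :
  iter n (transfer s) uA = \sum_v (path_count n v)%:R *: p v.
Proof.
elim: n => [|n IH]; first by apply: eq_bigr => v _; rewrite scale1r.
rewrite iterS IH /transfer.
transitivity (\sum_e (path_count n (rng e))%:R *: p (src e) : A).
  by apply: eq_bigr => e _; rewrite -amulA span_edge amulZr edge_src.
rewrite (partition_big (@src E) predT)//=; apply: eq_bigr => v _.
by rewrite natr_sum scaler_suml; apply: eq_bigr => e /eqP ->.
Qed.

Lemma vertex_inhabited v : p v != 0 -> exists z : inf_path E, irng z = v.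
Proof.
move=> pv; apply: contrapT => hv; move/negP: pv; apply.
apply/eqP/h_inj; rewrite h_p (lin0 hlin).
have [pilin _ _] : star_hom pi by case: rep.
rewrite -(lin0 pilin); congr (pi _); apply: contfunP => z; rewrite chi_vertexE.
by case: eqP => // zv; case: hv; exists z.
Qed.

End GraphSystem.

(** * Extension of KMS states *)

Section Extension.
Variables (R : realType) (E : digraph).
Local Notation CE := (contfun R (inf_path E)).
Variables (A : cstarAlgType R) (p : vertex E -> A) (s : edge E -> A).
Hypothesis fam : graph_family p s.
Hypothesis genA : cstar_generates (range p `|` range s).
Variables (B : cstarAlgType R) (psi pi : CE -> B).
Hypothesis rep : bimodule_rep psi pi.
Hypothesis genB : cstar_generates (range psi `|` range pi).
Variable h : A -> B.
Hypothesis h_hom : star_hom h.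
Hypothesis h_s : forall e, h (s e) = psi (chi_edge R e).
Hypothesis h_p : forall v, h (p v) = pi (chi_vertex R v).
Hypothesis h_inj : injective h.
Variable gammaA : R[i]^o -> A -> A.
Hypothesis gammaA_act : circle_action gammaA.
Hypothesis gammaA_s : forall z e, `|z| = 1 -> gammaA z (s e) = (z : R[i]) *: s e.
Hypothesis gammaA_p : forall z v, `|z| = 1 -> gammaA z (p v) = p v.
Variable gammaB : R[i]^o -> B -> B.
Hypothesis gammaB_act : circle_action gammaB.
Hypothesis gammaB_psi :
  forall z x, `|z| = 1 -> gammaB z (psi x) = (z : R[i]) *: psi x.
Hypothesis gammaB_pi : forall z a, `|z| = 1 -> gammaB z (pi a) = pi a.
Variable beta : R.
Hypothesis beta_gt : beta_c R E < beta.
Variable phi : A -> R[i]^o.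
Hypothesis phi_KMS : KMS_state (dynamics gammaA) beta phi.
Implicit Types (a b : A) (e : edge E) (v : vertex E).

Local Notation S := (fun e => psi (chi_edge R e)).
Local Notation P := (fun v => pi (chi_vertex R v)).
Local Notation uA := (graph_unit p).
Local Notation uB := (pi (contfun1 R E)).
Local Notation QA := (vac uA s).
Local Notation QB := (vac uB S).
Local Notation LA := (transfer s).
Local Notation LB := (transfer S).
Local Notation q := (expR (- beta)).

Let tsA := graph_system fam rep genB h_hom h_s h_p h_inj.
Let tsB := bimodule_system rep genB.
Let huA : is_unit uA := ts_unit tsA.
Let huB : is_unit uB := ts_unit tsB.
Let phi_state : state phi := phi_KMS.1.
Let flin : linear phi. Proof. by case: phi_state. Qed.
Let fpos a : 0 <= phi (adj a ** a). Proof. by case: phi_state. Qed.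
Let fu : phi uA = 1. Proof. exact: (state_unit huA phi_state). Qed.
Let fb : bounded_linear phi. Proof. exact: (state_bounded huA phi_state). Qed.
Let hlin : linear h. Proof. by case: h_hom. Qed.

Let hom_p v : homogeneous gammaA 0 (p v).
Proof. by apply: homogeneous0 => // z z1; exact: gammaA_p. Qed.

Let hom_s e : homogeneous gammaA 1 (s e).
Proof. by apply: homogeneous1 => // z z1; exact: gammaA_s. Qed.

Let hom_lin k (c : R[i]) a b : homogeneous gammaA k a -> homogeneous gammaA k b ->
  homogeneous gammaA k (c *: a + b).
Proof.
move=> ha hb t; have [dlin _ _] := dynamics_hom gammaA_act t.
by rewrite dlin ha hb scalerDr !scalerA mulrC.
Qed.

Let hom_sum (J : finType) (F : J -> A) :
  (forall j, homogeneous gammaA 0 (F j)) -> homogeneous gammaA 0 (\sum_j F j).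
Proof.
move=> hF; elim/big_ind: _ => [t|a b ha hb|//].
  by have [dlin _ _] := dynamics_hom gammaA_act t; rewrite (lin0 dlin) scaler0.
by have := hom_lin 1 ha hb; rewrite scale1r.
Qed.

Let hom_uA : homogeneous gammaA 0 uA.
Proof. exact: hom_sum. Qed.

Let hom_QA : homogeneous gammaA 0 QA.
Proof.
have := hom_lin (-1) (hom_sum (F := fun e => s e ** adj (s e)) _) hom_uA.
rewrite scaleN1r addrC; apply => e.
rewrite -[0](subrr 1); apply: homogeneousM => //.
exact: homogeneous_adj.
Qed.

Let hom_dense : dense_seq (lspan (homogeneous_set gammaA)).
Proof.
apply: (generates_dense genA); first exact: homogeneous_star_subalgebra.
move=> _ [[v _ <-]|[e _ <-]]; apply: lspan_sub; first by exists 0.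
by exists 1.
Qed.

(** [QA] is gauge invariant, hence commutes with everything under [phi]. *)
Let phi_QA b : phi (QA ** b) = phi (QA ** b ** QA).
Proof.
rewrite -[in LHS](vacK tsA) -amulA.
rewrite (KMS_homogeneous gammaA_act huA hom_dense _ phi_KMS hom_QA).
by rewrite oppr0 mul0r expR0 mul1r.
Qed.

Let phi_s e b : phi (s e ** b) = q%:C *: phi (b ** s e).
Proof.
rewrite (KMS_homogeneous gammaA_act huA hom_dense _ phi_KMS (hom_s e)).
by rewrite mulN1r.
Qed.

(** Splits [b] by [1 = QA + sum_e s e ** adj (s e)] and moves the leading [s e] to the right at the
    cost of [e^-beta]. *)
Let phi_rec b : phi b = phi (QA ** b ** QA) + q%:C *: phi (LA b).
Proof.
have {1}-> : b = QA ** b + \sum_e s e ** (adj (s e) ** b).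
  rewrite /vac amulBl (unit_mull _ huA) amul_suml.
  by under [X in _ + X]eq_bigr do rewrite amulA; rewrite subrK.
rewrite (linD flin) phi_QA; congr (_ + _).
rewrite /transfer !(lin_sum flin) scaler_sumr; apply: eq_bigr => e _.
by rewrite phi_s.
Qed.

Let phi_proj a : adj a = a -> a ** a = a -> phi a = (complex.Re (phi a))%:C /\
  0 <= complex.Re (phi a).
Proof.
move=> sa aa; have := fpos a; rewrite sa aa => pa; split.
  by rewrite RRe_real// ger0_real.
by move: pa; case: (phi a) => x y; rewrite lecE => /andP[].
Qed.

Let vertex_vac v : p v ** QA = QA ** p v.
Proof. by apply: (vac_comm tsA); exact: vertex_span_vertex. Qed.

Let pAdj v : adj (p v) = p v. Proof. exact: (vertex_adj fam). Qed.

Let pM v w : p v ** p w = if v == w then p v else 0.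
Proof. exact: (vertexM fam). Qed.

Let vv_proj v : adj (QA ** p v) = QA ** p v /\
  (QA ** p v) ** (QA ** p v) = QA ** p v.
Proof.
split; first by rewrite adjM pAdj (vac_adj tsA) vertex_vac.
by rewrite -{1}vertex_vac -amulA (amulA QA) (vacK tsA) amulA vertex_vac -amulA
  pM eqxx.
Qed.

Let eps v := complex.Re (phi (QA ** p v)).

Let epsE v : phi (QA ** p v) = (eps v)%:C.
Proof. by have [h1 h2] := vv_proj v; case: (phi_proj h1 h2). Qed.

Let eps_ge0 v : 0 <= eps v.
Proof. by have [h1 h2] := vv_proj v; case: (phi_proj h1 h2). Qed.

(** Injectivity of [h] makes the prescribed values attainable: a vanishing projection is asked to
    carry no mass. *)
Let eps_eq0 v : QB ** P v = 0 -> eps v = 0.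
Proof.
have [_ hM _] := h_hom.
rewrite -(hom_vac rep h_hom h_s h_p) -h_p -hM -(lin0 hlin) => /h_inj.
by rewrite /eps => ->; rewrite (lin0 flin).
Qed.

Let PD v : range pi (P v). Proof. by exists (chi_vertex R v). Qed.

Let PAdj v : adj (P v) = P v.
Proof. by have [_ _ hadj] := h_hom; rewrite -h_p -hadj pAdj. Qed.

Let PM v w : P v ** P w = if v == w then P v else 0.
Proof.
have [_ hM _] := h_hom; rewrite -!h_p -hM pM.
by case: eqP => // _; exact: lin0.
Qed.

Let w := sval (cid (vacuum_functional tsB PD PAdj PM eps_ge0 eps_eq0)).

Let wP : [/\ bounded_linear w, forall b : B, w (QB ** b ** QB) = w b,
    forall v, w (P v ** QB) = (eps v)%:C &
    forall a : B, range pi a -> 0 <= w (adj (a ** QB) ** (a ** QB))].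
Proof. by rewrite /w; case: cid. Qed.

Let wb : bounded_linear w. Proof. by case: wP. Qed.
Let wQ (b : B) : w (QB ** b ** QB) = w b. Proof. by case: wP. Qed.
Let wD (a : B) : range pi a -> 0 <= w (adj (a ** QB) ** (a ** QB)).
Proof. by case: wP => _ _ _; exact. Qed.

Let h_bounded : exists C, forall a : A, nr (h a) <= C * nr a.
Proof. by exists 1 => a; rewrite mul1r; exact: star_hom_le huA h_hom a. Qed.

(** Both sides depend only on the compression to the vacuum corner, which on a dense subalgebra is a
    combination of the [p v ** QA], where [w] was chosen to agree. *)
Let w_hom b : w (h b) = phi (QA ** b ** QA).
Proof.
have [_ hM _] := h_hom.
apply/eqP; rewrite -subr_eq0; apply/eqP; move: b.
have dA := graph_stab_dense fam genA rep genB h_hom h_s h_p h_inj.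
apply: (dense_eq0 dA (f := fun b => w (h b) - phi (QA ** b ** QA))).
  apply: bounded_linearB; first exact: bounded_linear_comp wb hlin h_bounded.
  apply: (bounded_linear_mull QA (f := fun b => phi (b ** QA))).
  exact: bounded_linear_mulr.
move=> c /(vac_corner tsA)[_ [k ->] cE].
rewrite cE -wQ -(hom_vac rep h_hom h_s h_p) -!hM cE amul_suml.
rewrite (lin_sum hlin) (lin_sum wb.1) (lin_sum flin) -sumrB big1// => v _.
rewrite amulZl (linZ hlin) (linZ wb.1) (linZ flin) hM h_p.
rewrite (hom_vac rep h_hom h_s h_p) vertex_vac epsE.
by case: wP => _ _ -> _; exact: subrr.
Qed.

Let phi_iter N b : phi b = fock_sum S w q N (h b) +
  (q ^+ N)%:C *: phi (iter N LA b).
Proof.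
elim: N => [|N IH]; first by rewrite /fock_sum big_ord0 add0r expr0 scale1r.
rewrite {1}IH /fock_sum big_ord_recr /= -addrA; congr (_ + _).
rewrite {1}phi_rec -w_hom scalerDr scalerA -rmorphM exprSr.
by rewrite (hom_iter_transfer h_hom h_s).
Qed.

Let phi_iter_le N b : nr (phi (iter N LA b) : R[i]) <=
  complex.Re (phi (iter N LA uA)) * nr b.
Proof.
have lin : linear (fun b => phi (iter N LA b)).
  by move=> k x y; rewrite iter_transfer_linear flin.
apply: (pos_le (tau := fun b => phi (iter N LA b)) huA lin) => a.
exact: iter_transfer_pos.
Qed.

Let phi_iter_unit N : 0 <= complex.Re (phi (iter N LA uA)) <= max_preim_card R E N.
Proof.
rewrite (iter_transfer_unit fam rep genB h_hom h_s h_p h_inj) (lin_sum flin).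
have pv v : phi (p v) = (complex.Re (phi (p v)))%:C /\ 0 <= complex.Re (phi (p v)).
  by apply: phi_proj => //; rewrite pM eqxx.
have fuE : \sum_v complex.Re (phi (p v)) = 1.
  apply: (@complexI R); rewrite rmorph_sum rmorph1 -[RHS]fu (lin_sum flin).
  by apply: eq_bigr => v _; apply/esym; exact: (pv v).1.
have -> : complex.Re (\sum_v phi ((path_count N v)%:R *: p v)) =
    \sum_v (path_count N v)%:R * complex.Re (phi (p v)).
  rewrite -[RHS]/(complex.Re ((\sum_v (path_count N v)%:R * complex.Re (phi (p v)))%:C)).
  congr complex.Re; rewrite rmorph_sum /=; apply: eq_bigr => v _.
  by rewrite (linZ flin) rmorphM rmorph_nat [in LHS](pv v).1.
apply/andP; split.
  by apply: sumr_ge0 => v _; rewrite mulr_ge0// (pv v).2.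
rewrite -[leRHS]mulr1 -[X in _ <= _ * X]fuE mulr_sumr; apply: ler_sum => v _.
(* A vanishing [p v] has no weight. Otherwise [v] is the range of an infinite path, so its path
   count is one of the cardinalities under the supremum. *)
have [p0|p0] := eqVneq (p v) 0; first by rewrite p0 (lin0 flin) !mulr0.
have [z <-] := vertex_inhabited rep h_hom h_p h_inj p0.
by apply: ler_wpM2r; [exact: (pv _).2|exact: path_count_le_max].
Qed.

(** [phi_iter] writes [phi 1 = 1] as this partial sum plus a nonnegative remainder. *)
Let fock_sum_unit N : complex.Re (fock_sum S w q N uB) <= 1.
Proof.
rewrite -(hom_graph_unit rep h_hom h_p).
have := phi_iter N uA; rewrite fu => /(congr1 (@complex.Re R)).
have /andP[] := phi_iter_unit N.
case: (phi _) => x y /= x0 _; case: (fock_sum _ _ _ _ _) => x' y' /= ->.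
by rewrite mul0r subr0 lerDl mulr_ge0// exprn_ge0// expR_ge0.
Qed.

Let q0 : 0 <= q. Proof. exact: expR_ge0. Qed.
Let dB := bimodule_stab_dense rep genB.
Let Phi : B -> R[i]^o := fock tsB dB wb wQ wD q0 fock_sum_unit.

Let Phi_hom a : phi a = Phi (h a).
Proof.
have cvgPhi : ccvg (fun N => fock_sum S w q N (h a)) (Phi (h a)) by exact: fock_cvg.
apply/esym/(ccvg_unique cvgPhi) => e e0.
have e'0 : 0 < e / (nr a + 1) by rewrite divr_gt0// ltr_wpDl ?nr_ge0.
have [N hN] := max_preim_card_decay beta_gt e'0.
exists N => n /hN; rewrite ltr_pdivlMr ?ltr_wpDl ?nr_ge0// => hn.
rewrite {1}(phi_iter n a) opprD addrA subrr sub0r nrN.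
rewrite -[_ *: _]/((q ^+ n)%:C * (phi _ : R[i])) nrCM nrC ger0_norm ?exprn_ge0//.
rewrite (le_lt_trans _ hn)// -expRM_natl (mulrC n%:R) -mulrA.
rewrite ler_wpM2l ?expR_ge0// (le_trans (phi_iter_le n a))//.
have /andP[x0 xM] := phi_iter_unit n.
by rewrite ler_pM ?nr_ge0// lerDl.
Qed.

Let Phi_bounded : bounded_linear Phi. Proof. exact: fock_bounded. Qed.
Let Phi_lin : linear Phi. Proof. by case: Phi_bounded. Qed.
Let Phi_pos (a : B) : 0 <= Phi (adj a ** a). Proof. exact: fock_pos. Qed.

Let Phi_state : state Phi.
Proof.
apply: (unit_state huB Phi_lin Phi_pos).
by rewrite -(hom_graph_unit rep h_hom h_p) -Phi_hom.
Qed.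

Let Phi_gauge t (a : B) : Phi (dynamics gammaB t a) = Phi a.
Proof.
have n1 : `|cis t : R[i]^o| = 1 by rewrite [LHS](nrE (cis t : R[i])) nr_cis.
apply: (fock_gauge _ _ _ _ _ _ _ (z := cis t)).
- exact: dynamics_hom.
- by move=> e; exact: gammaB_psi.
- by rewrite conj_cis -cisD addNr cis0.
- by move=> _ [b _ <-]; exact: gammaB_pi.
Qed.

(** Homogeneous elements obeying the KMS relation against every [a]. Products and adjoints preserve
    this, so checking the generators suffices. *)
Let twisted : set B := [set y | exists k, homogeneous gammaB k y /\
  forall a : B, Phi (y ** a) = (expR (- k * beta))%:C * (Phi (a ** y) : R[i])].

Let twisted_star_subalgebra : star_subalgebra (lspan twisted).
Proof.
apply: lspan_star_subalgebra => [y z [k [ky yk]] [l [lz zl]]|y [k [ky yk]]].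
  exists (k + l); split=> [|a]; first exact: homogeneousM.
  by rewrite -amulA yk -amulA zl amulA mulrA -rmorphM -expRD -mulrDl -opprD.
exists (- k); split=> [|a]; first exact: homogeneous_adj.
rewrite -[a in LHS]adjK -adjM (pos_adj huB Phi_lin Phi_pos).
rewrite -[in RHS](adjK (a ** adj y)) (pos_adj huB Phi_lin Phi_pos) adjM adjK yk.
have conjE (x : R) (t : R[i]) : Num.conj (x%:C * t) = x%:C * Num.conj t.
  by rewrite rmorphM; congr (_ * _); exact: conj_real.
rewrite conjE mulrA -rmorphM -expRD opprK -mulrDl subrr mul0r.
by rewrite expR0 mul1r.
Qed.

Let twisted_dense : dense_seq (lspan twisted).
Proof.
apply: (generates_dense genB) => //.
have [S0 SD SM _] := twisted_star_subalgebra.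
have tpi (a : CE) : lspan twisted (pi a).
  apply: lspan_sub; exists 0; split.
    by apply: homogeneous0 => // z z1; exact: gammaB_pi.
  move=> b; rewrite oppr0 mul0r expR0 mul1r; apply: fock_comm.
  by exists a.
move=> _ [[x _ <-]|[a _ <-]]; last exact: tpi.
rewrite (bimodule_expand rep genB); elim/big_ind: _ => [//|b c Sb Sc|e _].
  by have := SD 1 b c Sb Sc; rewrite scale1r.
apply: SM (tpi _); apply: lspan_sub; exists 1; split.
  by apply: homogeneous1 => // z z1; exact: gammaB_psi.
by move=> b; rewrite mulN1r; exact: fock_s.
Qed.

Lemma KMS_extension : exists Phi : B -> R[i]^o,
  KMS_state (dynamics gammaB) beta Phi /\ forall a, phi a = Phi (h a).
Proof.
exists Phi; split; last exact: Phi_hom.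
split; first exact: Phi_state.
move=> a b F _ aF; apply: (KMS_of_homogeneous gammaB_act _ twisted_dense
  Phi_bounded Phi_gauge _ _ aF) => // g dg g0.
(* The claim concerns a scalar function only, so the given state [phi] on the smaller algebra can
   prove it. *)
exact: (KMS_identity gammaA_act huA phi_KMS hom_uA dg g0).
Qed.

End Extension.

Theorem corollary7p8 (R : realType) (E : digraph) (E_cycle : has_cycle E)
  (* (TE, p, s) is the Toeplitz algebra of E *)
  (TE : cstarAlgType R) (p : vertex E -> TE) (s : edge E -> TE)
  (TE_univ : graph_toeplitz p s)
  (* (TX, psi, pi) is the Toeplitz algebra of X(E^oo) *)
  (TX : cstarAlgType R) (psi pi : contfun R (inf_path E) -> TX)
  (TX_univ : bimodule_toeplitz psi pi)
  (pi_SP : TE -> TX) (pi_SP_hom : star_hom pi_SP)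
  (pi_SP_s : forall e, pi_SP (s e) = psi (chi_edge R e))
  (pi_SP_p : forall v, pi_SP (p v) = pi (chi_vertex R v))
  (pi_SP_inj : injective pi_SP)
  (gammaE : R[i]^o -> TE -> TE) (gammaE_act : circle_action gammaE)
  (gammaE_s : forall z e, `|z| = 1 -> gammaE z (s e) = (z : R[i]) *: s e)
  (gammaE_p : forall z v, `|z| = 1 -> gammaE z (p v) = p v)
  (gammaX : R[i]^o -> TX -> TX) (gammaX_act : circle_action gammaX)
  (gammaX_psi : forall z x, `|z| = 1 -> gammaX z (psi x) = (z : R[i]) *: psi x)
  (gammaX_pi : forall z a, `|z| = 1 -> gammaX z (pi a) = pi a)
  (beta : R)
  (beta_gt : Num.max (beta_c R E) (ln (spectral_radius (vertex_matrix R E)))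
             < beta)
  (phi : TE -> R[i]^o) (phi_KMS : KMS_state (dynamics gammaE) beta phi) :
  exists Phi : TX -> R[i]^o,
    KMS_state (dynamics gammaX) beta Phi /\ forall a, phi a = Phi (pi_SP a).
Proof.
have [fam genA _] := TE_univ; have [rep genB _] := TX_univ.
have beta_c_lt : beta_c R E < beta by move: beta_gt; rewrite gt_max => /andP[].
exact: (KMS_extension fam genA rep genB pi_SP_hom pi_SP_s pi_SP_p pi_SP_inj
  gammaE_act gammaE_s gammaE_p gammaX_act gammaX_psi gammaX_pi beta_c_lt phi_KMS).
Qed.
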